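(* Let $x\in[n]$ and $\tilde w\in S_{\hat x}\subset\tilde S_n$. The map $\varphi^Q_{\mathrm{EG}}$, sending an affine factorization of $\tilde w$ with $m$ factors to its Edelman–Greene recording tableau $Q$, is a crystal isomorphism $$B(\tilde w)\cong\bigoplus_\lambda B(\lambda)^{\oplus a_{\tilde w,\lambda}};$$ in particular $\varphi^Q_{\mathrm{EG}}\circ\tilde e_i=\tilde e_i\circ\varphi^Q_{\mathrm{EG}}$ and $\varphi^Q_{\mathrm{EG}}\circ\tilde f_i=\tilde f_i\circ\varphi^Q_{\mathrm{EG}}$ for all $1\le i<m$.
   Context: $\tilde S_n$: affine symmetric group on $s_0,\dots,s_{n-1}$ (relations $s_i^2=1$, $s_is_{i+1}s_i=s_{i+1}s_is_{i+1}$, $s_is_j=s_js_i$ for $|i-j|>1$, mod $n$), $[n]=\{0,\dots,n-1\}$, $S_{\hat x}$ generated by $s_i$, $i\ne x$. $\ell$ is length, $\mathrm{con}(w)$ the letters of a reduced word. Cyclically decreasing element: $s_{i_1}\cdots s_{i_p}$ for a word with no repeated letter in which for no $j$ does $j-1$ occur left of $j$; determined by its content. Affine factorization of weight $\alpha\in\mathbb Z_{\ge0}^m$: $\tilde w=w^m\cdots w^1$, $w^i$ cyclically decreasing, $\ell(w^i)=\alpha_i$, $|\alpha|=\ell(\tilde w)$. Order $[n]\setminus\{x\}$ by $x-1>\cdots>0>n-1>\cdots>x+1$ (max/min/comparisons below use this). $uv$-pairing: process $b\in\mathrm{con}(u)$ from largest to smallest, pair $b$ with the smallest not-yet-paired $a\in\mathrm{con}(v)$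 with $a>b$ (else unpaired). $L_r$/$R_r$: unpaired elements of $\mathrm{con}(w^{r+1})$/$\mathrm{con}(w^r)$ in the $w^{r+1}w^r$-pairing. $\tilde e_r$: $\mathbf0$ if $L_r=\emptyset$; else with $b=\min L_r$, $t=\min\{i\ge0:b-i-1\notin\mathrm{con}(w^{r+1})\}$, replace contents by $\mathrm{con}(w^{r+1})\setminus\{b\}$, $\mathrm{con}(w^r)\cup\{b-t\}$. $\tilde f_r$: $\mathbf0$ if $R_r=\emptyset$; else with $a=\max R_r$, $s=\min\{i\ge0:a+i+1\notin\mathrm{con}(w^r)\}$, contents become $\mathrm{con}(w^{r+1})\cup\{a+s\}$, $\mathrm{con}(w^r)\setminus\{a\}$. $B(\tilde w)$: vertices the factorizations with $m$ factors, edges $\tilde f_r$. EG insertion of a letter $a$ into a row (letters compared by the order above): let $b$ be the smallest letter $>a$ in the row; if none, append $a$; if $b=a+1$ (mod $n$) and $a$ is in the row, insert $a+1$ into the next row up; otherwise replace $b$ by $a$ and insert $b$ into the next row up. Starting with $P^0=Q^0=\emptyset$, for $i=1,\dots,m$ let $P^i$ be obtained by inserting the letters of $\mathrm{con}(w^i)$ into the bottom row of $P^{i-1}$ one at a time from smallest to largest, and $Q^i$ by adding letter $i$ to $Q^{i-1}$ in the cells of $\mathrm{shape}(P^i)/\mathrm{shape}(P^{i-1})$; $\varphi^Q_{\mathrm{EG}}(w^m\cdots w^1)=Q^m$, a semistandard tableau (French convention) over $\{1,\dots,m\}$. On tableaux $\tilde e_i,\tilde f_i$ are the usual crystal operators: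 scanning columns right to left, each bottom to top, pair each $i+1$ with the closest previously scanned unpaired $i$; $\tilde f_i$ changes the rightmost unpaired $i$ into $i+1$, $\tilde e_i$ the leftmost unpaired $i+1$ into $i$. $B(\lambda)$ is the crystal of semistandard tableaux of shape $\lambda$ over $\{1,\dots,m\}$. $a_{\tilde w,\lambda}$ is the coefficient of the Schur function $s_\lambda$ in $F_{\tilde w}=\sum_\alpha|\{\text{affine factorizations of }\tilde w\text{ of weight }\alpha\}|x^\alpha$. *)

(* Defs.v *)
From HB Require Import structures.
From mathcomp Require Import all_boot all_order all_algebra generic_quotient.
From mathcomp Require Import finmap.
From mathcomp Require Import boolp classical_sets functions cardinality fsbigop.

Set Implicit Arguments.
Unset Strict Implicit.
Unset Printing Implicit Defensive.

Local Open Scope classical_set_scope.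

Section AffineSymmetricGroup.
Variable n : nat.
Implicit Types (i j : 'I_n) (p q u v : seq 'I_n).

(* [ordS] and [ord_pred] are i |-> i+1 and i |-> i-1 modulo n. *)
Inductive aff_relation : seq 'I_n -> seq 'I_n -> Prop :=
| aff_sqr i : aff_relation [:: i; i] [::]
| aff_braid i : aff_relation [:: i; ordS i; i] [:: ordS i; i; ordS i]
| aff_comm i j : i != j -> j != ordS i -> i != ordS j ->
    aff_relation [:: i; j] [:: j; i].

(* The generators are involutions, so the monoid presented by these relations
   is the group presented by them. *)
Inductive aff_eq : seq 'I_n -> seq 'I_n -> Prop :=
| aff_eq_step p q u v : aff_relation u v -> aff_eq (p ++ u ++ q) (p ++ v ++ q)
| aff_eq_refl u : aff_eq u u
| aff_eq_sym u v : aff_eq u v -> aff_eq v u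
| aff_eq_trans u v p : aff_eq u v -> aff_eq v p -> aff_eq u p.

Definition aff_eqb : rel (seq 'I_n) := fun u v => `[< aff_eq u v >].

Lemma aff_eqb_refl : reflexive aff_eqb.
Proof. by move=> u; apply/asboolP/aff_eq_refl. Qed.

Lemma aff_eqb_sym : symmetric aff_eqb.
Proof. by move=> u v; apply/asboolP/asboolP; apply: aff_eq_sym. Qed.

Lemma aff_eqb_trans : transitive aff_eqb.
Proof.
by move=> v u p /asboolP uv /asboolP vp; apply/asboolP/(aff_eq_trans uv vp).
Qed.

Canonical aff_equiv := EquivRel aff_eqb aff_eqb_refl aff_eqb_sym aff_eqb_trans.

Definition affine_sym := {eq_quot aff_equiv}%qT.
HB.instance Definition _ := Choice.on affine_sym.

Definition aff_class u : affine_sym := (\pi_({eq_quot aff_equiv}) u)%qT.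

Lemma aff_classP u v : aff_class u = aff_class v <-> aff_eq u v.
Proof.
split=> [|uv]; last by apply/eqmodP/asboolP.
by move/eqmodP/asboolP.
Qed.

Lemma aff_classK (w : affine_sym) : aff_class (repr w) = w.
Proof. exact: reprK. Qed.

Lemma aff_eq_catl p u v : aff_eq u v -> aff_eq (p ++ u) (p ++ v).
Proof.
elim=> {u v} [p' q u v uv|u|u v _|u v q _ uv _ vq].
- by rewrite !(catA p p'); apply: aff_eq_step.
- exact: aff_eq_refl.
- exact: aff_eq_sym.
- exact: aff_eq_trans uv vq.
Qed.

Lemma aff_eq_catr p u v : aff_eq u v -> aff_eq (u ++ p) (v ++ p).
Proof.
elim=> {u v} [p' q u v uv|u|u v _|u v q _ uv _ vq].
- by rewrite -!catA; apply: aff_eq_step.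
- exact: aff_eq_refl.
- exact: aff_eq_sym.
- exact: aff_eq_trans uv vq.
Qed.

Lemma aff_eq_repr u : aff_eq (repr (aff_class u)) u.
Proof. by apply/aff_classP; rewrite aff_classK. Qed.

Lemma aff_eq_revK u : aff_eq (rev u ++ u) [::].
Proof.
elim: u => [|i u IHu]; first exact: aff_eq_refl.
rewrite rev_cons cat_rcons; apply: aff_eq_trans IHu.
exact: (aff_eq_step _ _ (aff_sqr i)).
Qed.

Definition aff_mul (a b : affine_sym) := aff_class (repr a ++ repr b).
Definition aff_one := aff_class [::].
Definition aff_inv (a : affine_sym) := aff_class (rev (repr a)).

Lemma aff_mulE u v : aff_mul (aff_class u) (aff_class v) = aff_class (u ++ v).
Proof.
apply/aff_classP; apply: aff_eq_trans (aff_eq_catr _ (aff_eq_repr u)) _.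
exact: aff_eq_catl (aff_eq_repr v).
Qed.

Lemma aff_mulA : associative aff_mul.
Proof.
move=> a b c; rewrite -(aff_classK a) -(aff_classK b) -(aff_classK c).
by rewrite !aff_mulE catA.
Qed.

Lemma aff_mul1 : left_id aff_one aff_mul.
Proof. by move=> a; rewrite -(aff_classK a) aff_mulE. Qed.

Lemma aff_1mul : right_id aff_one aff_mul.
Proof. by move=> a; rewrite -(aff_classK a) aff_mulE cats0. Qed.

Lemma aff_mulV : left_inverse aff_one aff_inv aff_mul.
Proof.
move=> a; rewrite -{2}(aff_classK a) /aff_inv aff_mulE.
by apply/aff_classP/aff_eq_revK.
Qed.

Lemma aff_Vmul : right_inverse aff_one aff_inv aff_mul.
Proof.
move=> a; rewrite -{1}(aff_classK a) /aff_inv aff_mulE.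
by apply/aff_classP; rewrite -{1}(revK (repr a)); apply: aff_eq_revK.
Qed.

HB.instance Definition _ := isGroup.Build affine_sym
  aff_mulA aff_mul1 aff_1mul aff_mulV aff_Vmul.

Definition aff_gen i : affine_sym := aff_class [:: i].

Definition word_elt u : affine_sym := \big[*%g/1%g]_(i <- u) aff_gen i.

Lemma word_eltE u : word_elt u = aff_class u.
Proof.
rewrite /word_elt; elim: u => [|i u IHu]; first by rewrite big_nil.
by rewrite big_cons IHu; apply: aff_mulE.
Qed.

Implicit Types w : affine_sym.

Lemma has_word_of_size w :
  exists k, `[< exists2 u, word_elt u = w & size u = k >].
Proof.
exists (size (repr w)); apply/asboolP.
by exists (repr w); rewrite ?word_eltE ?aff_classK.
Qed.

Definition aff_length w : nat := ex_minn (has_word_of_size w).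

Definition reduced_word w u := word_elt u = w /\ size u = aff_length w.

Definition con w : {set 'I_n} :=
  [set i | `[< exists2 u, reduced_word w u & i \in u >]]%SET.

(* The generators are involutions, so products of generators suffice to
   describe the subgroup generated by the s_i with i <> x. *)
Definition parabolic (x : 'I_n) w := exists2 u, x \notin u & word_elt u = w.

Definition cyc_dec_word u :=
  uniq u /\ forall j, j \in u -> ord_pred j \in u ->
                      ~~ (index (ord_pred j) u < index j u).

Definition cyc_dec w := exists2 u, cyc_dec_word u & word_elt u = w.

(* The cyclically decreasing element of content A; it exists and is unique
   when A is a proper subset of [n]. *)
Definition cyc_elt (A : {set 'I_n}) : affine_sym :=
  xget 1%g [set w | cyc_dec w /\ con w = A].

(* A factorization w^m ... w^1 is the sequence [:: w^1; ...; w^m]. *)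
Definition affine_factorization w m (f : seq affine_sym) :=
  [/\ size f = m,
      forall g, g \in f -> cyc_dec g,
      \big[*%g/1%g]_(g <- rev f) g = w
    & sumn (map aff_length f) = aff_length w].

Definition fact_weight (f : seq affine_sym) : seq nat := map aff_length f.

End AffineSymmetricGroup.

Section CyclicOrder.
Variables (n : nat) (x : 'I_n).
Implicit Types (a b : 'I_n) (s : seq 'I_n) (A : {set 'I_n}).

(* Position of a in x+1 < ... < n-1 < 0 < ... < x-1, counted from 0. *)
Definition xrank a : nat := (a + n - x.+1) %% n.
Definition xle : rel 'I_n := fun a b => xrank a <= xrank b.
Definition xlt : rel 'I_n := fun a b => xrank a < xrank b.

Definition xsort s := sort xle s.
Definition xmin s : option 'I_n := ohead (xsort s).
Definition xmax s : option 'I_n := ohead (rev (xsort s)).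

(* [bs] is processed from its head, and [avail] holds the letters of the right
   factor not paired yet; the result lists the unpaired letters on each side. *)
Fixpoint pairing_rec (bs avail : seq 'I_n) : seq 'I_n * seq 'I_n :=
  if bs is b :: bs' then
    if xmin [seq a <- avail | xlt b a] is Some a
    then pairing_rec bs' (rem a avail)
    else let LR := pairing_rec bs' avail in (b :: LR.1, LR.2)
  else ([::], avail).

Definition pairing (A B : {set 'I_n}) :=
  pairing_rec (rev (xsort (enum A))) (enum B).

Implicit Types f : seq (affine_sym n).

(* w^r is item r-1 of f; the operators below are meant for 1 <= r < size f. *)
Definition factor f r : affine_sym n := nth 1%g f r.-1.

Definition unpairedL r f := (pairing (con (factor f r.+1)) (con (factor f r))).1.
Definition unpairedR r f := (pairing (con (factor f r.+1)) (con (factor f r))).2.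

Definition set_contents r f (A B : {set 'I_n}) :=
  set_nth 1%g (set_nth 1%g f r (cyc_elt A)) r.-1 (cyc_elt B).

(* For A <> [n]: the least i such that b-i-1, resp. b+i+1, is not in A. *)
Definition run_down A b := find (fun i => iter i.+1 (@ord_pred n) b \notin A) (iota 0 n).
Definition run_up A b := find (fun i => iter i.+1 (@ordS n) b \notin A) (iota 0 n).

Definition fact_e r f : option (seq (affine_sym n)) :=
  let A := con (factor f r.+1) in let B := con (factor f r) in
  if xmin (unpairedL r f) is Some b
  then Some (set_contents r f (A :\ b)
               (iter (run_down A b) (@ord_pred n) b |: B))%SET
  else None.

Definition fact_f r f : option (seq (affine_sym n)) :=
  let A := con (factor f r.+1) in let B := con (factor f r) in
  if xmax (unpairedR r f) is Some a
  then Some (set_contents r f (iter (run_up B a) (@ordS n) a |: A) (B :\ a))%SET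
  else None.

End CyclicOrder.

(* A French-convention tableau is the sequence of its rows, bottom row first. *)
Definition tab_shape (T : Type) (t : seq (seq T)) : seq nat := map size t.

Definition is_part (la : seq nat) := sorted geq la && (0 \notin la).

Section EdelmanGreene.
Variables (n : nat) (x : 'I_n).
Implicit Types (a b : 'I_n) (row : seq 'I_n) (P : seq (seq 'I_n)).

(* The new row and the letter to insert into the next row up, if any. *)
Definition eg_row a row : seq 'I_n * option 'I_n :=
  if xmin x [seq b <- row | xlt x a b] is Some b then
    if (b == ordS a) && (a \in row) then (row, Some (ordS a))
    else (set_nth a row (index b row) a, Some b)
  else (rcons row a, None).

Fixpoint eg_insert a P : seq (seq 'I_n) :=
  if P is row :: P' then
    let: (row', bumped) := eg_row a row in
    row' :: (if bumped is Some b then eg_insert b P' else P')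
  else [:: [:: a]].

Implicit Types f : seq (affine_sym n).

Definition eg_P f i : seq (seq 'I_n) :=
  foldl (fun P v => foldl (fun P' a => eg_insert a P') P (xsort x (enum (con v))))
        [::] (take i f).

Definition fill_cells (la : seq nat) k (Q : seq (seq nat)) : seq (seq nat) :=
  mkseq (fun r => let row := nth [::] Q r in
                  row ++ nseq (nth 0 la r - size row) k) (size la).

Definition eg_Q f : seq (seq nat) :=
  foldl (fun Q i => fill_cells (tab_shape (eg_P f i)) i Q) [::]
        (iota 1 (size f)).

End EdelmanGreene.

Section Tableaux.
Implicit Types (t : seq (seq nat)) (c : nat * nat).

(* Cells are (row, column), counted from 0 at the bottom left. *)
Definition tab_entry t c : nat := nth 0 (nth [::] t c.1) c.2.

Definition tab_cells t : seq (nat * nat) :=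
  [seq (r, j) | r <- iota 0 (size t), j <- iota 0 (size (nth [::] t r))].

Definition semistandard m t :=
  [/\ is_part (tab_shape t),
      forall c, c \in tab_cells t -> 0 < tab_entry t c <= m,
      forall r j, (r, j) \in tab_cells t -> (r, j.+1) \in tab_cells t ->
        tab_entry t (r, j) <= tab_entry t (r, j.+1)
    & forall r j, (r, j) \in tab_cells t -> (r.+1, j) \in tab_cells t ->
        tab_entry t (r, j) < tab_entry t (r.+1, j)].

Definition tab_weight m t : seq nat :=
  mkseq (fun i => count_mem i.+1 (flatten t)) m.

Definition tab_scan t : seq (nat * nat) :=
  [seq c <- [seq (r, j) | j <- rev (iota 0 (size (head [::] t))),
                          r <- iota 0 (size t)] | c \in tab_cells t].

(* [us] and [vs] collect the cells of the unpaired i's, resp. unpaired i+1's,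
   met so far, the last scanned one first. *)
Fixpoint tab_pairing i t (cs us vs : seq (nat * nat)) :=
  if cs is c :: cs' then
    if tab_entry t c == i then tab_pairing i t cs' (c :: us) vs
    else if tab_entry t c == i.+1 then
      if us is _ :: us' then tab_pairing i t cs' us' vs
      else tab_pairing i t cs' us (c :: vs)
    else tab_pairing i t cs' us vs
  else (us, vs).

Definition tab_unpaired i t := tab_pairing i t (tab_scan t) [::] [::].

Definition tab_set t c k : seq (seq nat) :=
  set_nth [::] t c.1 (set_nth 0 (nth [::] t c.1) c.2 k).

(* Columns are scanned from right to left, so the rightmost unpaired i is the
   first one scanned and the leftmost unpaired i+1 is the last one scanned. *)
Definition tab_f i t : option (seq (seq nat)) :=
  omap (fun c => tab_set t c i.+1) (ohead (rev (tab_unpaired i t).1)).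
Definition tab_e i t : option (seq (seq nat)) :=
  omap (fun c => tab_set t c i) (ohead (tab_unpaired i t).2).

End Tableaux.

(* A formal power series in x_1, x_2, ... with integer coefficients is given by
   its coefficients: the value at al is the coefficient of the monomial
   x_1^al_1 ... x_N^al_N, where N = size al. *)
Definition series := seq nat -> int.

Definition schur (la : seq nat) : series := fun al =>
  Posz #|` fset_set [set t : seq (seq nat) |
      [/\ semistandard (size al) t, tab_shape t = la
        & tab_weight (size al) t = al]] |.

Definition stanley n (w : affine_sym n) : series := fun al =>
  Posz #|` fset_set [set f : seq (affine_sym n) |
      affine_factorization w (size al) f /\ fact_weight f = al] |.

(* F = sum_la c_la s_la; for each al, only finitely many s_la have a nonzero
   coefficient at al, namely partitions la of sumn al. *)
Definition schur_expansion (F : series) (c : seq nat -> int) :=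
  forall al, F al = (\sum_(la \in [set la : seq nat | is_part la])
                        c la * schur la al)%R.

(* Schur functions are linearly independent, so the coefficients at partitions
   do not depend on the choice of the expansion. *)
Definition schur_coef (F : series) (la : seq nat) : int :=
  xget (fun=> 0%R) [set c | schur_expansion F c] la.

(* The elements of a crystal are the vertices; the operators and the weight are
   extended to an ambient type, and None stands for the 0 of a crystal. *)
Record crystal (A : Type) := Crystal {
  vertices : set A;
  cr_e : nat -> A -> option A;
  cr_f : nat -> A -> option A;
  cr_wt : A -> seq nat }.

Definition crystal_closed A m (B : crystal A) :=
  forall i b c, 0 < i < m -> vertices B b ->
    cr_e B i b = Some c \/ cr_f B i b = Some c -> vertices B c.

(* The operators are those with index 1 <= i < m. The string lengths eps_i and
   phi_i are determined by the operators. *)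
Definition crystal_iso A A' m (B : crystal A) (B' : crystal A') (h : A -> A') :=
  [/\ crystal_closed m B,
      crystal_closed m B',
      set_bij (vertices B) (vertices B') h,
      forall b, vertices B b -> cr_wt B' (h b) = cr_wt B b
    & forall i b, 0 < i < m -> vertices B b ->
        omap h (cr_e B i b) = cr_e B' i (h b) /\
        omap h (cr_f B i b) = cr_f B' i (h b)].

Definition crystal_dsum A (I : Type) (J : set I) (B : I -> crystal A) :
    crystal (I * A) :=
  {| vertices := [set p | J p.1 /\ vertices (B p.1) p.2];
     cr_e := fun i p => omap (pair p.1) (cr_e (B p.1) i p.2);
     cr_f := fun i p => omap (pair p.1) (cr_f (B p.1) i p.2);
     cr_wt := fun p => cr_wt (B p.1) p.2 |}.

Definition fact_crystal n (x : 'I_n) (w : affine_sym n) m :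
    crystal (seq (affine_sym n)) :=
  {| vertices := [set f | affine_factorization w m f];
     cr_e := fact_e x;
     cr_f := fact_f x;
     cr_wt := @fact_weight n |}.

Definition tab_crystal m (la : seq nat) : crystal (seq (seq nat)) :=
  {| vertices := [set t | semistandard m t /\ tab_shape t = la];
     cr_e := tab_e;
     cr_f := tab_f;
     cr_wt := tab_weight m |}.

(* The direct sum over partitions la of a la copies of B(la): the summand
   indexed by (la, k) is the copy number k of B(la). *)
Definition tab_crystal_dsum m (a : seq nat -> nat) :
    crystal ((seq nat * nat) * seq (seq nat)) :=
  crystal_dsum [set p : seq nat * nat | is_part p.1 /\ p.2 < a p.1]
    (fun p => tab_crystal m p.1).

(* Main.v *)
Require Import Defs.
From mathcomp Require Import all_boot all_order all_algebra zify finmap.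
From mathcomp Require Import boolp classical_sets functions cardinality fsbigop.

Set Implicit Arguments.
Unset Strict Implicit.
Unset Printing Implicit Defensive.

(** Number the letters by their position in the order on [n] \ {x}; a factorization of w then
    becomes a list F of strictly increasing rows whose concatenation is a reduced word, and
    Edelman-Greene insertion makes sense on such lists. Put cnt S t = #{a in S | t <= a}. For two
    consecutive rows A, B the number of unpaired letters of B is the maximum E of
    cnt B t - cnt A (t+1), the operator e removes the largest maximizer from B, and E is also the
    number of cells by which the row A grows when B is inserted into it.

    Inserting A and then B into a row R bumps rows A^, B^, and
      E(A, B) = (|B| - |B^|) + max(0, E(A^, B^) - (|A| - |A^|)).
    The same recursion governs the string lengths of a semistandard tableau when its bottom row is
    removed, since scanning by columns may be replaced by scanning by rows. Hence e commutes with
    the bottom-row pass and, inductively, with F |-> Q(F). It is a Coxeter-Knuth move, so P(F) does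
    not change; f is its inverse on both sides. As (P, Q) determines F and B(la) is connected, the
    factorizations with a given P of shape la form a copy of B(la).

    The multiplicity of la is thus the number of tableaux P of shape la. It is the Schur
    coefficient because a semistandard tableau of shape la and weight mu has
    sum_i i la_i <= sum_i i mu_i, with equality only if la = mu. *)

(* [lia] after discarding the hypotheses that are not arithmetic. *)
Ltac nlia :=
  repeat match goal with
  | H : ?T |- _ =>
    lazymatch T with
    | is_true (leq _ _) => fail
    | is_true (eq_op _ _) => fail
    | is_true (andb _ _) => fail
    | is_true (negb (leq _ _)) => fail
    | is_true (negb (andb _ _)) => fail
    | is_true (negb (eq_op _ _)) => fail
    | @eq ?U _ _ => assert_fails (unify U nat); clear H
    | _ => lazymatch type of T with Prop => clear H end
    end
  end; lia.

Definition cnt (s : seq nat) t := count (leq t) s.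

Notation srt := (sorted ltn).

Lemma srt_uniq s : srt s -> uniq s.
Proof. exact: sorted_uniq ltn_trans ltnn s. Qed.

Lemma srt_eq s1 s2 : srt s1 -> srt s2 -> s1 =i s2 -> s1 = s2.
Proof. exact: irr_sorted_eq ltn_trans ltnn s1 s2. Qed.

Lemma srt_cat s1 s2 :
  srt (s1 ++ s2) = [&& srt s1, srt s2 & all (fun a => all (ltn a) s2) s1].
Proof. by rewrite !(sorted_pairwise ltn_trans) pairwise_cat andbC -andbA. Qed.

Lemma srt_cons a s : srt (a :: s) = all (ltn a) s && srt s.
Proof. by rewrite !(sorted_pairwise ltn_trans). Qed.

Lemma cntS s t : uniq s -> cnt s t = (t \in s) + cnt s t.+1.
Proof.
elim: s => //= a s IH /andP[as_ us]; rewrite /cnt /= -!/(cnt _ _) IH // in_cons.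
have [->|ne] /= := eqVneq t a; first by rewrite (negPf as_); nlia.
nlia.
Qed.

Lemma cnt0 s : cnt s 0 = size s.
Proof. by apply/eqP; rewrite -all_count; apply/allP. Qed.

Lemma cnt_cat s1 s2 t : cnt (s1 ++ s2) t = cnt s1 t + cnt s2 t.
Proof. exact: count_cat. Qed.

Lemma cnt_cons a s t : cnt (a :: s) t = (t <= a) + cnt s t.
Proof. by []. Qed.

Lemma cnt_nil t : cnt [::] t = 0.
Proof. by []. Qed.

Arguments cnt : simpl never.

Lemma cnt_eq0 s t : (forall a, a \in s -> a < t) -> cnt s t = 0.
Proof.
move=> h; apply/eqP; rewrite -leqn0 leqNgt -has_count; apply/hasPn => a /h /=.
nlia.
Qed.

Lemma cnt_le_size s t : cnt s t <= size s.
Proof. exact: count_size. Qed.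

Lemma cnt_ubound (s : seq nat) : exists T, forall a, a \in s -> a < T.
Proof.
elim: s => [|b s [T hT]]; first by exists 0.
exists (maxn b.+1 T) => a; rewrite inE leq_max => /predU1P[->|/hT ->].
  by rewrite ltnSn.
by rewrite orbT.
Qed.

Lemma uniq_cnt_sub s1 s2 t : uniq s1 -> {subset s1 <= s2} -> cnt s1 t <= cnt s2 t.
Proof.
move=> u sub; rewrite /cnt -!size_filter; apply: uniq_leq_size.
  exact: filter_uniq.
by move=> a; rewrite !mem_filter => /andP[-> /sub].
Qed.

(** * Insertion into one row *)

Definition nrow a (R : seq nat) : seq nat * option nat :=
  if [seq r <- R | a < r] is b :: R2 then
    if (b == a.+1) && (a \in R) then (R, Some b)
    else ([seq r <- R | r <= a] ++ a :: R2, Some b)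
  else (rcons R a, None).

Definition oseq (o : option nat) := if o is Some b then [:: b] else [::].

Variant nrow_spec a R : seq nat * option nat -> Prop :=
| NrowApp of all (gtn a) R : nrow_spec a R (rcons R a, None)
| NrowSpecial R1 R2 of R = R1 ++ a :: a.+1 :: R2 & all (gtn a) R1
    & all (ltn a.+1) R2 : nrow_spec a R (R, Some a.+1)
| NrowBump R1 b R2 of R = R1 ++ b :: R2 & all (gtn a) R1 & a < b
    & all (ltn b) R2 : nrow_spec a R (R1 ++ a :: R2, Some b).

Lemma srt_split a R : srt R ->
  R = [seq r <- R | r <= a] ++ [seq r <- R | a < r].
Proof.
elim: R => //= r R IH; rewrite -/(srt (r :: R)) srt_cons => /andP[rR sR].
case: leqP => ra /=; first by rewrite -IH.
rewrite (_ : [seq x <- R | x <= a] = [::]) /=.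
  by rewrite (all_filterP _) //; apply: sub_all rR => x /=; nlia.
apply/eqP; rewrite -(negbK (_ == _)) -has_filter; apply/hasPn => x /(allP rR) /=.
nlia.
Qed.

(** The guard excludes an [a] present without [a.+1], in which case the row would receive [a] twice.
    It holds whenever [R ++ [:: a]] is reduced ([red_good]). *)
Lemma nrowP a R : srt R -> (a \in R) ==> (a.+1 \in R) -> nrow_spec a R (nrow a R).
Proof.
move=> sR g; rewrite /nrow; have eR := srt_split a sR.
have := sR; rewrite {1}eR srt_cat => /and3P[s1 s2 _].
have R1a : all (fun x => x <= a) [seq r <- R | r <= a] by apply: filter_all.
have R2a : all (ltn a) [seq r <- R | a < r] by apply: (filter_all (ltn a)).
have a1 : (a.+1 \in R) -> a.+1 \in [seq r <- R | a < r].
  by rewrite mem_filter ltnSn.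
move: eR s1 s2 R1a R2a a1.
set R1 := [seq r <- R | r <= a]; set R2 := [seq r <- R | a < r].
have mR1 : a \in R -> a \in R1 by rewrite mem_filter leqnn.
have subR1 : {subset R1 <= R} by move=> y; rewrite mem_filter => /andP[].
move: R1 mR1 subR1 => S1 mS1 subS1; move: R2 => S2.
case: S2 => [|b R2] eR s1 s2 R1a R2a a1.
  apply: NrowApp; apply/allP => r; rewrite eR cats0 => rS.
  have := allP R1a _ rS; rewrite leq_eqVlt => /predU1P[ra|//].
  by move: g; rewrite -{1}ra (subS1 _ rS) /= => /a1.
have lt_b : a < b by move: R2a => /= /andP[].
have bR2 : all (ltn b) R2 by move: s2; rewrite srt_cons => /andP[].
have lastS : a \in R -> exists S, S1 = rcons S a.
  move=> /mS1; move: s1 R1a; case/lastP: S1 {eR subS1 mS1} => // S y.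
  rewrite -cats1 srt_cat => /and3P[_ _ hS]; rewrite all_cat mem_cat.
  case/andP=> _ /= /andP[ya _]; rewrite inE => /orP[aS|/eqP->].
    by have /= := allP hS _ aS; nlia.
  by exists S; rewrite cats1.
case: ifP => [/andP[/eqP eb aR]|hn].
  have [S eS] := lastS aR; rewrite eb; apply: (@NrowSpecial _ _ S R2).
  - by rewrite eR eS eb cat_rcons.
  - move: s1; rewrite eS -cats1 srt_cat => /and3P[_ _].
    by apply: sub_all => y /= /andP[].
  - by rewrite -eb.
apply: NrowBump => //; apply/allP => r rS /=.
have := allP R1a _ rS; rewrite leq_eqVlt => /predU1P[ra|//].
have aR : a \in R by rewrite -ra; apply: subS1.
move: g hn; rewrite aR /= andbT => /a1; rewrite inE => /predU1P[<-|]; first by rewrite eqxx.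
by move/(allP bR2) => /=; nlia.
Qed.

Lemma nrow_srt a R : srt R -> (a \in R) ==> (a.+1 \in R) -> srt (nrow a R).1.
Proof.
move=> sR g; case: (nrowP sR g) => [ha|R1 R2 eR _ _|R1 b R2 eR h1 h2 h3] //=.
  rewrite -cats1 srt_cat sR /=; apply: sub_all ha => y /=; nlia.
move: sR; rewrite eR !srt_cat => /and3P[-> ]; rewrite /= -!/(srt (_ :: _)) !srt_cons.
move=> /andP[_ ->] h /=; rewrite andbT; apply/andP; split.
  by apply: sub_all h3 => y /=; nlia.
apply/allP => y yR; have /= -> := allP h1 _ yR.
by have /= /andP[_ ->] := allP h _ yR.
Qed.

Fixpoint rins R (u : seq nat) : seq nat * seq nat :=
  if u is a :: u' then
    let ro := nrow a R in let rv := rins ro.1 u' in (rv.1, oseq ro.2 ++ rv.2)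
  else (R, [::]).

(* The letters bumped by the special rule, which leaves them in the row. *)
Fixpoint zins R (u : seq nat) : seq nat :=
  if u is a :: u' then
    (if a \in R then oseq (nrow a R).2 else [::]) ++ zins (nrow a R).1 u'
  else [::].

Fixpoint gins R (u : seq nat) : bool :=
  if u is a :: u' then ((a \in R) ==> (a.+1 \in R)) && gins (nrow a R).1 u'
  else true.

Lemma rins_cat R u v : rins R (u ++ v) =
  ((rins (rins R u).1 v).1, (rins R u).2 ++ (rins (rins R u).1 v).2).
Proof.
elim: u R => [|a u IH] R /=; first by case: (rins R v).
by rewrite IH /= catA.
Qed.

Lemma gins_cat R u v : gins R (u ++ v) = gins R u && gins (rins R u).1 v.
Proof. by elim: u R => //= a u IH R; rewrite IH andbA. Qed.

Lemma rins_srt R u : srt R -> gins R u -> srt (rins R u).1.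
Proof.
by elim: u R => //= a u IH R sR /andP[g gu]; apply: IH => //; apply: nrow_srt.
Qed.

Lemma rins_size R u : srt R -> gins R u ->
  size (rins R u).1 + size (rins R u).2 = size R + size u.
Proof.
elim: u R => //= a u IH R sR /andP[g gu].
have := IH _ (nrow_srt sR g) gu; rewrite size_cat; move: gu.
case: (nrowP sR g) => [ha|R1 R2 eR _ _|R1 b R2 eR h1 h2 h3] _ /=; try nlia.
  rewrite size_rcons; nlia.
rewrite eR !size_cat /=; nlia.
Qed.

Lemma bumped_gt y R u : srt R -> gins R u -> all (leq y) u -> all (ltn y) (rins R u).2.
Proof.
elim: u R => //= a u IH R sR /andP[g gu] /andP[ya yu].
rewrite all_cat IH ?nrow_srt // andbT; move: gu.
by case: (nrowP sR g) => [ha|R1 R2 eR _ _|R1 b R2 eR h1 h2 h3] _ //=; nlia.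
Qed.

Lemma bumped_le_size R u : size (rins R u).2 <= size u.
Proof.
elim: u R => //= a u IH R; rewrite size_cat.
by have := IH (nrow a R).1; case: (nrow a R).2 => [b|] /=; nlia.
Qed.

(** Letters come in increasing order and bump larger ones, so a letter that was just inserted is
    never bumped later. *)
Lemma bumped_sub R A : srt R -> srt A -> gins R A -> {subset (rins R A).2 <= R}.
Proof.
elim: A R => //= a A IH R sR; rewrite -/(srt (_ :: _)) srt_cons => /andP[aA sA] /andP[g gA] y.
rewrite mem_cat => /orP[|yb].
  case: (nrowP sR g) => [ha|R1 R2 eR _ _|R1 b R2 eR h1 h2 h3] //=;
    by rewrite inE => /eqP->; rewrite eR !(mem_cat, inE) eqxx ?orbT.
have sR' := nrow_srt sR g.
have ya : a < y by apply: (allP (bumped_gt sR' gA (sub_all _ aA)) _ yb) => z /=; nlia.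
have := IH _ sR' sA gA _ yb.
case: (nrowP sR g) => [ha|R1 R2 eR _ _|R1 b R2 eR h1 h2 h3] //=.
  by rewrite mem_rcons inE => /predU1P[ey|//]; move: ya; rewrite ey ltnn.
rewrite eR !(mem_cat, inE) => /or3P[->//|/eqP ey|->]; last by rewrite !orbT.
by move: ya; rewrite ey ltnn.
Qed.

Lemma bumped_srt R A : srt R -> srt A -> gins R A -> srt (rins R A).2.
Proof.
elim: A R => //= a A IH R sR; rewrite -/(srt (_ :: _)) srt_cons => /andP[aA sA] /andP[g gA].
have sR' := nrow_srt sR g; rewrite srt_cat IH // andTb.
have sub := bumped_sub sR' sA gA.
have ya : all (ltn a.+1) (rins (nrow a R).1 A).2 by apply: bumped_gt.
move: gA sub ya.
case: (nrowP sR g) => [ha|R1 R2 eR _ _|R1 b R2 eR h1 h2 h3] gA sub ya //=; rewrite andbT.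
  by [].
apply/allP => y yb /=; have := sub _ yb.
have /= := allP ya _ yb => lt_ay.
rewrite mem_cat inE => /or3P[/(allP h1)|/eqP|/(allP h3)] //=; nlia.
Qed.

(** Each bumped letter exceeds the letter that bumps it; hence there are at most as many bumped
    letters up to [t] as inserted letters below [t]. *)
Lemma cnt_bumped_ge R u t : srt R -> gins R u ->
  cnt u t + size (rins R u).2 <= size u + cnt (rins R u).2 t.+1.
Proof.
elim: u R => [|a u IH] R sR; first by [].
rewrite /= => /andP[g gu].
have := IH _ (nrow_srt sR g) gu; rewrite size_cat cnt_cat cnt_cons; move: gu.
case: (nrowP sR g) => [ha|R1 R2 eR _ _|R1 b R2 eR h1 h2 h3] _ /=;
  rewrite ?cnt_cons ?cnt_nil /=; nlia.
Qed.

(** As [t] stays in the row, an inserted letter below [t] must bump a letter up to [t], which gives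
    equality in [cnt_bumped_ge]. *)
Lemma cnt_unbumped R u t : srt R -> gins R u -> t \in R -> t \notin (rins R u).2 ->
  cnt u t + size (rins R u).2 = size u + cnt (rins R u).2 t.+1.
Proof.
elim: u R => [|a u IH] R sR; first by [].
rewrite /= => /andP[g gu] tR.
have := IH _ (nrow_srt sR g) gu; rewrite size_cat cnt_cat cnt_cons mem_cat; move: gu.
case: (nrowP sR g) => [ha|R1 R2 eR h1 h2|R1 b R2 eR h1 h2 h3] _ /= IHt;
  rewrite ?cnt_cons ?cnt_nil /= ?inE ?negb_or.
- move=> tn; have /= := allP ha _ tR; move: IHt; rewrite mem_rcons inE tR orbT.
  by move=> /(_ isT tn); nlia.
- case/andP=> t1 tn; move: IHt => /(_ tR tn).
  by move: tR; rewrite eR mem_cat !inE => /or4P[/(allP h1)|/eqP|/eqP|/(allP h2)] /=; nlia.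
- case/andP=> t1 tn; move: tR IHt; rewrite eR !mem_cat !inE (negPf t1) /= => tR.
  move=> /(_ _ tn); case/orP: tR => [/[dup] /(allP h1) /= lt ->|/[dup] /(allP h3) /= lt ->];
  rewrite ?orbT => /(_ isT); nlia.
Qed.

(** Under the special rule [a] comes in, [a.+1] goes out and the row does not change; the surplus is
    visible only at the threshold [a.+1]. *)
Lemma cnt_row R u t : srt R -> gins R u ->
  cnt (rins R u).1 t + cnt (rins R u).2 t = cnt R t + cnt u t + count_mem t (zins R u).
Proof.
elim: u R => [|a u IH] R sR; first by rewrite /= !addn0.
rewrite /= => /andP[g gu].
have := IH _ (nrow_srt sR g) gu; rewrite count_cat cnt_cat cnt_cons; move: gu.
case: (nrowP sR g) => [ha|R1 R2 eR h1 h2|R1 b R2 eR h1 h2 h3] _ /=.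
- have -> : a \in R = false by apply/negP => /(allP ha) /=; rewrite ltnn.
  by rewrite -cats1 cnt_cat cnt_cons cnt_nil /=; nlia.
- have -> : a \in R by rewrite eR mem_cat !inE eqxx orbT.
  by rewrite cnt_cons cnt_nil /=; nlia.
- have -> : a \in R = false.
    apply/negP; rewrite eR mem_cat inE => /or3P[/(allP h1)|/eqP|/(allP h3)] /=; nlia.
  by rewrite eR !cnt_cat !cnt_cons cnt_nil /=; nlia.
Qed.

(** A special bump of [t] finds [t.-1] still in the row, so an earlier bump of [t.-1] was special as
    well. This propagates specialness downwards. *)
Lemma zinsP R A t : srt R -> srt A -> gins R A -> t \in zins R A ->
  [/\ 0 < t, t \in R, t.-1 \in R, t.-1 \in A
    & t.-1 \in (rins R A).2 -> t.-1 \in zins R A].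
Proof.
elim: A R => //= a A IH R sR; rewrite -/(srt (_ :: _)) srt_cons => /andP[aA sA] /andP[g gA].
have sR' := nrow_srt sR g; rewrite !mem_cat => /orP[|].
  case: ifP => // aR.
  have ya : all (ltn a.+1) (rins (nrow a R).1 A).2 by apply: bumped_gt.
  move: gA ya.
  case: (nrowP sR g) => [ha|R1 R2 eR _ _|R1 b R2 eR h1 h2 h3] gA ya //=.
    rewrite !inE => /eqP->; rewrite eR /= !(mem_cat, inE) !eqxx !orbT; split=> //.
    rewrite -eR; case/orP; first by nlia.
    by move/(allP ya) => /=; nlia.
  by have /= := allP h1; move: aR; rewrite eR mem_cat inE => /or3P[/(allP h1)|/eqP|/(allP h3)] /=; nlia.
move=> tz; have [t0 tR tR' tA' Ht] := IH _ sR' sA gA tz.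
have ta : a < t.-1 by apply: (allP aA).
rewrite !inE tA' orbT; split=> //.
- move: tR; case: (nrowP sR g) => [ha|R1 R2 eR _ _|R1 b R2 eR h1 h2 h3] //=.
    by rewrite mem_rcons inE => /predU1P[|//]; nlia.
  by rewrite eR !(mem_cat, inE) => /or3P[->//|/eqP|->]; rewrite ?orbT //; nlia.
- move: tR'; case: (nrowP sR g) => [ha|R1 R2 eR _ _|R1 b R2 eR h1 h2 h3] //=.
    by rewrite mem_rcons inE => /predU1P[|//]; nlia.
  by rewrite eR !(mem_cat, inE) => /or3P[->//|/eqP|->]; rewrite ?orbT //; nlia.
- case/orP=> [tb|/Ht ->]; last by rewrite orbT.
  move: tR' tb; case: (nrowP sR g) => [ha|R1 R2 eR _ _|R1 b R2 eR h1 h2 h3] //=.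
    have -> : a \in R by rewrite eR mem_cat !inE eqxx orbT.
    by move=> _ ->.
  rewrite inE => + /eqP eb; rewrite eb mem_cat inE.
  case/or3P=> [/(allP h1)|/eqP|/(allP h3)] /=; nlia.
Qed.

Lemma zins_uniq R A : srt R -> srt A -> gins R A -> uniq (zins R A).
Proof.
elim: A R => //= a A IH R sR; rewrite -/(srt (_ :: _)) srt_cons => /andP[aA sA] /andP[g gA].
have sR' := nrow_srt sR g; rewrite cat_uniq IH // andbT.
case: ifP => aR; last by rewrite /= -all_predC; apply/allP.
apply/andP; split; first by case: (nrow a R).2.
apply/hasPn => t /[dup] tz /(zinsP sR' sA gA) [t0 _ _ /(allP aA) /= lt _].
move: aR; case: (nrowP sR g) => [ha|R1 R2 eR _ _|R1 b R2 eR h1 h2 h3] //=.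
  by rewrite inE; nlia.
by rewrite eR mem_cat inE => /or3P[/(allP h1)|/eqP|/(allP h3)] /=; nlia.
Qed.

(** * String lengths *)

Definition is_eps (A B : seq nat) e :=
  (forall t, cnt B t <= e + cnt A t.+1) /\ (exists t, cnt B t = e + cnt A t.+1).

Lemma is_eps_uniq A B e e' : is_eps A B e -> is_eps A B e' -> e = e'.
Proof. by move=> [h1 [t1 e1]] [h2 [t2 e2]]; have := h1 t2; have := h2 t1; nlia. Qed.

Lemma row_attained R A t : srt R -> srt A -> gins R A -> exists2 s, s <= t &
  size A + cnt (rins R A).2 t.+1 + cnt R s.+1 = cnt A s + size (rins R A).2 + cnt R t.+1.
Proof.
move=> sR sA g; elim: t => [|t [s st IH]].
  exists 0 => //; have h := bumped_gt sR g (y := 0).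
  have {h} h : all (ltn 0) (rins R A).2 by apply: h; apply/allP.
  have -> : cnt (rins R A).2 1 = size (rins R A).2 by apply/eqP; rewrite -all_count.
  by rewrite cnt0; nlia.
have ub := srt_uniq (bumped_srt sR sA g).
have := cntS t.+1 ub; have := cntS t.+1 (srt_uniq sR) => e1 e2.
have [tb|tb] := boolP (t.+1 \in (rins R A).2).
  exists s; first by nlia.
  by move: e1 e2; rewrite tb (bumped_sub sR sA g tb); nlia.
have [tR|tR] := boolP (t.+1 \in R).
  by exists t.+1 => //; have := cnt_unbumped sR g tR tb; nlia.
by exists s; move: e1 e2; rewrite (negPf tb) (negPf tR); nlia.
Qed.

Lemma is_eps_rins R A : srt R -> srt A -> gins R A ->
  is_eps R A (size A - size (rins R A).2).
Proof.
move=> sR sA g; have bs := bumped_le_size R A.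
have ub := srt_uniq (bumped_srt sR sA g).
split=> [t|].
  have := cnt_bumped_ge t sR g.
  by have := uniq_cnt_sub t.+1 ub (bumped_sub sR sA g); nlia.
have [T hT] := cnt_ubound R.
have [s _] := row_attained T sR sA g.
have -> : cnt (rins R A).2 T.+1 = 0.
  by apply: cnt_eq0 => a /(bumped_sub sR sA g) /hT; nlia.
have -> : cnt R T.+1 = 0 by apply: cnt_eq0 => a /hT; nlia.
by exists s; nlia.
Qed.

(* A nonreduced product: see [red_norun]. *)
Definition norun (A B : seq nat) := forall s e, s <= e ->
  (forall j, s <= j <= e -> (j \in A) && (j \in B)) -> e.+1 \notin A ->
  (0 < s) && (s.-1 \in B).

Lemma largest_maximizer A B E : is_eps A B E -> 0 < E ->
  exists b, cnt B b = E + cnt A b.+1 /\ forall s, b < s -> cnt B s < E + cnt A s.+1.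
Proof.
move=> [hE [t0 et0]] E0; have [T hT] := cnt_ubound B.
have ex : exists t, cnt B t == E + cnt A t.+1 by exists t0; apply/eqP.
have ub t : cnt B t == E + cnt A t.+1 -> t <= T.
  move=> /eqP et; rewrite leqNgt; apply/negP => lt.
  by move: et; rewrite cnt_eq0 => [|a /hT]; nlia.
case: (ex_maxnP ex ub) => b /eqP eb hb; exists b; split=> // s bs.
rewrite ltn_neqAle hE andbT; apply/negP => /hb; nlia.
Qed.

(** Go down from the largest maximizer while [s.+1] is special: then [s] lies in both rows, [norun]
    puts [s.-1] into [B], and [s.-1] is again a maximizer. At 0 this contradicts [norun]. *)
Lemma nonspecial_maximizer R A B E : srt R -> srt A -> srt B -> gins R A ->
  norun A B -> is_eps A B E ->
  exists2 s, cnt B s = E + cnt A s.+1 & s.+1 \notin zins R A.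
Proof.
move=> sR sA sB g nr hE; have [E0|E0] := posnP E.
  (* Above all letters both counts vanish, which attains the maximum 0. *)
  have [T hT] := cnt_ubound (R ++ A ++ B); exists T.
    by rewrite E0 !cnt_eq0 // => a ha; have := hT a; rewrite !mem_cat ha ?orbT; nlia.
  apply/negP => /(zinsP sR sA g) [_ TR _ _ _].
  by have := hT T.+1; rewrite mem_cat TR; nlia.
have [b [eb hb]] := largest_maximizer hE E0.
have cB t := cntS t (srt_uniq sB); have cA t := cntS t (srt_uniq sA).
have bB : (b \in B) && (b.+1 \notin A).
  by have := hb b.+1 (ltnSn _); have := cB b; have := cA b.+1; do 2 case: (_ \in _) => /=; nlia.
case/andP: bB => bB bA.
suff H : forall k s, s + k = b -> cnt B s = E + cnt A s.+1 -> s \in B ->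
    (forall j, s < j <= b -> (j \in A) && (j \in B)) ->
    exists2 s, cnt B s = E + cnt A s.+1 & s.+1 \notin zins R A.
  by apply: (H 0 b) => //; [nlia|move=> j; nlia].
move=> k s; elim: s k => [|s IH] k sk es sBm run.
  have [z|] := boolP (1 \in zins R A); last by exists 0.
  have [_ _ _ /= sAm _] := zinsP sR sA g z.
  have // : (0 < 0) && (0.-1 \in B); apply: (nr 0 b) => //.
  by move=> j jb; have [->|j0] := eqVneq j 0; [rewrite sBm sAm|apply: run; nlia].
have [z|] := boolP (s.+2 \in zins R A); last by exists s.+1.
have [_ _ _ /= sAm _] := zinsP sR sA g z.
have run' : forall j, s < j <= b -> (j \in A) && (j \in B).
  by move=> j jb; have [->|j0] := eqVneq j s.+1; [rewrite sBm sAm|apply: run; nlia].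
have /andP[_ /= sB'] : (0 < s.+1) && (s \in B) by apply: (nr s.+1 b) => //; nlia.
apply: (IH k.+1) => //; first by nlia.
by have := cB s; have := cA s.+1; rewrite sB' sAm; nlia.
Qed.

Lemma special_chain R A s t : srt R -> srt A -> gins R A -> s < t ->
  t \in zins R A -> (forall j, s < j < t -> j \in R -> j \in (rins R A).2) ->
  s.+1 \in zins R A.
Proof.
move=> sR sA g; elim: t => // t IH st z h.
have [->//|ne] := eqVneq s t.
have [_ _ /= tR _ /= Hz] := zinsP sR sA g z.
apply: IH; first nlia; first by apply: Hz; apply: h => //; nlia.
by move=> j js; apply: h; nlia.
Qed.

(** The difference of the two counts is the number of letters of [R] outside [S] from the threshold
    on, hence decreasing in the threshold. *)
Lemma cnt_diff_gap (R S : seq nat) s t : uniq R -> uniq S -> {subset S <= R} -> s <= t ->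
  cnt R t + cnt S s <= cnt R s + cnt S t /\
  (cnt R t + cnt S s = cnt R s + cnt S t -> forall j, s <= j < t -> j \in R -> j \in S).
Proof.
move=> uR uS sub; elim: t => [|t IH] st.
  by have -> : s = 0 by [nlia]; split=> // _ j; nlia.
have [->|ne] := eqVneq s t.+1; first by split=> // _ j; nlia.
have {IH} [|h1 h2] := IH; first nlia.
have eR := cntS t uR; have eS := cntS t uS.
have [tS|tS] := boolP (t \in S); last first.
  rewrite (negPf tS) in eS; split=> [|h j js jR]; first by nlia.
  have [ej|nj] := eqVneq j t; last by apply: h2 => //; nlia.
  by rewrite -{2}ej jR in eR; nlia.
rewrite tS (sub _ tS) in eR eS; split=> [|h j js]; first by nlia.
have [->//|nj] := eqVneq j t; apply: h2; nlia.
Qed.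

Lemma eps_formula R A B E p :
  srt R -> srt A -> srt B -> gins R A -> gins (rins R A).1 B -> norun A B ->
  is_eps A B E -> is_eps (rins R A).2 (rins (rins R A).1 B).2 p ->
  E = (size B - size (rins (rins R A).1 B).2) + (p - (size A - size (rins R A).2)).
Proof.
move=> sR sA sB gA gB nr hE hp; have sR' := rins_srt sR gA.
have bA := bumped_le_size R A; have bB := bumped_le_size (rins R A).1 B.
have uA := srt_uniq (bumped_srt sR sA gA); have uR := srt_uniq sR.
have subA := bumped_sub sR sA gA.
have uB := srt_uniq (bumped_srt sR' sB gB).
have subB := bumped_sub sR' sB gB.
have row t := cnt_row t sR gA.
have zc t : count_mem t (zins R A) = (t \in zins R A).
  by rewrite count_uniq_mem // zins_uniq.
apply/eqP; rewrite eqn_leq; apply/andP; split.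
  (* At a nonspecial maximizer [cnt_row] has no surplus at [s.+1], which an upper bound for [E]
     could not afford. *)
  have [s es sz] := nonspecial_maximizer sR sA sB gA nr hE.
  have hB := cnt_bumped_ge s sR' gB.
  have := row s.+1; rewrite zc (negPf sz) addn0 => rs.
  have [|] := boolP (has (fun t => (s < t) && (t \notin (rins R A).2)) R).
    move=> /hasP[t0 t0R /andP[st0 t0A]].
    have ex : exists t, [&& s < t, t \in R & t \notin (rins R A).2] by exists t0; apply/and3P.
    (* The bound by [p] is used at the least letter of [R] above [s] that [A] does not bump. *)
    case: (ex_minnP ex) => t /and3P[st tR tA] tmin.
    have cu := cnt_unbumped sR gA tR tA.
    have gap : forall j, s.+1 <= j < t -> j \in R -> j \in (rins R A).2.
      move=> j js jR; apply/negPn/negP => jA.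
      by have := tmin j; rewrite jR jA; nlia.
    have eqd : cnt R t + cnt (rins R A).2 s.+1 = cnt R s.+1 + cnt (rins R A).2 t.
      have : s.+1 <= t by []; elim: {-2}t (leqnn t) => [|u IH] ut su; first nlia.
      have [->|ne] := eqVneq s.+1 u.+1; first by [].
      have := IH; have := cntS u uR; have := cntS u uA.
      have [uA'|uA'] := boolP (u \in (rins R A).2); first by rewrite (subA _ uA'); nlia.
      have [uR'|uR'] := boolP (u \in R); last by nlia.
      by move: uA'; rewrite gap //; nlia.
    have [d1 _] := cnt_diff_gap (srt_uniq sR') uB subB st.
    have := hp.1 t; have := row t.
    nlia.
  (* Otherwise [A] bumps all letters of [R] above [s], and the growth of the row under [B] alone
     bounds [E]. *)
  move=> /hasPn hn.
  have : cnt R s.+1 = cnt (rins R A).2 s.+1.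
    apply/eqP; rewrite eqn_leq (uniq_cnt_sub _ uA subA) andbT /cnt -!size_filter.
    apply: uniq_leq_size; first exact: filter_uniq.
    move=> t; rewrite !mem_filter => /andP[st tR]; rewrite st /=.
    by have := hn _ tR; rewrite st negbK.
  have := uniq_cnt_sub s.+1 uB subB; nlia.
(* For the lower bound, the threshold attaining the growth under [B] handles the first summand, and
   a maximizer [t2] for [p] handles the rest. *)
have [_ [t et]] := is_eps_rins sR' sB gB.
have h1 := hE.1 t; have := row t.+1; have := uniq_cnt_sub t.+1 uA subA => h2 h3.
suff : size B - size (rins (rins R A).1 B).2 + p <= E + (size A - size (rins R A).2) by nlia.
have [t2 et2] := hp.2.
have [t0|t0] := posnP t2.
  have hb : cnt (rins (rins R A).1 B).2 0 = cnt (rins (rins R A).1 B).2 1.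
    rewrite cnt0; apply/esym/eqP; rewrite -all_count.
    by apply: (bumped_gt sR' gB); apply/allP.
  have := hE.1 0; have := cnt_bumped_ge 0 sR gA.
  have := cnt0 B; have := cnt0 (rins (rins R A).1 B).2.
  have := cnt0 A; have := cnt_le_size A 1.
  by rewrite t0 in et2; nlia.
have [s st] := row_attained t2.-1 sR' sB gB.
rewrite prednK // => es.
have [g1 g2] := cnt_diff_gap uR uA subA (leq_ltn_trans st (ltnSn _) : s.+1 <= t2.-1.+1).
rewrite prednK // in g1 g2.
have := hE.1 s; have := row s.+1; have := row t2; have := cnt_bumped_ge t2 sR gA.
rewrite !zc.
(* If [t2] is special, the surplus of [cnt_row] at [t2] is compensated by the same surplus at
   [s.+1], or else by an unbumped letter of [R] in between. *)
have hz : t2 \in zins R A ->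
  cnt R t2 + cnt (rins R A).2 s.+1 = cnt R s.+1 + cnt (rins R A).2 t2 -> s.+1 \in zins R A.
  by move=> z /g2 h; apply: (special_chain sR sA gA _ z h); nlia.
have := is_eps_rins sR' sB gB.
have := cnt_bumped_ge s.+1 sR gA.
case: (boolP (t2 \in zins R A)) hz => [_ /(_ isT) hz|_ _]; last by nlia.
have [eqd|ned] := eqVneq (cnt R t2 + cnt (rins R A).2 s.+1) (cnt R s.+1 + cnt (rins R A).2 t2).
  by rewrite (hz eqd); nlia.
nlia.
Qed.

(** * Reduced words in the affine symmetric group *)

Section Words.
Variable n : nat.
Implicit Types (i j k : 'I_n) (p q u v : seq 'I_n) (t g : affine_sym n).
Local Open Scope group_scope.

Lemma word_elt_nil : word_elt (nil : seq 'I_n) = 1.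
Proof. by rewrite /word_elt big_nil. Qed.

Lemma word_elt_cons i u : word_elt (i :: u) = aff_gen i * word_elt u.
Proof. by rewrite /word_elt big_cons. Qed.

Lemma word_elt_cat u v : word_elt (u ++ v) = word_elt u * word_elt v.
Proof. by rewrite /word_elt big_cat. Qed.

Lemma word_elt1 i : word_elt [:: i] = aff_gen i.
Proof. by rewrite word_elt_cons word_elt_nil mulg1. Qed.

Lemma aff_eqP u v : word_elt u = word_elt v <-> aff_eq u v.
Proof. by rewrite !word_eltE; apply: aff_classP. Qed.

Lemma word_elt_rel u v : aff_relation u v -> word_elt u = word_elt v.
Proof. by move=> h; apply/aff_eqP; have := aff_eq_step [::] [::] h; rewrite /= !cats0. Qed.

Lemma aff_gen2 i : aff_gen i * aff_gen i = 1.
Proof. by have := word_elt_rel (aff_sqr i); rewrite !word_elt_cons !word_elt_nil mulg1. Qed.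

Lemma aff_genV i : (aff_gen i)^-1 = aff_gen i.
Proof. by rewrite -[LHS]mulg1 -(aff_gen2 i) mulKg. Qed.

Lemma aff_gen_braid i : aff_gen i * aff_gen (ordS i) * aff_gen i =
  aff_gen (ordS i) * aff_gen i * aff_gen (ordS i).
Proof.
have := word_elt_rel (aff_braid i).
by rewrite !word_elt_cons !word_elt_nil !mulg1 !mulgA.
Qed.

Lemma aff_gen_comm i j : i != j -> j != ordS i -> i != ordS j ->
  aff_gen i * aff_gen j = aff_gen j * aff_gen i.
Proof.
move=> h1 h2 h3; have := word_elt_rel (aff_comm h1 h2 h3).
by rewrite !word_elt_cons !word_elt_nil !mulg1.
Qed.

Lemma word_elt_rev u : word_elt (rev u) = (word_elt u)^-1.
Proof.
elim: u => [|i u IH]; first by rewrite /= word_elt_nil invg1.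
by rewrite rev_cons -cats1 word_elt_cat IH word_elt1 word_elt_cons invgM aff_genV.
Qed.

Lemma aff_length_le u : aff_length (word_elt u) <= size u.
Proof.
rewrite /aff_length; case: ex_minnP => k _; apply.
by apply/asboolP; exists u.
Qed.

Lemma reduced_word_ex g : exists u, reduced_word g u.
Proof.
rewrite /reduced_word /aff_length; case: ex_minnP => k /asboolP[u eu su] _.
by exists u.
Qed.

(* The reflection representation over F_2, which separates the generators even
   for n = 2, where permutations of Z/n do not. *)
Definition adj i j := (i != j) && ((j == ordS i) || (i == ordS j)).

Definition dotf i (f : {ffun 'I_n -> bool}) := \big[addb/false]_(j | adj i j) f j.

Definition refl i (f : {ffun 'I_n -> bool}) : {ffun 'I_n -> bool} :=
  [ffun k => f k (+) ((k == i) && dotf i f)].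

Lemma dotf_refl i j f : dotf i (refl j f) = dotf i f (+) (adj i j && dotf j f).
Proof.
rewrite /dotf; under eq_bigr do rewrite ffunE.
rewrite big_split /=; congr (_ (+) _).
have [a|a] := boolP (adj i j).
  rewrite (bigD1 j) //= eqxx big1 ?addbF // => k /andP[_ /negPf ->] //.
rewrite big1 // => k ak; have [ek|//] := eqVneq k j.
by move: a; rewrite -ek ak.
Qed.

Lemma adjC i j : adj i j = adj j i.
Proof. by rewrite /adj eq_sym orbC. Qed.

Definition act u f := foldr refl f u.

Lemma act_rel u v f : aff_relation u v -> act u f = act v f.
Proof.
have adjxx i : adj i i = false by rewrite /adj eqxx.
case=> [i|i|i j ij ji1 ij1] /=.
- by apply/ffunP => k; rewrite !ffunE dotf_refl adjxx; case: (k == i); case: (f k); case: dotf.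
- have [<-//|ne] := eqVneq i (ordS i).
  have aij : adj i (ordS i) by rewrite /adj ne eqxx.
  have aji : adj (ordS i) i by rewrite adjC.
  apply/ffunP => k; rewrite !ffunE !dotf_refl !adjxx aij aji.
  by case: (k == i); case: (k == ordS i); case: (f k); case: dotf; case: dotf.
- have aij : adj i j = false by rewrite /adj ij (negPf ji1) (negPf ij1).
  have aji : adj j i = false by rewrite adjC.
  apply/ffunP => k; rewrite !ffunE !dotf_refl aij aji.
  by case: (k == i); case: (k == j); case: (f k); case: dotf; case: dotf.
Qed.

Lemma act_eq u v f : aff_eq u v -> act u f = act v f.
Proof.
move=> h; elim: h f => {u v} [p q u v uv|u|u v _ IH|u v q _ IH1 _ IH2] f //.
  by rewrite /act !foldr_cat; congr foldr; apply: act_rel.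
by rewrite IH1.
Qed.

(** On the indicator function of [ordS i], the generator of [i] changes the coordinate [i], and that
    of [j] does not. *)
Lemma aff_gen_inj : injective (@aff_gen n).
Proof.
move=> i j; rewrite -!word_elt1 => /aff_eqP h; apply/eqP/negPn/negP => ij.
have nS : i != ordS i.
  have ne : (i : nat) != j by [].
  apply/negP => /eqP /(congr1 val) /=; have li := ltn_ord i; have lj := ltn_ord j.
  have := li; rewrite leq_eqVlt => /predU1P[e|lt]; first by rewrite e modnn; lia.
  by rewrite modn_small //; lia.
pose f : {ffun 'I_n -> bool} := [ffun k => k == ordS i].
have df : dotf i f = true.
  rewrite /dotf (bigD1 (ordS i)) /= ?ffunE ?eqxx ?big1 //.
    by move=> k /andP[_ /negPf]; rewrite ffunE.
  by rewrite /adj nS eqxx.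
have /ffunP/(_ i) := act_eq f h.
by rewrite /= !ffunE df eqxx (negPf ij) (negPf nS).
Qed.

(* Whether t occurs an odd number of times among the reflections
   p s_i p^-1, for p ++ i a prefix of u. *)
Fixpoint par u t : bool :=
  if u is i :: u' then (t == aff_gen i) (+) par u' (aff_gen i * t * aff_gen i)
  else false.

Lemma conj_gen_eq i t g :
  (aff_gen i * t * aff_gen i == g) = (t == aff_gen i * g * aff_gen i).
Proof.
have K h : aff_gen i * (aff_gen i * h * aff_gen i) * aff_gen i = h.
  by rewrite !mulgA aff_gen2 mul1g -mulgA aff_gen2 mulg1.
by apply/eqP/eqP => [<-|->]; rewrite K.
Qed.

Lemma par_cat p u t :
  par (p ++ u) t = par p t (+) par u ((word_elt p)^-1 * t * word_elt p).
Proof.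
elim: p t => [|i p IH] t /=; first by rewrite word_elt_nil invg1 mul1g mulg1.
by rewrite IH -addbA word_elt_cons invgM aff_genV !mulgA.
Qed.

(** Both sides of the braid relation have the same three reflections [s_i], [s_i s_{i+1} s_i] and
    [s_{i+1}], in opposite orders. *)
Lemma par_rel u v t : aff_relation u v -> par u t = par v t.
Proof.
case=> [i|i|i j h1 h2 h3] /=; rewrite !conj_gen_eq ?addbF.
- by rewrite aff_gen2 mul1g addbb.
- rewrite !mulgA.
  have e1 : aff_gen i * aff_gen (ordS i) * aff_gen i * aff_gen (ordS i) * aff_gen i
            = aff_gen (ordS i).
    by rewrite aff_gen_braid -(mulgA _ (aff_gen (ordS i)) (aff_gen (ordS i))) aff_gen2
      mulg1 -mulgA aff_gen2 mulg1.
  have e2 : aff_gen (ordS i) * aff_gen i * aff_gen (ordS i) * aff_gen i * aff_gen (ordS i)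
            = aff_gen i.
    by rewrite -aff_gen_braid -(mulgA _ (aff_gen i) (aff_gen i)) aff_gen2
      mulg1 -mulgA aff_gen2 mulg1.
  rewrite e1 e2 aff_gen_braid.
  by case: (t == aff_gen i); case: (t == aff_gen (ordS i)); case: (t == _).
- rewrite (aff_gen_comm h1 h2 h3) -mulgA aff_gen2 mulg1.
  by rewrite -(aff_gen_comm h1 h2 h3) -mulgA aff_gen2 mulg1 addbC.
Qed.

Lemma par_eq u v t : word_elt u = word_elt v -> par u t = par v t.
Proof.
move/aff_eqP=> h; elim: h t => {u v} [p q u v uv|u|u v _ IH|u v q _ IH1 _ IH2] t //.
  by rewrite !par_cat (word_elt_rel uv) (par_rel _ uv).
by rewrite IH1.
Qed.

Lemma par_true u t : par u t -> exists p j q,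
  u = p ++ j :: q /\ t = word_elt p * aff_gen j * (word_elt p)^-1.
Proof.
elim: u t => [//|i u IH] t /=; have [->|_] /= := eqVneq t (aff_gen i).
  by exists [::], i, u; rewrite word_elt_nil mul1g invg1 mulg1.
move=> /IH[p [j [q [-> e]]]]; exists (i :: p), j, q; split=> //.
move/eqP: e; rewrite conj_gen_eq => /eqP->.
by rewrite word_elt_cons invgM aff_genV !mulgA.
Qed.

(** Deletion: when one reflection occurs at two positions of a word, the two letters cancel. *)
Lemma delete_pair i j q1 q2 :
  aff_gen i = word_elt q1 * aff_gen j * (word_elt q1)^-1 ->
  word_elt (i :: q1 ++ j :: q2) = word_elt (q1 ++ q2).
Proof.
move=> e; rewrite word_elt_cons !word_elt_cat word_elt_cons e.
by rewrite -!mulgA mulKg !mulgA -(mulgA (word_elt q1)) aff_gen2 mulg1.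
Qed.

(** In a word for [s_i] the reflection [s_j] with [j] different from [i] occurs an even number of
    times. If [j] is the first letter it occurs there, hence once more, and deletion gives a shorter
    word. *)
Lemma gen_notin_parabolic i v : i \notin v -> word_elt v <> aff_gen i.
Proof.
have [N] := ubnP (size v); elim: N v => // N IH [|j v] sv iv e.
  move: e; rewrite -(word_elt1 i) => e; have := par_eq (aff_gen i) e.
  by rewrite /= eqxx.
have ev : word_elt (j :: v) = word_elt [:: i] by rewrite word_elt1.
have /= := par_eq (aff_gen j) ev; rewrite eqxx addbF aff_gen2 mul1g.
have [|_ /= /esym/eqP/aff_gen_inj ji] := boolP (par v (aff_gen j)); last first.
  by move: iv; rewrite ji inE eqxx.
move=> /par_true[q1 [k [q2 [eq1 e1]]]] _.
apply: (IH (q1 ++ q2)) => //.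
- by move: sv; rewrite eq1 /= !size_cat /=; lia.
- by move: iv; rewrite eq1 inE !mem_cat inE !negb_or => /and4P[_ -> _ ->].
- by rewrite -e eq1 (delete_pair _ e1).
Qed.

Lemma first_split (i : 'I_n) u : i \in u -> exists p q, u = p ++ i :: q /\ i \notin p.
Proof.
elim: u => // j u IH; have [->|ne] := eqVneq j i; first by exists [::], u.
rewrite inE eq_sym (negPf ne) /= => /IH[p [q [-> ip]]]; exists (j :: p), q.
by rewrite inE eq_sym (negPf ne).
Qed.

(* The reflection of the first i in a reduced word of w is also a reflection of
   any other word of w. *)
Lemma reduced_avoids i u0 u : i \notin u0 -> word_elt u = word_elt u0 ->
  size u = aff_length (word_elt u) -> i \notin u.
Proof.
move=> iu0 e su; apply/negP => /first_split[p [q [eu ip]]].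
pose t := word_elt p * aff_gen i * (word_elt p)^-1.
have et : (word_elt p)^-1 * t * word_elt p = aff_gen i.
  by rewrite /t -!mulgA mulKg mulVg mulg1.
(* In a reduced word [t] occurs exactly once, since a second occurrence would allow a deletion. *)
have tu : par u t.
  rewrite eu par_cat et /= eqxx aff_gen2 mul1g.
  have -> : par q (aff_gen i) = false.
    apply/negP => /par_true[q1 [j [q2 [eq1 e1]]]].
    have e2 : word_elt u = word_elt (p ++ q1 ++ q2).
      by rewrite eu eq1 word_elt_cat (delete_pair _ e1) -word_elt_cat.
    have := aff_length_le (p ++ q1 ++ q2); rewrite -e2 -su eu eq1 !size_cat /= size_cat /=.
    lia.
  rewrite addbF addbT; apply/negP => /par_true[p1 [j [p2 [ep1 e1]]]].
  have e3 : word_elt p * aff_gen i = word_elt (p1 ++ p2).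
    have -> : word_elt p * aff_gen i = t * word_elt p by rewrite /t -!mulgA mulVg mulg1.
    rewrite e1 ep1 !word_elt_cat word_elt_cons -!mulgA mulKg (mulgA (aff_gen j)) aff_gen2.
    by rewrite mul1g.
  have e2 : word_elt u = word_elt (p1 ++ p2 ++ q).
    by rewrite eu word_elt_cat word_elt_cons mulgA e3 -word_elt_cat catA.
  have := aff_length_le (p1 ++ p2 ++ q); rewrite -e2 -su eu ep1 !size_cat /=.
  lia.
move: tu; rewrite (par_eq _ e) => /par_true[p0 [j [q0 [eu0 e1]]]].
(* The generator of [i] is conjugate to [t] by the prefix [p], and [t] has a word in the letters of
   [u0]; neither of these contains [i]. *)
apply: (@gen_notin_parabolic i (rev p ++ p0 ++ j :: rev p0 ++ p)).
  move: iu0; rewrite eu0 !(mem_cat, in_cons, mem_rev) !negb_or ip.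
  by move=> /and3P[-> -> _].
by rewrite !(word_elt_cat, word_elt_rev, word_elt_cons) -et e1 !mulgA.
Qed.

(** A letter [y] that occurs once in [u] and not in [v] could be solved for, which would give a word
    for its generator without [y]. *)
Lemma uniq_word_sub u v : uniq u -> word_elt u = word_elt v -> {subset u <= v}.
Proof.
move=> uu e y yu; apply/negPn/negP => yv.
have [p [q [eu yp]]] := first_split yu.
have yq : y \notin q by move: uu; rewrite eu cat_uniq => /and3P[_ _ /= /andP[]].
apply: (@gen_notin_parabolic y (rev p ++ v ++ rev q)).
  by rewrite !(mem_cat, mem_rev) !negb_or yp yv yq.
rewrite !word_elt_cat -e eu !(word_elt_cat, word_elt_rev, word_elt_cons).
by rewrite -!mulgA mulgV mulg1 mulKg.
Qed.

Lemma uniq_reduced u v : uniq u -> reduced_word (word_elt u) v -> size v = size u /\ u =i v.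
Proof.
move=> uu [ev sv]; have sub := uniq_word_sub uu (esym ev).
have szv : size v <= size u by rewrite sv aff_length_le.
have [e1 e2] := uniq_min_size uu sub szv; split=> //; by apply/eqP; rewrite e1.
Qed.

Lemma uniq_length u : uniq u -> aff_length (word_elt u) = size u.
Proof.
by move=> uu; have [v hv] := reduced_word_ex (word_elt u); have [<- _] := uniq_reduced uu hv; case: hv.
Qed.

Lemma uniq_con u : uniq u -> con (word_elt u) = [set i in u]%SET.
Proof.
move=> uu; apply/setP => i; rewrite !inE; apply/asboolP/idP.
  by case=> v /(uniq_reduced uu)[_ ->].
by move=> iu; exists u => //; split=> //; rewrite uniq_length.
Qed.

(** * Cyclically decreasing words *)

Lemma cyc_dec_word_tail i u : cyc_dec_word (i :: u) -> cyc_dec_word u.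
Proof.
case=> /= /andP[iu uu] h; split=> // j ju pu; have := h j.
rewrite !inE ju pu !orbT => /(_ isT isT).
have [e|_] := eqVneq i (ord_pred j); first by move: iu; rewrite e pu.
by have [e|_] := eqVneq i j; first by move: iu; rewrite e ju.
Qed.

Lemma cyc_dec_word_del p i q : cyc_dec_word (p ++ i :: q) -> cyc_dec_word (p ++ q).
Proof.
case; rewrite cat_uniq /= negb_or => /and3P[up /andP[ip pq] /andP[iq uq]] h; split.
  by rewrite cat_uniq up pq.
move=> j; rewrite mem_cat => jpq; rewrite mem_cat => ppq; have := h j.
rewrite !mem_cat !inE.
have ji : (j == i) = false by apply/negP => /eqP e; move: jpq; rewrite e (negPf ip) (negPf iq).
have pi : (ord_pred j == i) = false.
  by apply/negP => /eqP e; move: ppq; rewrite e (negPf ip) (negPf iq).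
rewrite ji pi /= jpq ppq => /(_ isT isT); rewrite !index_cat /=.
rewrite (eq_sym i) pi (eq_sym i) ji.
have sz k : k \in p -> index k p < size p by rewrite index_mem.
case: ifP => [/sz|_]; case: ifP => [/sz|_] //; lia.
Qed.

(** The first letter [i] of [u] commutes with every letter that precedes it in [v]: such a letter is
    not [i+1] because [u] is cyclically decreasing, and not [i-1] because [v] is. *)
Lemma cyc_dec_word_unique u v : cyc_dec_word u -> cyc_dec_word v -> u =i v ->
  word_elt u = word_elt v.
Proof.
elim: u v => [|i u IH] v cu cv uv.
  by case: v cv uv => // j v _ /(_ j); rewrite !inE eqxx.
have iv : i \in v by rewrite -uv inE eqxx.
have [p [q [ev ip]]] := first_split iv; have [uu hu] := cu; have [uv' hv] := cv.
have comm : forall p', {subset p' <= p} -> aff_gen i * word_elt p' = word_elt p' * aff_gen i.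
  elim=> [|j p' IHp] sub; first by rewrite word_elt_nil mulg1 mul1g.
  have jp : j \in p by apply: sub; rewrite inE eqxx.
  have jv : j \in v by rewrite ev mem_cat jp.
  have ji : i != j by apply/negP => /eqP e; move: ip; rewrite e jp.
  have -> : aff_gen i * word_elt (j :: p') = aff_gen j * (aff_gen i * word_elt p').
    rewrite word_elt_cons !mulgA (aff_gen_comm ji) //; apply/negP => /eqP e.
      have := hu j; rewrite uv jv e ordSK inE eqxx => /(_ isT isT) /=.
      by rewrite eqxx -e (negPf ji).
    have := hv i; rewrite e ordSK jv -e iv => /(_ isT isT); rewrite ev !index_cat jp (negPf ip) /=.
    by rewrite eqxx addn0 index_mem jp.
  rewrite IHp ?word_elt_cons ?mulgA // => k kp; apply: sub.
  by rewrite inE kp orbT.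
rewrite ev word_elt_cat !word_elt_cons mulgA -comm // -mulgA -word_elt_cat; congr (_ * _).
have iq : i \notin q by move: uv'; rewrite ev cat_uniq /= => /and3P[_ _ /andP[]].
apply: IH; first exact: cyc_dec_word_tail cu.
  by apply: (@cyc_dec_word_del p i q); rewrite -ev.
move=> k; have := uv k; rewrite ev !(mem_cat, inE).
have [->|//] := eqVneq k i.
by move: uu => /= /andP[/negPf -> _] _; rewrite (negPf ip) (negPf iq).
Qed.

End Words.

(** * Words in the letters of the parabolic subgroup *)

Definition far (a b : nat) := (a.+1 < b) || (b.+1 < a).

Section Parabolic.
Variables (n : nat) (x : 'I_n).
Implicit Types (p q u v A B R : seq nat).

(* The letter at position k in the order x+1 < ... < n-1 < 0 < ... < x-1 < x. *)
Definition ltr (k : nat) : 'I_n := insubd x ((k + x.+1) %% n).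

Lemma n_gt0 : 0 < n.
Proof. exact: leq_ltn_trans (ltn_ord x). Qed.

Lemma val_ltr k : val (ltr k) = (k + x.+1) %% n.
Proof. by rewrite val_insubd ltn_mod n_gt0. Qed.

Lemma xrankK : cancel (xrank x) ltr.
Proof.
move=> a; apply: val_inj; rewrite val_ltr /xrank modnDml subnK; last first.
  by have := ltn_ord x; lia.
by rewrite modnDr modn_small.
Qed.

Lemma xrank_lt a : xrank x a < n.
Proof. by rewrite ltn_mod n_gt0. Qed.

Lemma ltrK k : k < n -> xrank x (ltr k) = k.
Proof.
move=> kn; rewrite /xrank val_ltr; have xn := ltn_ord x.
have [lt|ge] := ltnP (k + x.+1) n.
  by rewrite (modn_small lt) (_ : _ - _ = k + n); [rewrite modnDr modn_small|lia].
have -> : (k + x.+1) %% n = k + x.+1 - n.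
  by rewrite -{1}(subnK ge) modnDr modn_small //; lia.
by rewrite (_ : _ - _ = k) ?modn_small //; lia.
Qed.

Lemma ordS_ltr k : ordS (ltr k) = ltr k.+1.
Proof.
by apply: val_inj; rewrite /= val_ltr -[X in _ = X]/(val (ltr k.+1)) val_ltr -addn1 modnDml addn1.
Qed.

Lemma ltr_last : ltr n.-1 = x.
Proof.
apply: val_inj; rewrite val_ltr; have xn := ltn_ord x.
by rewrite (_ : n.-1 + x.+1 = x + n) ?modnDr ?modn_small //; lia.
Qed.

Lemma xrank_x : xrank x x = n.-1.
Proof. by rewrite -{2}ltr_last ltrK //; have := n_gt0; lia. Qed.

Lemma xrank_inj : injective (xrank x).
Proof. exact: can_inj xrankK. Qed.

Lemma xrank_ne a : (a != x) = (xrank x a < n.-1).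
Proof.
have := xrank_lt a; have [->|ne] := eqVneq a x; first by rewrite xrank_x ltnn.
have : xrank x a != n.-1 by rewrite -xrank_x (inj_eq xrank_inj).
lia.
Qed.

Lemma ltr_eq j k : j < n -> k < n -> (ltr j == ltr k) = (j == k).
Proof. by move=> jn kn; apply/eqP/eqP => [e|->//]; rewrite -(ltrK jn) e ltrK. Qed.

(** Position [n.-1] is the letter [x], so these are the words avoiding [x]. *)
Definition okw u := all (gtn n.-1) u.

(* The word is reversed, since a factorization w^m ... w^1 is read from w^1. *)
Definition celt u : affine_sym n := word_elt [seq ltr k | k <- rev u].

Definition red u := okw u && (aff_length (celt u) == size u).

Local Open Scope group_scope.

Lemma celt_nil : celt [::] = 1.
Proof. exact: word_elt_nil. Qed.

Lemma celt_cat u v : celt (u ++ v) = celt v * celt u.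
Proof. by rewrite /celt rev_cat map_cat word_elt_cat. Qed.

Lemma celt1 k : celt [:: k] = aff_gen (ltr k).
Proof. exact: word_elt1. Qed.

Lemma celt_cons k u : celt (k :: u) = celt u * aff_gen (ltr k).
Proof. by rewrite -cat1s celt_cat celt1. Qed.

Lemma celt_ctx p q u v : celt u = celt v -> celt (p ++ u ++ q) = celt (p ++ v ++ q).
Proof. by rewrite !celt_cat => ->. Qed.

Lemma okw_cat u v : okw (u ++ v) = okw u && okw v.
Proof. exact: all_cat. Qed.

Lemma red_ok u : red u -> okw u.
Proof. by case/andP. Qed.

Lemma celt_length u : (aff_length (celt u) <= size u)%N.
Proof. by have := aff_length_le [seq ltr k | k <- rev u]; rewrite size_map size_rev. Qed.

Lemma red_eq u v : red u -> okw v -> size v = size u -> celt v = celt u -> red v.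
Proof. by move=> /andP[_ h] ov sv ev; rewrite /red ov ev sv. Qed.

Lemma red_infix p u q : red (p ++ u ++ q) -> red u.
Proof.
rewrite /red !okw_cat => /andP[/and3P[_ -> _] /eqP h] /=.
rewrite eqn_leq celt_length /=.
have [v [ev sv]] := reduced_word_ex (celt u).
rewrite -sv; have := aff_length_le ([seq ltr k | k <- rev q] ++ v ++ [seq ltr k | k <- rev p]).
rewrite !word_elt_cat ev -!/(celt _) mulgA -celt_cat -celt_cat h !size_cat !size_map !size_rev.
lia.
Qed.

Lemma red_infixl p u : red (p ++ u) -> red u.
Proof. by rewrite -{1}(cats0 u); apply: red_infix. Qed.

Lemma red_infixr u q : red (u ++ q) -> red u.
Proof. exact: (@red_infix [::]). Qed.

Lemma red_square k : red [:: k; k] = false.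
Proof.
apply/negP => /andP[_]; rewrite celt_cons celt1 aff_gen2 -celt_nil.
by have := celt_length [::]; rewrite leqn0 => /eqP->.
Qed.

Lemma celt_comm j k : (j < n.-1)%N -> (k < n.-1)%N -> far j k ->
  celt [:: j; k] = celt [:: k; j].
Proof.
move=> jn kn f; rewrite !celt_cons !celt_nil !mul1g; apply: aff_gen_comm;
  rewrite ?ordS_ltr ltr_eq; move: f; rewrite /far; lia.
Qed.

Lemma celt_braid k : celt [:: k; k.+1; k] = celt [:: k.+1; k; k.+1].
Proof. by rewrite !celt_cons celt_nil !mul1g -ordS_ltr aff_gen_braid. Qed.

Lemma celt_far a u : (a < n.-1)%N -> okw u -> all (far a) u ->
  celt (a :: u) = celt (u ++ [:: a]).
Proof.
move=> an; elim: u => [|b u IH] //= /andP[bn ou] /andP[fb fu].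
rewrite celt_cons (celt_cons b) -(celt_cons b) -cat1s.
have -> : celt ([:: b] ++ u) * aff_gen (ltr a) = celt ([:: a; b] ++ u).
  by rewrite /= !celt_cons.
rewrite celt_cat (celt_comm an bn fb) -celt_cat /= celt_cons IH //.
by rewrite -celt_cons.
Qed.

Lemma celt_far2 u v : okw u -> okw v -> all (fun a => all (far a) v) u ->
  celt (u ++ v) = celt (v ++ u).
Proof.
move=> + ov; elim: u => [|a u IH] /=; first by rewrite cats0.
move=> /andP[an ou] /andP[fa fu].
rewrite celt_cons IH // -celt_cons -[a :: _]/((a :: v) ++ u) celt_cat.
by rewrite celt_far // -celt_cat -catA.
Qed.


Lemma celt_swap p u v q : okw u -> okw v -> (forall a b, a \in u -> b \in v -> far a b) ->
  celt (p ++ u ++ v ++ q) = celt (p ++ v ++ u ++ q).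
Proof.
move=> ou ov f; have h : celt (u ++ v) = celt (v ++ u).
  by apply: celt_far2 => //; apply/allP => a au; apply/allP => b bv; apply: f.
by rewrite (catA u) (catA v); apply: celt_ctx.
Qed.

(** The new [a] commutes past the letters of [R] above [a], which all exceed [a.+1], and meets the
    other [a] in a square. *)
Lemma red_good R a : srt R -> red (R ++ [:: a]) -> (a \in R) ==> (a.+1 \in R).
Proof.
move=> sR rR; apply/implyP => aR; apply/negPn/negP => na.
case/splitPr: aR sR rR na => R1 R2; rewrite srt_cat => /and3P[_ + _].
rewrite srt_cons => /andP[aR2 _] rR; rewrite mem_cat inE !negb_or => /and3P[_ _ aR2'].
have := red_ok rR; rewrite -catA okw_cat /= okw_cat => /and3P[o1 oa /andP[o2 _]].
suff : red (R1 ++ [:: a; a] ++ R2) by move/red_infix; rewrite red_square.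
apply: (red_eq rR).
- by rewrite !okw_cat /= o1 oa o2.
- by rewrite !size_cat /=; lia.
have := @celt_swap (R1 ++ [:: a]) [:: a] R2 [::] _ o2 _; rewrite -!catA /= cats0.
apply=> [|c b]; rewrite /= ?oa // inE => /eqP-> bR; have /= := allP aR2 _ bR; rewrite /far.
have : b != a.+1 by apply/negP => /eqP e; move: aR2'; rewrite -e bR.
nlia.
Qed.

(** The bumped letter moves left past smaller letters and [a] moves left past larger ones; only the
    special rule needs a braid relation. *)
Lemma nrow_celt R a : srt R -> okw (R ++ [:: a]) -> (a \in R) ==> (a.+1 \in R) ->
  let ro := nrow a R in
  [/\ okw (oseq ro.2 ++ ro.1), size (oseq ro.2 ++ ro.1) = (size R).+1
    & celt (oseq ro.2 ++ ro.1) = celt (R ++ [:: a])].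
Proof.
move=> sR ok g /=; case: (nrowP sR g) ok => [ha|R1 R2 eR h1 h2|R1 b R2 eR h1 h2 h3] /=.
- by rewrite cats1 => ->; rewrite size_rcons.
- rewrite eR -catA okw_cat => /andP[o1 /= /and3P[oa oa1]]; rewrite okw_cat /= => /andP[o2 _].
  split; rewrite ?okw_cat /= ?okw_cat ?o1 /= ?oa ?oa1 ?o2 //.
  rewrite -[LHS]/(celt ([::] ++ [:: a.+1] ++ R1 ++ [:: a, a.+1 & R2])).
  rewrite celt_swap /= ?oa1 //; last first.
    by move=> c b; rewrite inE => /eqP-> /(allP h1) /=; rewrite /far; nlia.
  rewrite -[RHS]/(celt (R1 ++ [:: a; a.+1] ++ R2 ++ [:: a])).
  rewrite -[in RHS](cats0 [:: a]) (catA R1) -(celt_swap _ (u := [:: a])) /= ?oa //; last first.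
    by move=> c b; rewrite inE => /eqP-> /(allP h2) /=; rewrite /far; nlia.
  by rewrite cats0 -catA /= (@celt_ctx R1 R2 [:: a.+1; a; a.+1] [:: a; a.+1; a]) // celt_braid.
- rewrite eR -catA okw_cat /= okw_cat => /and3P[o1 ob /= /andP[o2 /andP[oa _]]].
  split; rewrite ?okw_cat /= ?okw_cat ?ob ?o1 /= ?oa ?o2 //.
    by rewrite !size_cat /=; lia.
  rewrite -[LHS]/(celt ([::] ++ [:: b] ++ R1 ++ a :: R2)).
  rewrite celt_swap /= ?ob //; last first.
    by move=> c d; rewrite inE => /eqP-> /(allP h1) /=; rewrite /far; nlia.
  rewrite -[RHS]/(celt (R1 ++ [:: b] ++ R2 ++ [:: a])).
  rewrite -[in RHS](cats0 [:: a]) (catA R1) -(celt_swap _ (u := [:: a])) /= ?oa //; last first.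
    by move=> c d; rewrite inE => /eqP-> /(allP h3) /=; rewrite /far; nlia.
  by rewrite cats0 -catA.
Qed.

(** Reducedness supplies the guard of every insertion. The prefix [p] collects the letters bumped so
    far, so that the induction always sees the whole reduced word. *)
Lemma rins_celt p R u : srt R -> red (p ++ R ++ u) ->
  [/\ gins R u, red (p ++ (rins R u).2 ++ (rins R u).1)
    & celt ((rins R u).2 ++ (rins R u).1) = celt (R ++ u)].
Proof.
elim: u p R => [|a u IH] p R sR rR /=; first by rewrite cats0 in rR *.
have rRa : red (R ++ [:: a]).
  by move: rR; rewrite -cat1s (catA R); apply: red_infix.
have g := red_good sR rRa; have [o1 s1 e1] := nrow_celt sR (red_ok rRa) g.
have rR' : red ((p ++ oseq (nrow a R).2) ++ (nrow a R).1 ++ u).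
  apply: (red_eq rR).
  - move: o1; rewrite -catA !okw_cat => /andP[-> ->] /=.
    by move/red_ok: rR; rewrite !okw_cat /= => /and3P[-> _ /andP[]].
  - by move: s1; rewrite !size_cat /=; lia.
  - by rewrite -catA (catA (oseq _)) -(cat1s a) (catA R); apply: celt_ctx.
have [g' r' e'] := IH _ _ (nrow_srt sR g) rR'.
split; rewrite ?g ?g' //; first by rewrite -!catA in r' *.
rewrite -catA celt_cat e' -celt_cat catA -(cat1s a) (catA R).
by rewrite celt_cat e1 -celt_cat.
Qed.

Lemma celt_content u v : okw u -> okw v -> uniq u -> uniq v -> celt u = celt v -> u =i v.
Proof.
move=> ou ov uu uv e.
have inj w : okw w -> uniq w -> uniq [seq ltr k | k <- rev w].
  move=> ow uw; rewrite map_inj_in_uniq ?rev_uniq // => j k; rewrite !mem_rev.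
  move=> /(allP ow) /= jn /(allP ow) /= kn /eqP.
  by rewrite ltr_eq; [move/eqP|nlia|nlia].
have H w w' : okw w -> okw w' -> uniq w -> celt w = celt w' -> {subset w <= w'}.
  move=> ow ow' uw e' k kw; have := uniq_word_sub (inj _ ow uw) e' (x := ltr k).
  rewrite map_f ?mem_rev // => /(_ isT) /mapP[j]; rewrite mem_rev => jw /eqP.
  have /= := allP ow _ kw; have /= := allP ow' _ jw => jn kn.
  by rewrite ltr_eq; [move/eqP->|nlia|nlia].
by move=> k; apply/idP/idP; apply: H.
Qed.

(** A letter that passes from right to left through the run turns into its successor, by one braid
    relation. *)
Lemma celt_iota_shift s k : okw (iota s k) ->
  celt (iota s k ++ iota s k.-1) = celt (iota s.+1 k.-1 ++ iota s k).
Proof.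
move=> ok; suff H j : (j <= k.-1)%N ->
    celt (iota s k ++ iota s j) = celt (iota s.+1 j ++ iota s k) by apply: H.
have okm i : (s <= i < s + k)%N -> (i < n.-1)%N by move=> h; apply: (allP ok); rewrite mem_iota.
elim: j => [|j IH] jk; first by rewrite cats0.
rewrite -addn1 !iotaD /= catA celt_cat IH; last nlia.
rewrite -celt_cat -!catA /=.
rewrite celt_cat [RHS]celt_cat; congr (_ * _).
have ek : iota s k = iota s j ++ [:: s + j; (s + j).+1] ++ iota (s + j.+2) (k - j.+2).
  have {1}-> : k = (j + (2 + (k - j.+2)))%N by nlia.
  by rewrite iotaD /= !addnS.
have okf (u : seq nat) : {subset u <= iota s k} -> okw u.
  by move=> sub; apply/allP => i /sub; apply: (allP ok).
have ok1 : okw (iota (s + j.+2) (k - j.+2)).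
  by apply: okf => i; rewrite !mem_iota; nlia.
have ok0 : okw (iota s j) by apply: okf => i; rewrite !mem_iota; nlia.
have ok2 : okw [:: s + j]%N by rewrite /= okm //; nlia.
have ok3 : okw [:: (s + j).+1]%N by rewrite /= okm //; nlia.
rewrite ek -!catA.
rewrite -{1}(cats0 [:: (s + j)%N]) (catA (iota s j)).
rewrite -(celt_swap _ (u := [:: (s + j)%N])) //; last first.
  by move=> c d; rewrite inE => /eqP->; rewrite mem_iota /far; nlia.
rewrite cats0 -catA.
have -> : ((s + j).+1 :: iota s j ++ [:: s + j; (s + j).+1] ++ iota (s + j.+2) (k - j.+2) =
  [::] ++ [:: (s + j).+1] ++ iota s j ++ [:: s + j; (s + j).+1] ++ iota (s + j.+2) (k - j.+2))%N by [].
rewrite (celt_swap _ _ ok3 ok0); last first.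
  by move=> c d; rewrite inE => /eqP->; rewrite mem_iota /far; nlia.
exact: (@celt_ctx (iota s j) _ _ _ (celt_braid (s + j)%N)).
Qed.

Lemma srt_iota s k : srt (iota s k).
Proof. exact: iota_ltn_sorted. Qed.

Lemma run_split A s e : srt A -> (s <= e.+1)%N -> (forall j, s <= j <= e -> j \in A)%N ->
  A = [seq a <- A | (a < s)%N] ++ iota s (e.+1 - s) ++ [seq a <- A | (e < a)%N].
Proof.
move=> sA se run; apply: srt_eq => //.
  rewrite !srt_cat srt_iota !sorted_filter //; try exact: ltn_trans.
  rewrite /=; apply/andP; split; apply/allP => a; rewrite ?mem_filter ?mem_iota => ha;
    by apply/allP => b; rewrite ?mem_cat ?mem_iota ?mem_filter /=; nlia.
move=> a; rewrite !mem_cat !mem_filter mem_iota.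
have [h|h] := boolP ((s <= a) && (a <= e)); first by rewrite run //; nlia.
by case: (a \in A); nlia.
Qed.

(** If it failed, the letters that keep the two copies of the run [s, e] apart would be absent, and
    commutations would bring the copies together. Shifting one through the other by
    [celt_iota_shift] then produces the square of [e]. *)
Lemma red_norun A B : srt A -> srt B -> red (A ++ B) -> norun A B.
Proof.
move=> sA sB rAB s e se run eA; apply/negPn/negP => nB.
have runA j : (s <= j <= e)%N -> j \in A by move=> /run /andP[].
have runB j : (s <= j <= e)%N -> j \in B by move=> /run /andP[].
have eA' := run_split sA (leqW se) runA; have eB' := run_split sB (leqW se) runB.
set A1 := [seq a <- A | _] in eA'; set A2 := [seq a <- A | _] in eA'.
set B1 := [seq a <- B | _] in eB'; set B2 := [seq a <- B | _] in eB'.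
set I := iota s (e.+1 - s) in eA' eB'.
have {}rAB : red (I ++ A2 ++ B1 ++ I).
  move: rAB; rewrite eA' eB' -!catA => /red_infixl.
  by rewrite (catA I) (catA _ B1) (catA _ I) => /red_infixr; rewrite -!catA.
have := red_ok rAB; rewrite !okw_cat => /and4P[oI oA2 oB1 _].
have fA2 a b : a \in A2 -> b \in B1 -> far a b.
  by rewrite !mem_filter /far => /andP[+ _] /andP[+ _]; nlia.
have A2gt a : a \in A2 -> (e.+1 < a)%N.
  rewrite mem_filter => /andP[ea aA]; have : a != e.+1 by apply: contraNneq eA => <-.
  nlia.
have B1lt b : b \in B1 -> (b.+1 < s)%N.
  rewrite mem_filter => /andP[bs bB]; have : b != s.-1.
    by apply: contraNneq nB => <-; rewrite bB andbT; nlia.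
  nlia.
have r2 : red (B1 ++ (I ++ I) ++ A2).
  apply: (red_eq rAB).
  - by rewrite !okw_cat oI oA2 oB1.
  - by rewrite !size_cat; nlia.
  have h1 : celt (I ++ A2 ++ B1 ++ I) = celt (I ++ (B1 ++ I) ++ A2 ++ [::]).
    rewrite -(celt_swap I (u := A2) (v := B1 ++ I)) ?cats0 ?okw_cat ?oB1 //.
    move=> a b /A2gt ha; rewrite mem_cat => /orP[/B1lt|]; rewrite ?mem_iota /far; nlia.
  have h2 : celt ([::] ++ I ++ B1 ++ I ++ A2) = celt ([::] ++ B1 ++ I ++ I ++ A2).
    apply: celt_swap => // a b; rewrite mem_iota => ha /B1lt; rewrite /far; nlia.
  by rewrite h1 cats0 -!catA; apply: esym.
have {r2} := red_infix r2.
have eI : I = iota s (e - s) ++ [:: e].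
  by rewrite /I subSn // -addn1 iotaD /= subnKC.
rewrite {2}eI catA => r2.
have : red (iota s.+1 (e - s) ++ I ++ [:: e]).
  apply: (red_eq r2).
  - rewrite !okw_cat oI /=; move: (oI); rewrite eI okw_cat /= => /andP[_ ->]; rewrite !andbT.
    by apply/allP => a; rewrite mem_iota => ha; apply: (allP oI); rewrite mem_iota; nlia.
  - by rewrite !size_cat !size_iota; nlia.
  - rewrite catA [LHS]celt_cat [RHS]celt_cat; congr (_ * _); rewrite /I.
    by have := celt_iota_shift oI; rewrite (_ : (e.+1 - s).-1 = e - s)%N; [move->|nlia].
rewrite {1}eI -!catA => /red_infixl /red_infixl.
by rewrite red_square.
Qed.

(* (c+1 ... b)(c ... b) = (c ... b)(c ... b-1), and the other letters commute past. *)
Lemma celt_move A B A' B' b c : srt A -> srt B -> srt A' -> srt B' -> okw A -> okw B ->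
  (c <= b)%N -> (forall j, c <= j <= b -> j \in B)%N -> ~~ ((0 < c)%N && (c.-1 \in B)) ->
  (forall j, c < j <= b -> j \in A)%N -> c \notin A -> b.+1 \notin A ->
  (forall j, (j \in A') = (j == c) || (j \in A)) ->
  (forall j, (j \in B') = (j != b) && (j \in B)) ->
  celt (A' ++ B') = celt (A ++ B).
Proof.
move=> sA sB sA' sB' oA oB cb runB cB runA cA bA mA mB.
have oA' : okw A'.
  apply/allP => j; rewrite mA => /predU1P[->|/(allP oA)//].
  by apply: (allP oB); apply: runB; nlia.
have oB' : okw B' by apply/allP => j; rewrite mB => /andP[_ /(allP oB)].
pose A1 := [seq a <- A | (a < c)%N]; pose A2 := [seq a <- A | (b < a)%N].
pose B1 := [seq a <- B | (a < c)%N]; pose B2 := [seq a <- B | (b < a)%N].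
have lt_tr := ltn_trans.
have eA : A = A1 ++ iota c.+1 (b - c) ++ A2.
  rewrite {1}(run_split (s := c.+1) (e := b) sA) //; congr (_ ++ _ ++ _).
  apply: eq_in_filter => a aA; have : a != c by apply: contraNneq cA => <-.
  nlia.
have eB : B = B1 ++ iota c (b.+1 - c) ++ B2 by apply: run_split => //; nlia.
have eA' : A' = A1 ++ iota c (b.+1 - c) ++ A2.
  rewrite (run_split (s := c) (e := b) sA'); last 2 first.
  - by nlia.
  - by move=> j hj; rewrite mA; have [//|ne] := eqVneq j c; rewrite runA ?orbT //; nlia.
  congr (_ ++ _ ++ _); apply: srt_eq; rewrite ?sorted_filter // => j; rewrite !mem_filter mA;
    by have [->|//] := eqVneq j c; rewrite ?ltnn //; nlia.
have eB' : B' = B1 ++ iota c (b - c) ++ B2.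
  have [e|ne] := eqVneq c b; last first.
    rewrite (run_split (s := c) (e := b.-1) sB'); last 2 first.
    - by nlia.
    - by move=> j hj; rewrite mB runB; nlia.
    congr (_ ++ _ ++ _); [|congr iota; nlia|];
    apply: srt_eq; rewrite ?sorted_filter // => j; rewrite !mem_filter mB;
    by case: (j \in B); nlia.
  rewrite e subnn /=; apply: srt_eq => //.
    rewrite srt_cat !sorted_filter //; apply/allP => a; rewrite mem_filter => ha.
    by apply/allP => d; rewrite mem_filter /=; nlia.
  by move=> j; rewrite mem_cat !mem_filter mB; case: (j \in B); nlia.
have fil w (P : pred nat) : okw w -> okw [seq a <- w | P a].
  by move=> ow; apply/allP => a; rewrite mem_filter => /andP[_ /(allP ow)].
have oI : okw (iota c (b.+1 - c)) by move: oB; rewrite eB !okw_cat => /and3P[].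
have oI' : okw (iota c (b - c)) by move: oB'; rewrite eB' !okw_cat => /and3P[].
have oI1 : okw (iota c.+1 (b - c)) by move: oA; rewrite eA !okw_cat => /and3P[].
have [oA2 oB1] : okw A2 /\ okw B1 by split; apply: fil.
have A2gt a : a \in A2 -> (b.+1 < a)%N.
  rewrite mem_filter => /andP[ea aA]; have : a != b.+1 by apply: contraNneq bA => <-.
  nlia.
have B1lt d : d \in B1 -> (d.+1 < c)%N.
  rewrite mem_filter => /andP[bs bB]; have : d != c.-1.
    by apply: contraNneq cB => <-; rewrite bB andbT; nlia.
  nlia.
have H J K : okw J -> okw K -> {subset J <= iota c (b.+1 - c)} ->
    {subset K <= iota c (b.+1 - c)} ->
    celt ((A1 ++ J ++ A2) ++ (B1 ++ K ++ B2)) = celt ((A1 ++ B1) ++ (J ++ K) ++ (A2 ++ B2)).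
  move=> oJ oK sJ sK; rewrite -!catA !(catA A1 J) (catA B1 K).
  rewrite (celt_swap _ _ oA2 (v := B1 ++ K)) ?okw_cat ?oB1 //; last first.
    move=> a d /A2gt ha; rewrite mem_cat => /orP[/B1lt|/sK]; rewrite ?mem_iota /far; nlia.
  rewrite -!catA (celt_swap _ _ oJ oB1) // => a d /sJ; rewrite mem_iota => ha /B1lt.
  rewrite /far; nlia.
rewrite eA eB eA' eB' !H //; try by move=> j; rewrite !mem_iota; nlia.
apply: celt_ctx; have := celt_iota_shift oI.
by rewrite (_ : (b.+1 - c).-1 = b - c)%N //; nlia.
Qed.

End Parabolic.

(** * Coxeter-Knuth equivalence *)

Lemma filter_none (T : Type) (P : pred T) s : all (predC P) s -> filter P s = [::].
Proof. by elim: s => //= a s IH /andP[/negPf -> /IH]. Qed.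

Lemma filter_every (T : Type) (P : pred T) s : all P s -> filter P s = s.
Proof. by elim: s => //= a s IH /andP[-> /IH ->]. Qed.

Lemma nrow_appE a S : all (gtn a) S -> nrow a S = (rcons S a, None).
Proof.
by move=> h; rewrite /nrow filter_none //; apply: sub_all h => b /=; nlia.
Qed.

Lemma nrow_bumpE a S1 b S2 : all (gtn a) S1 -> a < b -> all (ltn a) S2 ->
  nrow a (S1 ++ b :: S2) = (S1 ++ a :: S2, Some b).
Proof.
move=> h1 h2 h3.
have f1 : [seq r <- S1 ++ b :: S2 | a < r] = b :: S2.
  rewrite filter_cat filter_none /= ?h2; first by rewrite filter_every.
  by apply: sub_all h1 => c /=; nlia.
have f2 : [seq r <- S1 ++ b :: S2 | r <= a] = S1.
  rewrite filter_cat filter_every /=; last by apply: sub_all h1 => c /=; nlia.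
  rewrite leqNgt h2 /= filter_none ?cats0 //; apply: sub_all h3 => c /=; nlia.
have na : a \in S1 ++ b :: S2 = false.
  apply/negP; rewrite mem_cat inE => /or3P[/(allP h1)|/eqP|/(allP h3)] /=; nlia.
by rewrite /nrow f1 na andbF f2.
Qed.

Lemma nrow_lastE a S b : all (gtn a) S -> a < b ->
  nrow a (rcons S b) = (rcons S a, Some b).
Proof. by move=> h ab; rewrite -!cats1 nrow_bumpE. Qed.

Lemma nrow_specialE a S : srt S -> a \in S -> a.+1 \in S -> nrow a S = (S, Some a.+1).
Proof.
move=> sS aS a1S; have g : (a \in S) ==> (a.+1 \in S) by rewrite a1S implybT.
case: (nrowP sS g) => [h|R1 R2 //|R1 b R2 eS h1 h2 h3].
  by have /= := allP h _ aS; rewrite ltnn.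
by move: aS; rewrite eS mem_cat inE => /or3P[/(allP h1)|/eqP|/(allP h3)] /=; nlia.
Qed.

Lemma nrow_catl a S1 S2 : has (ltn a) S1 -> all (ltn a) S2 ->
  nrow a (S1 ++ S2) = ((nrow a S1).1 ++ S2, (nrow a S1).2).
Proof.
move=> /hasP[b bS1 /= ab] S2a; rewrite /nrow filter_cat (filter_every S2a).
have bf : b \in [seq r <- S1 | a < r] by rewrite mem_filter ab.
case: [seq r <- S1 | a < r] bf => // c T _ /=; rewrite mem_cat.
have -> : a \in S2 = false by apply/negP => /(allP S2a) /=; rewrite ltnn.
rewrite orbF; case: ifP => //= _; rewrite filter_cat -!catA /=.
rewrite (filter_none (s := S2)) //; apply: sub_all S2a => d /=; nlia.
Qed.

Lemma nrow_catr a S1 S2 : all (gtn a) S1 ->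
  nrow a (S1 ++ S2) = (S1 ++ (nrow a S2).1, (nrow a S2).2).
Proof.
move=> h; rewrite /nrow !filter_cat mem_cat.
rewrite (filter_none (s := S1)); last by apply: sub_all h => d /=; nlia.
rewrite (filter_every (s := S1)); last by apply: sub_all h => d /=; nlia.
have -> : a \in S1 = false by apply/negP => /(allP h) /=; rewrite ltnn.
rewrite /=; case: [seq r <- S2 | a < r] => [|b T] /=; first by rewrite rcons_cat.
by case: ifP => //= _; rewrite catA.
Qed.

Lemma nrow_in a R : srt R -> (a \in R) ==> (a.+1 \in R) -> a \in (nrow a R).1.
Proof.
move=> sR g; case: (nrowP sR g) => [h|R1 R2 eR h1 h2|R1 b R2 eR h1 h2 h3] /=.
- by rewrite mem_rcons inE eqxx.
- by rewrite eR mem_cat inE eqxx orbT.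
- by rewrite mem_cat inE eqxx orbT.
Qed.

Lemma nrow_bumped a R b : srt R -> (a \in R) ==> (a.+1 \in R) -> (nrow a R).2 = Some b ->
  [/\ a < b, b \in R, forall r, r \in R -> a < r -> b <= r
    & forall r, r \in (nrow a R).1 -> a.+1 < r -> b < r].
Proof.
move=> sR g; case: (nrowP sR g) => [h|R1 R2 eR h1 h2|R1 c R2 eR h1 h2 h3] //= [<-].
  by split=> //; rewrite eR mem_cat !inE eqxx !orbT.
split=> //; first by rewrite eR mem_cat inE eqxx orbT.
  by move=> r; rewrite eR mem_cat !inE => /or3P[/(allP h1)|/eqP->|/(allP h3)] /=; nlia.
by move=> r; rewrite mem_cat !inE => /or3P[/(allP h1)|/eqP->|/(allP h3)] /=; nlia.
Qed.

(** The letter [y] separates the two insertions: that of [a] affects only the part of the row up to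
    [y], that of [c] only the part above. *)
Lemma nrow_comm R a c y : srt R -> y \in R -> a < y < c ->
  [/\ (nrow c (nrow a R).1).1 = (nrow a (nrow c R).1).1,
      (nrow c (nrow a R).1).2 = (nrow c R).2 & (nrow a (nrow c R).1).2 = (nrow a R).2].
Proof.
move=> sR yR /andP[ay yc]; have eR := srt_split y sR.
set S1 := [seq r <- R | r <= y] in eR; set S2 := [seq r <- R | y < r] in eR.
have hS1 : has (ltn a) S1 by apply/hasP; exists y => //; rewrite mem_filter leqnn.
have S1c : all (gtn c) S1 by apply/allP => r; rewrite mem_filter /= => /andP[+ _]; nlia.
have S1c' : all (gtn c) (nrow a S1).1.
  move: hS1 S1c; rewrite /nrow; case: [seq r <- S1 | a < r] (mem_filter (ltn a) ^~ S1) => [|b T] mf.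
    by move=> /hasP[r rS ar]; have := mf r; rewrite rS ar.
  move=> _ S1c; case: ifP => //= _; rewrite all_cat /= (ltn_trans ay yc) /=.
  apply/andP; split; apply/allP => r.
    by rewrite mem_filter => /andP[_ /(allP S1c)].
  by move=> rT; have := mf r; rewrite inE rT orbT => /esym/andP[_ /(allP S1c)].
have S2y d : d \in S2 -> y < d by rewrite mem_filter => /andP[].
have S2a : all (ltn a) S2 by apply/allP => d /S2y /=; nlia.
have S2a' : all (ltn a) (nrow c S2).1.
  apply/allP => r; rewrite /nrow; case e : [seq q <- S2 | c < q] => [|b U] /=.
    by rewrite mem_rcons inE => /predU1P[->|/(allP S2a)//]; nlia.
  case: ifP => _ /=; first exact: (allP S2a).
  rewrite mem_cat inE mem_filter => /or3P[/andP[_ /(allP S2a)]|/eqP->|rU] //; first by nlia.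
  apply: (allP S2a); have : r \in [seq q <- S2 | c < q] by rewrite e inE rU orbT.
  by rewrite mem_filter => /andP[].
have ea : nrow a R = ((nrow a S1).1 ++ S2, (nrow a S1).2) by rewrite {1}eR nrow_catl.
have ec : nrow c R = (S1 ++ (nrow c S2).1, (nrow c S2).2) by rewrite {1}eR nrow_catr.
by rewrite ea ec /= nrow_catr //= nrow_catl.
Qed.

Inductive ckr : seq nat -> seq nat -> Prop :=
| ckr1 a b c : a < b < c -> ckr [:: b; a; c] [:: b; c; a]
| ckr2 a b c : a < b < c -> ckr [:: a; c; b] [:: c; a; b]
| ckr3 a : ckr [:: a; a.+1; a] [:: a.+1; a; a.+1].

Inductive ck : seq nat -> seq nat -> Prop :=
| ck_step p q u v : ckr u v -> ck (p ++ u ++ q) (p ++ v ++ q)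
| ck_refl u : ck u u
| ck_sym u v : ck u v -> ck v u
| ck_trans u v w : ck u v -> ck v w -> ck u w.

Lemma ckrW u v : ckr u v -> ck u v.
Proof. by move=> h; have := ck_step [::] [::] h; rewrite /= !cats0. Qed.

Lemma ck_ctx p q u v : ck u v -> ck (p ++ u ++ q) (p ++ v ++ q).
Proof.
elim=> {u v} [p' q' u v h|u|u v _|u v w _ h1 _ h2].
- by rewrite -!catA !(catA p); apply: ck_step.
- exact: ck_refl.
- exact: ck_sym.
- exact: ck_trans h1 h2.
Qed.

Lemma ck_cat u u' v v' : ck u u' -> ck v v' -> ck (u ++ v) (u' ++ v').
Proof.
move=> h1 h2; apply: (@ck_trans _ (u' ++ v)).
  by have := ck_ctx [::] v h1.
by have := ck_ctx u' [::] h2; rewrite !cats0.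
Qed.

Lemma ck_size u v : ck u v -> size u = size v.
Proof.
elim=> {u v} [p q u v h|u|u v _|u v w _ -> _] //.
by rewrite !size_cat; case: h.
Qed.

Lemma split_gap R a c : srt R -> a <= c -> (forall r, r \in R -> r < a \/ c < r) ->
  exists S1 S2, [/\ R = S1 ++ S2, all (gtn a) S1 & all (ltn c) S2].
Proof.
move=> sR ac h; exists [seq r <- R | r <= a], [seq r <- R | a < r].
split; first exact: srt_split; apply/allP => r; rewrite mem_filter => /andP[ra /h[]] /=; nlia.
Qed.

Section Rows.
Variables (n : nat) (x : 'I_n).
Notation okw := (okw n).
Notation red := (red x).
Notation celt := (celt x).

Lemma ckr_celt u v : ckr u v -> okw u -> okw v /\ celt u = celt v.
Proof.
case=> [a b c abc|a b c abc|a] /=.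
- move=> /and4P[-> oa oc _]; rewrite oa oc; split=> //.
  have := @celt_swap n x [:: b] [:: a] [:: c] [::]; rewrite /= oa oc; apply=> //.
  by move=> i j; rewrite !inE => /eqP-> /eqP->; rewrite /far; lia.
- move=> /and4P[oa oc -> _]; rewrite oa oc; split=> //.
  have := @celt_swap n x [::] [:: a] [:: c] [:: b]; rewrite /= oa oc; apply=> //.
  by move=> i j; rewrite !inE => /eqP-> /eqP->; rewrite /far; lia.
- by move=> /and4P[-> -> _ _]; split=> //; apply: celt_braid.
Qed.

Lemma ck_celt u v : ck u v -> okw u = okw v /\ (okw u -> celt u = celt v).
Proof.
elim=> {u v} [p q u v h|u|u v _ [-> h]|u v w _ [e1 h1] _ [e2 h2]] //.
- have e : okw u = okw v.
    apply/idP/idP => [/(ckr_celt h)[]//|].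
    by case: h => [a b c _|a b c _|a] /=; do 3 case: (_ < _) => //.
  rewrite !okw_cat e; split=> // /and3P[_ ov _]; apply: celt_ctx.
  by apply: (ckr_celt h _).2; rewrite e.
- by split=> // /h.
- by split=> [|ou]; rewrite ?e1 // h1 // h2 // -e1.
Qed.

Lemma ck_red p q u v : ck u v -> red (p ++ u ++ q) -> red (p ++ v ++ q).
Proof.
move=> h r; have [e1 e2] := ck_celt h.
have := red_ok r; rewrite !okw_cat => /and3P[op ou oq].
apply: (red_eq r); first by rewrite !okw_cat op -e1 ou.
  by rewrite !size_cat (ck_size h).
by apply: celt_ctx; rewrite e2.
Qed.

Lemma rins3 R a b c : rins R [:: a; b; c] =
  let r1 := nrow a R in let r2 := nrow b r1.1 in let r3 := nrow c r2.1 in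
  (r3.1, oseq r1.2 ++ oseq r2.2 ++ oseq r3.2).
Proof. by rewrite /= cats0. Qed.

(** The bumped words need not be related by a move of the same kind: a Knuth move can become a
    braid, and conversely. *)
Lemma ckr_rins R u v : srt R -> gins R u -> gins R v -> ckr u v ->
  (rins R u).1 = (rins R v).1 /\ ck (rins R u).2 (rins R v).2.
Proof.
move=> sR gu gv h; case: h gu gv => [a b c /andP[ab bc]|a b c /andP[ab bc]|a];
  rewrite !rins3 /= !andbT.
- move=> /and3P[gb ga gc] /and3P[_ gc' ga'].
  have sR1 := nrow_srt sR gb; have bR1 := nrow_in sR gb.
  have abc : a < b < c by rewrite ab.
  have [-> -> ->] := nrow_comm sR1 bR1 abc; split=> //.
  case eb : (nrow b R).2 => [d|]; last first.
    suff -> : (nrow c (nrow b R).1).2 = None by rewrite /= cats0; apply: ck_refl.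
    move: eb; case: (nrowP sR gb) => //= hb _; rewrite nrow_appE // all_rcons /= bc /=.
    by apply: sub_all hb => r /=; nlia.
  case ec : (nrow c (nrow b R).1).2 => [d'|]; last by rewrite cats0; apply: ck_refl.
  case ea : (nrow a (nrow b R).1).2 => [d''|]; last exact: ck_refl.
  have [h1 _ _ h2] := nrow_bumped sR gb eb.
  have [h3 _ h4 _] := nrow_bumped sR1 ga ea; have := h4 _ bR1 ab => h5.
  apply: ckrW; apply: ckr1; apply/andP; split; first by nlia.
  by have [h6 h7 _ _] := nrow_bumped sR1 gc' ec; apply: h2 => //; nlia.
- move=> /and3P[ga gc gb] /and3P[gc' ga' _].
  (* If a letter of [R] lies strictly between [a] and [c], their insertions commute. Otherwise [R]
     has a gap there and the rows can be written out. *)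
  have [/hasP[y yR /= ayc]|hn] := boolP (has (fun y => (a < y) && (y < c)) R).
    have [e1 e2 e3] := nrow_comm sR yR ayc; rewrite e1 e2 e3; split=> //.
    case ec : (nrow c R).2 => [d|]; last exact: ck_refl.
    case ea : (nrow a R).2 => [d'|]; last exact: ck_refl.
    have sR2 := nrow_srt (nrow_srt sR gc') ga'.
    case eb : (nrow b (nrow a (nrow c R).1).1).2 => [d''|]; last first.
      move: eb; rewrite -e1; have := nrow_in (nrow_srt sR ga) gc.
      rewrite e1 => cR2; rewrite e1 in gb.
      by case: (nrowP sR2 gb) => //= /allP/(_ _ cR2) /=; nlia.
    rewrite e1 in gb; have [h1 h0 h2 _] := nrow_bumped sR2 gb eb.
    have [h3 _ h4 _] := nrow_bumped sR gc' ec.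
    have ea' : (nrow a (nrow c R).1).2 = Some d' by rewrite e3.
    have [h5 _ h6 h7] := nrow_bumped (nrow_srt sR gc') ga' ea'.
    apply: ckrW; apply: ckr2; apply/andP; split; last first.
      have := nrow_in (nrow_srt sR ga) gc; rewrite e1 => cR2.
      by have := h2 _ cR2 bc; nlia.
    by apply: h7 => //; nlia.
  have gap r : r \in R -> r <= a \/ c <= r.
    by move=> rR; have := hasPn hn _ rR; nlia.
  have aR : a \notin R.
    apply/negP => aR; move: ga; rewrite aR /= => /gap; nlia.
  (* For [c] in [R] the bumped words are [c, c+1, c] and [c+1, c, c+1]: the Knuth move becomes a
     braid. *)
  have [cR|cR] := boolP (c \in R).
    move: gc ga' gb; case: (nrowP sR gc') => [h|R1 R2 eR h1 h2|R1 d R2 eR h1 h2 h3] /=.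
    + by move: (allP h _ cR); rewrite /= ltnn.
    + have h1' : all (gtn a) R1.
        apply/allP => r rR1; have rR : r \in R by rewrite eR mem_cat rR1.
        have ra : r != a by apply: contraNneq aR => <-.
        by have /= := allP h1 _ rR1; have := gap _ rR; nlia.
      have h3 : all (ltn c) R2 by apply: sub_all h2 => r /=; nlia.
      have h4 : all (ltn a) R2 by apply: sub_all h2 => r /=; nlia.
      have h5 : all (ltn b) R2 by apply: sub_all h2 => r /=; nlia.
      have k1 : all (gtn b) (rcons R1 a).
        by rewrite all_rcons /= ab; apply: sub_all h1' => r /=; nlia.
      have k2 : all (gtn c) (rcons R1 a).
        by rewrite all_rcons /= (ltn_trans ab bc); apply: sub_all h1' => r /=; nlia.
      have e1 : nrow a R = (R1 ++ a :: c.+1 :: R2, Some c).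
        by rewrite eR nrow_bumpE //= ?h4 ?andbT; nlia.
      have e2 : nrow c (R1 ++ a :: c.+1 :: R2) = (R1 ++ a :: c :: R2, Some c.+1).
        by rewrite -!(cat_rcons a) nrow_bumpE.
      have e3 : nrow b (R1 ++ a :: c :: R2) = (R1 ++ a :: b :: R2, Some c).
        by rewrite -!(cat_rcons a) nrow_bumpE.
      have e4 : nrow b (R1 ++ a :: c.+1 :: R2) = (R1 ++ a :: b :: R2, Some c.+1).
        by rewrite -!(cat_rcons a) nrow_bumpE //; nlia.
      move=> _ _ _; rewrite e1 /= e2 /= e3 e4 /=; split=> //.
      by apply: ckrW; apply: ckr3.
    + by move: cR; rewrite eR mem_cat inE => /or3P[/(allP h1)|/eqP|/(allP h3)] /=; nlia.
  have [|r rR|S1 [S2 [eR h1 h2]]] := @split_gap R a c sR; first by nlia.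
    have ra : r != a by apply: contraNneq aR => <-.
    have rc : r != c by apply: contraNneq cR => <-.
    by have [] := gap _ rR; [left|right]; nlia.
  have k1 : all (gtn b) (rcons S1 a).
    by rewrite all_rcons /= ab; apply: sub_all h1 => r /=; nlia.
  have k2 : all (gtn c) (rcons S1 a).
    by rewrite all_rcons /= (ltn_trans ab bc); apply: sub_all h1 => r /=; nlia.
  have k3 : all (gtn c) S1 by move: k2; rewrite all_rcons => /andP[].
  have ac := ltn_trans ab bc.
  rewrite eR; case: S2 h2 eR => [_ _|d [|d' S2]] /=.
  + rewrite cats0 (nrow_appE h1) (nrow_appE k3) /= (nrow_appE k2) /=.
    rewrite (nrow_lastE k1 bc) (nrow_lastE h1 ac) /= (nrow_appE k1) /=.
    by split=> //; apply: ck_refl.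
  + rewrite andbT cats1 => cd _; have ad := ltn_trans ac cd.
    rewrite (nrow_lastE h1 ad) (nrow_lastE k3 cd) /= (nrow_appE k2) (nrow_lastE h1 ac) /=.
    rewrite (nrow_lastE k1 bc) (nrow_appE k1) /=.
    by split=> //; apply: ck_refl.
  + move=> /and3P[cd cd' h2] eR; have dd' : d < d'.
      by move: sR; rewrite eR srt_cat => /and3P[_ /= /andP[]].
    have j1 : all (ltn a) (d' :: S2) by rewrite /= (ltn_trans ac cd'); apply: sub_all h2 => r /=; nlia.
    have j2 : all (ltn b) (d' :: S2) by rewrite /= (ltn_trans bc cd'); apply: sub_all h2 => r /=; nlia.
    have j3 : all (ltn c) (d' :: S2) by rewrite /= cd'.
    have [j1' j2'] : all (ltn a) S2 /\ all (ltn b) S2 by split; [case/andP: j1|case/andP: j2].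
    have ad : a < d by nlia.
    rewrite (nrow_bumpE h1 ad j1) (nrow_bumpE k3 cd j3) /= (nrow_bumpE h1 ac j1) /=.
    rewrite -!(cat_rcons a) (nrow_bumpE k2 cd' h2) /= (nrow_bumpE k1 bc j2') /=.
    rewrite (nrow_bumpE k1 _ j2') /=; last by nlia.
    split=> //; apply: ck_sym; apply: ckrW; apply: ckr1; nlia.
- move=> /and3P[ga gb ga2] /and3P[gb' ga' gb2].
  have [aR|aR] := boolP (a \in R).
    move: ga; rewrite aR /= => bR.
    have e1 := nrow_specialE sR aR bR; move: gb; rewrite e1 /= bR /= => cR.
    have e2 := nrow_specialE sR bR cR; rewrite e2 /= e1 /= e2 /=; split=> //.
    by apply: ckrW; apply: ckr3.
  have a1 : a < a.+1 by [].
  have [bR|bR] := boolP (a.+1 \in R).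
    move: gb ga' ga2 gb2; case: (nrowP sR gb') => [h|R1 R2 eR h1 h2|R1 d R2 eR h1 h2 h3] /=.
    + by move: (allP h _ bR); rewrite /= ltnn.
    + have h1' : all (gtn a) R1.
        apply/allP => r rR1; have rR : r \in R by rewrite eR mem_cat rR1.
        have ra : r != a by apply: contraNneq aR => <-.
        by have /= := allP h1 _ rR1; nlia.
      have h3 : all (ltn a.+1) R2 by apply: sub_all h2 => r /=; nlia.
      have h4 : all (ltn a) R2 by apply: sub_all h2 => r /=; nlia.
      have k1 : all (gtn a.+1) (rcons R1 a).
        by rewrite all_rcons /= leqnn; apply: sub_all h1' => r /=; nlia.
      have e1 : nrow a R = (R1 ++ a :: a.+2 :: R2, Some a.+1).
        by rewrite eR nrow_bumpE //= ?h4 ?andbT; nlia.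
      have e2 : nrow a.+1 (R1 ++ a :: a.+2 :: R2) = (R1 ++ a :: a.+1 :: R2, Some a.+2).
        by rewrite -!(cat_rcons a) nrow_bumpE.
      have s2 : srt (R1 ++ a :: a.+1 :: R2).
        move: sR; rewrite eR !srt_cat !srt_cons /= => /and3P[-> /and3P[_ _ ->] h5].
        rewrite leqnn h4 h3 /=; apply/allP => r rR1.
        have /= /and3P[_ _ ->] := allP h5 _ rR1.
        by have /= := allP h1' _ rR1; nlia.
      have e3 : nrow a (R1 ++ a :: a.+1 :: R2) = (R1 ++ a :: a.+1 :: R2, Some a.+1).
        by apply: nrow_specialE => //; rewrite mem_cat !inE eqxx ?orbT.
      move=> _ _ _ _; rewrite e1 /= e2 /= e3 /=; split=> //.
      by apply: ckrW; apply: ckr3.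
    + by move: bR; rewrite eR mem_cat inE => /or3P[/(allP h1)|/eqP|/(allP h3)] /=; nlia.
  (* With neither [a] nor [a.+1] in [R], the bumped words agree or differ by a Knuth move instead of
     a braid. *)
  have [|r rR|S1 [S2 [eR h1 h2]]] := @split_gap R a a.+1 sR; first by nlia.
    have ra : r != a by apply: contraNneq aR => <-.
    have rc : r != a.+1 by apply: contraNneq bR => <-.
    by have [lt|ge] := ltnP r a; [left|right; nlia].
  have k1 : all (gtn a.+1) (rcons S1 a).
    by rewrite all_rcons /= leqnn; apply: sub_all h1 => r /=; nlia.
  have k3 : all (gtn a.+1) S1 by move: k1; rewrite all_rcons => /andP[].
  have sp T : all (ltn a.+1) T -> srt (S1 ++ T) ->
    nrow a (rcons S1 a ++ a.+1 :: T) = (rcons S1 a ++ a.+1 :: T, Some a.+1).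
    move=> hT sT; apply: nrow_specialE; last 2 first.
    - by rewrite mem_cat mem_rcons inE eqxx.
    - by rewrite mem_cat inE eqxx orbT.
    move: sT; rewrite cat_rcons !srt_cat !srt_cons => /and3P[-> -> h5].
    rewrite /= leqnn hT /= andbT; apply/andP; split; first by apply: sub_all hT => r /=; nlia.
    apply/allP => r rS; have /= -> := allP h5 _ rS.
    by have /= := allP h1 _ rS; nlia.
  move: sR; rewrite eR; case: S2 h2 {eR} => [_|d [|d' S2]] /= sR'.
  + have := sp [::] isT sR'; rewrite !cats1 !cats0 => sp'.
    rewrite (nrow_appE h1) (nrow_appE k3) /= (nrow_appE k1) /= sp' /=.
    rewrite (nrow_lastE h1 a1) /= (nrow_appE k1) /=.
    by split=> //; apply: ck_refl.
  + move=> sRd; move: sR'; rewrite andbT cats1 => cd; have ad := ltn_trans a1 cd.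
    have := sp [::] isT; rewrite !cats1 !cats0 => sp'.
    rewrite (nrow_lastE h1 ad) (nrow_lastE k3 cd) /= (nrow_appE k1) (nrow_lastE h1 a1) /=.
    rewrite sp' ?(nrow_appE k1) /=; last by move: sRd; rewrite srt_cat => /and3P[].
    by split=> //; apply: ck_refl.
  + move: sR' => /and3P[cd cd' h2] sR'; have dd' : d < d'.
      by move: sR'; rewrite srt_cat => /and3P[_ /= /andP[]].
    have j1 : all (ltn a) (d' :: S2).
      by rewrite /= (ltn_trans a1 cd'); apply: sub_all h2 => r /=; nlia.
    have j3 : all (ltn a.+1) (d' :: S2) by rewrite /= cd'.
    have ad : a < d by nlia.
    rewrite (nrow_bumpE h1 ad j1) (nrow_bumpE k3 cd j3) /= (nrow_bumpE h1 a1 j1) /=.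
    rewrite -!(cat_rcons a) (nrow_bumpE k1 cd' h2) /= sp //=; last first.
      move: sR'; rewrite !srt_cat !srt_cons => /and3P[-> /and3P[_ _ ->] h5] /=.
      by apply: sub_all h5 => r /= /and3P[].
    split=> //; apply: ck_sym; apply: ckrW; apply: ckr1; nlia.
Qed.

Lemma ck_rins R u v : srt R -> red (R ++ u) -> ck u v ->
  (rins R u).1 = (rins R v).1 /\ ck (rins R u).2 (rins R v).2.
Proof.
move=> sR rR h; elim: h rR => {u v} [p q u v h|u|u v h IH|u v w h1 IH1 _ IH2] rR.
- have [g r _] := @rins_celt _ x [::] R (p ++ u ++ q) sR rR.
  have rp : red (R ++ p) by move: rR; rewrite catA; apply: red_infixr.
  have [gp _ _] := @rins_celt _ x [::] R p sR rp; have sR1 := rins_srt sR gp.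
  have [_ r1 _] := @rins_celt _ x [::] R p sR rp.
  have gu : gins (rins R p).1 u by move: g; rewrite !gins_cat => /and3P[].
  have rR' : red (R ++ p ++ v ++ q).
    by have := ck_red (p := R ++ p) (q := q) (ckrW h); rewrite -!catA; apply.
  have [g' _ _] := @rins_celt _ x [::] R (p ++ v ++ q) sR rR'.
  have gv : gins (rins R p).1 v by move: g'; rewrite !gins_cat => /and3P[].
  have [e1 e2] := ckr_rins sR1 gu gv h.
  rewrite !rins_cat /= e1; split=> //; apply: ck_cat; first exact: ck_refl.
  by apply: ck_cat => //; apply: ck_refl.
- by split=> //; apply: ck_refl.
- have [|-> e] := IH; last by split=> //; apply: ck_sym.
  by have := ck_red (p := R) (q := [::]) (ck_sym h); rewrite !cats0; apply.
- have [e1 e2] := IH1 rR.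
  have [|e3 e4] := IH2; first by have := ck_red (p := R) (q := [::]) h1; rewrite !cats0; apply.
  by split; [rewrite e1|apply: ck_trans e2 e4].
Qed.

End Rows.

Lemma ck_pass_right a b R : a < b -> srt (b :: R) -> ck (b :: R ++ [:: a]) (b :: a :: R).
Proof.
elim: R b => [|r R IH] b ab; first by move=> _; apply: ck_refl.
rewrite srt_cons => /andP[/= /andP[br _] sR].
apply: (@ck_trans _ (b :: r :: a :: R)).
  by have := ck_ctx [:: b] [::] (IH r (ltn_trans ab br) sR); rewrite /= !cats0.
by have := @ck_step [::] R _ _ (@ckr1 a b r _); rewrite ab br => /(_ isT) /ck_sym.
Qed.

Lemma ck_pass_left a b R q : a < b -> srt (R ++ [:: a]) ->
  ck (R ++ b :: a :: q) (b :: R ++ a :: q).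
Proof.
move=> ab; elim: R => [|r R IH]; first by move=> _; apply: ck_refl.
rewrite cat_cons srt_cons => /andP[rR sR].
apply: (@ck_trans _ (r :: b :: R ++ a :: q)).
  by have := ck_ctx [:: r] [::] (IH sR); rewrite /= !cats0.
have bR : all (gtn b) (R ++ [:: a]).
  rewrite all_cat /= ab /= andbT; move: sR; rewrite srt_cat => /and3P[_ _].
  by apply: sub_all => c /= /andP[]; nlia.
case: R rR bR {IH sR} => [|c R] /=.
  rewrite !andbT => ra _.
  by apply: (@ck_step [::] q _ _ (@ckr2 r a b _)); rewrite ra.
move=> /andP[rc _] /andP[cb _].
by apply: (@ck_step [::] (R ++ a :: q) _ _ (@ckr2 r c b _)); rewrite rc.
Qed.

(** The bumped letter goes to the row above, which comes first in the reading word. *)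
Lemma ck_nrow a R : srt R -> (a \in R) ==> (a.+1 \in R) ->
  ck (R ++ [:: a]) (oseq (nrow a R).2 ++ (nrow a R).1).
Proof.
move=> sR g; case: (nrowP sR g) => [ha|R1 R2 eR h1 h2|R1 b R2 eR h1 h2 h3] /=.
- by rewrite cats1; apply: ck_refl.
- have := sR; rewrite eR srt_cat !srt_cons => /and3P[s1 /and3P[_ h3 s2] _].
  have sa : srt (R1 ++ [:: a]).
    by rewrite srt_cat s1 /=; apply: sub_all h1 => c /=; rewrite andbT.
  apply: (@ck_trans _ (R1 ++ [:: a; a.+1; a] ++ R2)).
    have sb : srt (a.+1 :: R2) by rewrite srt_cons h3.
    have := ck_ctx (R1 ++ [:: a]) [::] (ck_pass_right (ltnSn a) sb).
    by rewrite -!catA /= !cats0.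
  apply: (@ck_trans _ (R1 ++ [:: a.+1; a; a.+1] ++ R2)); first exact: ck_step (ckr3 a).
  exact: ck_pass_left.
- have := sR; rewrite eR srt_cat srt_cons => /and3P[s1 /andP[_ s2] _].
  have sa : srt (R1 ++ [:: a]).
    by rewrite srt_cat s1 /=; apply: sub_all h1 => c /=; rewrite andbT.
  apply: (@ck_trans _ (R1 ++ b :: a :: R2)); last exact: ck_pass_left.
  have sb : srt (b :: R2) by rewrite srt_cons h3.
  have := ck_ctx R1 [::] (ck_pass_right h2 sb).
  by rewrite -!catA /= !cats0.
Qed.

Lemma ck_rins_word R u : srt R -> gins R u -> ck (R ++ u) ((rins R u).2 ++ (rins R u).1).
Proof.
elim: u R => [|a u IH] R sR /=; first by rewrite cats0 => _; apply: ck_refl.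
move=> /andP[g gu]; have := IH _ (nrow_srt sR g) gu => h.
apply: (@ck_trans _ (oseq (nrow a R).2 ++ (nrow a R).1 ++ u)).
  by rewrite -cat1s !catA; apply: ck_cat; [apply: ck_nrow|apply: ck_refl].
by rewrite -catA; apply: ck_cat => //; apply: ck_refl.
Qed.

(** * Crystal operators on a pair of factors *)

Lemma cnt_full (A : seq nat) s t : uniq A -> s <= t -> cnt A s <= (t - s) + cnt A t /\
  (cnt A s = (t - s) + cnt A t <-> forall j, s <= j < t -> j \in A).
Proof.
move=> uA; elim: t => [|t IH] st.
  by have -> : s = 0 by [nlia]; split=> //; split=> // _ j; nlia.
have [->|ne] := eqVneq s t.+1; first by rewrite subnn; split=> //; split=> // _ j; nlia.
have {IH} [|h1 h2] := IH; first by nlia.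
have e := cntS t uA; split; first by case: (t \in A) e; nlia.
split=> [e1 j sj|h].
  have [tA|tA] := boolP (t \in A); last by rewrite (negPf tA) in e; nlia.
  rewrite tA in e; have [->//|nj] := eqVneq j t; apply h2; nlia.
have e1 : cnt A s = t - s + cnt A t by apply h2 => j sj; apply: h; nlia.
by have tA : t \in A by [apply: h; nlia]; rewrite tA in e; nlia.
Qed.

Lemma srt_cnt_eq A B : srt A -> srt B -> (forall t, cnt A t = cnt B t) -> A = B.
Proof.
move=> sA sB h; apply: srt_eq => // t.
have := cntS t (srt_uniq sA); have := cntS t (srt_uniq sB); rewrite !h.
by do 2 case: (t \in _) => //; nlia.
Qed.

Lemma cnt_add A A' c t : srt A -> srt A' -> c \notin A ->
  (forall j, (j \in A') = (j == c) || (j \in A)) -> cnt A' t = (t <= c) + cnt A t.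
Proof.
move=> sA sA' cA mA; rewrite -cnt_cons; apply/permP; apply: uniq_perm.
- exact: srt_uniq.
- by rewrite /= cA srt_uniq.
- by move=> j; rewrite mA inE.
Qed.

(** The operator e on the contents [A] of w^r and [B] of w^{r+1}, expressed by counts. The letter
    [b] is the smallest unpaired letter of [B], and [c] is the bottom of the run of [B] through [b],
    written b - t in the definition of e. *)
Record estep (A B A' B' : seq nat) (b c E : nat) : Prop := EStep {
  es_eps : is_eps A B E;
  es_pos : 0 < E;
  es_max : cnt B b = E + cnt A b.+1;
  es_gt : forall s, b < s -> cnt B s < E + cnt A s.+1;
  es_cb : c <= b;
  es_run : forall j, c <= j <= b -> j \in B;
  es_bot : ~~ ((0 < c) && (c.-1 \in B));
  es_sA' : srt A';
  es_sB' : srt B';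
  es_mA : forall j, (j \in A') = (j == c) || (j \in A);
  es_mB : forall j, (j \in B') = (j != b) && (j \in B) }.

(** * Inverting row insertion *)

Lemma nrow_inj a a' R R' : srt R -> srt R' ->
  (a \in R) ==> (a.+1 \in R) -> (a' \in R') ==> (a'.+1 \in R') ->
  nrow a R = nrow a' R' -> a = a' /\ R = R'.
Proof.
move=> sR sR' g g' e; move: (erefl (nrow a R)) (erefl (nrow a' R')).
case: {2}_ / (nrowP sR g) => [h|R1 R2 eR h1 h2|R1 b R2 eR h1 h2 h3] e1;
case: {2}_ / (nrowP sR' g') => [h'|R1' R2' eR' h1' h2'|R1' b' R2' eR' h1' h2' h3'] e2;
move: e; rewrite e1 e2 //.
- by case=> /rcons_inj[-> ->].
- by case=> -> ->.
(* A letter bumped by the special rule is still in the row, one bumped by the ordinary rule is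
   not. *)
- case=> eRR eb; have : b' \in R by rewrite eR -eb mem_cat !inE eqxx !orbT.
  by rewrite eRR mem_cat inE => /or3P[/(allP h1')|/eqP|/(allP h3')] /=; nlia.
- case=> eRR eb; have : b \in R' by rewrite eR' eb mem_cat !inE eqxx !orbT.
  by rewrite -eRR mem_cat inE => /or3P[/(allP h1)|/eqP|/(allP h3)] /=; nlia.
case=> eRR eb; subst b'.
have aa : a = a'.
  have : a \in R1' ++ a' :: R2' by rewrite -eRR mem_cat inE eqxx orbT.
  have : a' \in R1 ++ a :: R2 by rewrite eRR mem_cat inE eqxx orbT.
  rewrite !mem_cat !inE => /or3P[/(allP h1)|/eqP|/(allP h3)] /= ha;
    case/or3P=> [/(allP h1')|/eqP|/(allP h3')] /=; nlia.
subst a'; split=> //; apply: srt_eq => // r.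
have := congr1 (fun s => r \in s) eRR; rewrite eR eR' !mem_cat !inE.
have [->|_] := eqVneq r b; first by rewrite !orbT.
have [->|_ //] := eqVneq r a.
have na (T1 T2 : seq nat) : all (gtn a) T1 -> all (ltn b) T2 -> (a \in T1) || (a \in T2) = false.
  by move=> k1 k2; apply/negP => /orP[/(allP k1)|/(allP k2)] /=; nlia.
by rewrite !na.
Qed.

(** An appended letter is the maximum of the row, so the later letters, being larger, are all
    appended as well. *)
Lemma row_size_or_max X Z z : srt X -> srt (rcons Z z) -> gins X (rcons Z z) ->
  size (rins X (rcons Z z)).1 = size X \/ all (fun r => r <= z) (rins X (rcons Z z)).1.
Proof.
move=> sX; elim/last_ind: Z z => [|W w IH] z sZ gZ.
  move: gZ; rewrite /= andbT => g; case: (nrowP sX g) => [h|R1 R2 eR h1 h2|R1 b R2 eR h1 h2 h3] /=.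
  - by right; rewrite all_rcons leqnn; apply: sub_all h => r /=; nlia.
  - by left.
  - by left; rewrite eR !size_cat.
rewrite -cats1 gins_cat in gZ; case/andP: gZ => gW; rewrite /= andbT => g.
move: sZ; rewrite -cats1 srt_cat => /and3P[sW _ lz].
have wz : w < z by have := allP lz w; rewrite mem_rcons inE eqxx => /(_ isT) /= /andP[].
have sr := rins_srt sX gW; rewrite rins_cat /=.
case: (IH w sW gW) => [es|al].
  case: (nrowP sr g) => [h|R1 R2 eR h1 h2|R1 b R2 eR h1 h2 h3] /=.
  - by right; rewrite all_rcons leqnn; apply: sub_all h => r /=; nlia.
  - by left.
  - by left; rewrite -es eR !size_cat.
right; rewrite nrow_appE /=; last by apply: sub_all al => r /=; nlia.
by rewrite all_rcons leqnn; apply: sub_all al => r /=; nlia.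
Qed.

(** Insertions are undone from the last one on. Whether it appended a letter is decided by the size
    of the initial row, because a bump occurs only while the row still has that size. *)
Lemma rins_inj X X' Y Y' : srt X -> srt X' -> srt Y -> srt Y' ->
  gins X Y -> gins X' Y' -> rins X Y = rins X' Y' -> size X = size X' -> X = X' /\ Y = Y'.
Proof.
move=> sX sX' + + + + + eX; elim/last_ind: Y Y' => [|Z y IH] Y'.
  case/lastP: Y' => [|Z' y'] _ sY' _ gY' e; first by case: e => ->.
  have := rins_size sX' gY'; rewrite -e /= size_rcons; nlia.
case/lastP: Y' => [|Z' y'] sY sY' gY gY' e.
  have := rins_size sX gY; rewrite e /= size_rcons; nlia.
have := row_size_or_max sX sY gY; have := row_size_or_max sX' sY' gY'.
have k Y0 y0 X0 : srt X0 -> srt (rcons Y0 y0) -> gins X0 (rcons Y0 y0) ->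
    (nrow y0 (rins X0 Y0).1).2 <> None -> size (rins X0 Y0).1 = size X0.
  case/lastP: Y0 => [//|V v] s0 sV gV nn.
  move: (gV); rewrite -cats1 gins_cat => /andP[gV' _].
  move: (sV); rewrite -cats1 srt_cat => /and3P[sV' _ lz].
  have vy : v < y0 by have := allP lz v; rewrite mem_rcons inE eqxx => /(_ isT) /= /andP[].
  case: (row_size_or_max s0 sV' gV') => // al; case: nn.
  by rewrite nrow_appE //; apply: sub_all al => r /=; nlia.
have k1 := k _ _ _ sX sY gY; have k2 := k _ _ _ sX' sY' gY'.
move: gY gY' sY sY' e; rewrite -!cats1 !gins_cat !srt_cat !rins_cat /= !cats0 !andbT.
move=> /andP[gZ gy] /andP[gZ' gy'] /andP[sZ _] /andP[sZ' _] [e1 e2] _ _.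
have sr := rins_srt sX gZ; have sr' := rins_srt sX' gZ'.
have eo : (nrow y (rins X Z).1).2 = (nrow y' (rins X' Z').1).2 /\ (rins X Z).2 = (rins X' Z').2.
  have sz a R : srt R -> (a \in R) ==> (a.+1 \in R) ->
      size (nrow a R).1 = size R + ((nrow a R).2 == None).
    move=> sR g; case: (nrowP sR g) => [h|R1 R2 eR h1 h2|R1 b R2 eR h1 h2 h3] /=.
    - by rewrite size_rcons; nlia.
    - by rewrite addn0.
    - by rewrite eR !size_cat addn0.
  have := congr1 size e1; rewrite !sz //.
  have s0 := rins_size sX gZ; have b0 := bumped_le_size X Z.
  have s0' := rins_size sX' gZ'; have b0' := bumped_le_size X' Z'.
  have grow X0 Y0 : srt X0 -> gins X0 Y0 -> size X0 <= size (rins X0 Y0).1.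
    by move=> s g; have := rins_size s g; have := bumped_le_size X0 Y0; nlia.
  have g1 := grow _ _ sX gZ; have g2 := grow _ _ sX' gZ'.
  move: e2 k1 k2; case: (nrow y _).2 => [d|]; case: (nrow y' _).2 => [d'|] /=.
  - by rewrite !cats1 => /rcons_inj[-> ->].
  - by move=> _ /(_ (fun h => ltac:(discriminate h))) k1 _ sz'; exfalso; nlia.
  - by move=> _ _ /(_ (fun h => ltac:(discriminate h))) k2 sz'; exfalso; nlia.
  - by rewrite !cats0.
case: eo => eo1 eo2.
have [-> er] : y = y' /\ (rins X Z).1 = (rins X' Z').1.
  apply: nrow_inj => //; by rewrite [LHS]surjective_pairing [RHS]surjective_pairing e1 eo1.
have [|-> -> //] := IH Z' sZ sZ' gZ gZ'.
by rewrite [LHS]surjective_pairing [RHS]surjective_pairing er eo2.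
Qed.

Section Pairs.
Variables (n : nat) (x : 'I_n).
Notation okw := (okw n).
Notation red := (red x).
Notation celt := (celt x).

Section EStep.
Variables (A B A' B' : seq nat) (b c E : nat).
Hypotheses (sA : srt A) (sB : srt B) (rAB : red (A ++ B)) (e : estep A B A' B' b c E).

Lemma estep_norun : norun A B.
Proof. exact: red_norun rAB. Qed.

Lemma estep_top : b.+1 \notin A.
Proof.
have := es_gt e (ltnSn b); have := es_max e.
have := cntS b (srt_uniq sB); have := cntS b.+1 (srt_uniq sA).
by case: (b.+1 \in A) => //; case: (b \in B); nlia.
Qed.

Lemma estep_runB : cnt B c = (b - c) + cnt B b.
Proof.
have [_ h] := cnt_full (srt_uniq sB) (es_cb e).
by apply h => j cj; apply: (es_run e); nlia.
Qed.

(** From [b] down to [c] the count of [B] rises by one at each step and that of [A] by at most one,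
    so the bound by [E] at [c] forces [A] to contain [c+1, ..., b]. *)
Lemma estep_runA : cnt A c.+1 = (b - c) + cnt A b.+1.
Proof.
have [h1 _] := cnt_full (srt_uniq sA) (es_cb e : c.+1 <= b.+1).
have := (es_eps e).1 c; have := estep_runB; have := es_max e; nlia.
Qed.

Lemma estep_run j : c < j <= b -> j \in A.
Proof.
have [_ h] := cnt_full (srt_uniq sA) (es_cb e : c.+1 <= b.+1).
by move=> cj; apply h; [rewrite estep_runA; nlia|nlia].
Qed.

(** Otherwise [c, b] would be a common run of the kind that [norun] excludes. *)
Lemma estep_new : c \notin A.
Proof.
apply/negP => cA; have := es_bot e; rewrite (@estep_norun c b) ?(es_cb e) ?estep_top //.
by move=> j cj; rewrite (es_run e) ?andbT //; have [->//|ne] := eqVneq j c; apply: estep_run; nlia.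
Qed.

Lemma estep_celt : celt (A' ++ B') = celt (A ++ B).
Proof.
have := red_ok rAB; rewrite okw_cat => /andP[oA oB].
apply: (celt_move x sA sB (es_sA' e) (es_sB' e) oA oB (es_cb e) (es_run e) (es_bot e)
  estep_run estep_new estep_top (es_mA e) (es_mB e)).
Qed.

Lemma estep_cntA t : cnt A' t = (t <= c) + cnt A t.
Proof. exact: cnt_add (es_sA' e) estep_new (es_mA e). Qed.

Lemma estep_cntB t : cnt B t = (t <= b) + cnt B' t.
Proof.
apply: cnt_add (es_sB' e) sB _ _; first by rewrite (es_mB e) eqxx.
move=> j; rewrite (es_mB e); have [->|//] := eqVneq j b.
by rewrite (es_run e) // (es_cb e) leqnn.
Qed.

Lemma estep_sizeA : size A' = (size A).+1.
Proof. by rewrite -!cnt0 estep_cntA. Qed.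

Lemma estep_sizeB : size B = (size B').+1.
Proof. by rewrite -!cnt0 estep_cntB. Qed.

Lemma estep_red : red (A' ++ B').
Proof.
have := red_ok rAB; rewrite okw_cat => /andP[/allP oA /allP oB].
apply: (red_eq rAB); last exact: estep_celt.
  rewrite okw_cat; apply/andP; split; apply/allP => j.
    by rewrite (es_mA e) => /predU1P[->|/oA//]; apply: oB; rewrite (es_run e) // leqnn (es_cb e).
  by rewrite (es_mB e) => /andP[_ /oB].
by rewrite !size_cat estep_sizeA estep_sizeB; nlia.
Qed.

Lemma estep_eps : is_eps A' B' E.-1.
Proof.
have E0 := es_pos e; split=> [t|].
  have := estep_cntB t; have := estep_cntA t.+1; have := (es_eps e).1 t.
  by have [tb|tb] := leqP t b; [nlia|have := es_gt e tb; nlia].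
exists c; have := estep_cntB c; have := estep_cntA c.+1; have := estep_runA.
have := estep_runB; have := es_max e; have := es_cb e; nlia.
Qed.

(** Combined with [row_attained]: up to terms independent of [s], the number of bumped letters above
    [t] is the maximum of [cnt u s - cnt R s.+1] over [s <= t]. *)
Lemma bumped_cnt_max R u t s : srt R -> srt u -> gins R u -> s <= t ->
  cnt u s + size (rins R u).2 + cnt R t.+1 <= size u + cnt (rins R u).2 t.+1 + cnt R s.+1.
Proof.
move=> sR su g st; have := cnt_bumped_ge s sR g.
have [h _] := cnt_diff_gap (srt_uniq sR) (srt_uniq (bumped_srt sR su g))
  (bumped_sub sR su g) (st : s.+1 <= t.+1).
nlia.
Qed.

(** The bumped words are compared through the maximum formula for their counts. They then cancel in
    the group, and an increasing row is determined by its element. *)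
Lemma estep_rins : rins A' B' = rins A B.
Proof.
have sA' := es_sA' e; have sB' := es_sB' e.
have [gB rB eB] := rins_celt (p := [::]) sA rAB.
have [gB' rB' eB'] := rins_celt (p := [::]) sA' estep_red.
have epsA := is_eps_uniq (is_eps_rins sA sB gB) (es_eps e).
have epsA' := is_eps_uniq (is_eps_rins sA' sB' gB') estep_eps.
have b1 := bumped_le_size A B; have b2 := bumped_le_size A' B'.
have szB := estep_sizeB; have E0 := es_pos e.
have cb := es_cb e; have mc : cnt B c = E + cnt A c.+1.
  by rewrite estep_runB (es_max e) estep_runA; nlia.
have e2 : (rins A' B').2 = (rins A B).2.
  apply: srt_cnt_eq => [||t]; try exact: bumped_srt.
  case: t => [|t]; first by rewrite !cnt0; nlia.
  have hA := estep_cntA t.+1.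
  apply/eqP; rewrite eqn_leq; apply/andP; split.
    have [s st es] := row_attained t sA' sB' gB'.
    have hB := estep_cntB s; have hs := estep_cntA s.+1.
    have [tc|tc] := ltnP t c.
      have := bumped_cnt_max sA sB gB st; nlia.
    have := bumped_cnt_max sA sB gB tc.
    have := (es_eps e).1 s; have gs : b < s -> cnt B s < E + cnt A s.+1 by apply: (es_gt e).
    case: (leqP s b) gs => [sb _|sb /(_ isT)]; nlia.
  have [s st es] := row_attained t sA sB gB.
  have [tc|tc] := ltnP t c.
    have := bumped_cnt_max sA' sB' gB' st.
    have hB := estep_cntB s; have hs := estep_cntA s.+1; nlia.
  have := bumped_cnt_max sA' sB' gB' tc.
  have hB := estep_cntB c; have hs := estep_cntA c.+1; have := (es_eps e).1 s.
  nlia.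
rewrite [LHS]surjective_pairing [RHS]surjective_pairing e2; congr (_, _).
have := red_ok rB; have := red_ok rB'; rewrite /= !okw_cat => /andP[_ o1] /andP[_ o2].
have [s1 s2] := (rins_srt sA' gB', rins_srt sA gB).
apply: srt_eq => //; apply: (celt_content (x := x)) => //; try exact: srt_uniq.
have := estep_celt; rewrite -eB -eB' e2 !celt_cat.
by move/(@mulIg _ _ _ _).
Qed.

(** Both words are equivalent to one and the same inserted word, so no explicit chain of moves is
    required. *)
Lemma estep_ck : ck (A ++ B) (A' ++ B').
Proof.
have [gB _ _] := rins_celt (p := [::]) sA rAB.
have [gB' _ _] := rins_celt (p := [::]) (es_sA' e) estep_red.
apply: ck_trans (ck_rins_word sA gB) _; rewrite -estep_rins.
exact: ck_sym (ck_rins_word (es_sA' e) gB').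
Qed.

End EStep.

Lemma estep_ex A B E : srt A -> srt B -> red (A ++ B) -> is_eps A B E -> 0 < E ->
  exists A' B' b c, estep A B A' B' b c E.
Proof.
move=> sA sB rAB hE E0; have [b [eb hb]] := largest_maximizer hE E0.
have bB : b \in B.
  have := hb _ (ltnSn b); have := cntS b (srt_uniq sB); have := cntS b.+1 (srt_uniq sA).
  by case: (b \in B) => //; case: (_ \in A); nlia.
have ex : exists c, (c <= b) && all (mem B) (iota c (b.+1 - c)).
  by exists b; rewrite leqnn subSnn /= bB.
case: (ex_minnP ex) => c /andP[cb /allP run] cmin.
exists (sort leq (undup (c :: A))), [seq j <- B | j != b], b, c; split=> //.
- by move=> j cj; apply: run; rewrite mem_iota; nlia.
- apply/negP => /andP[c0 cB]; have := cmin c.-1; rewrite (leq_trans (leq_pred _) cb) /=.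
  rewrite leqNgt prednK // leqnn /= => H; suff: false by [].
  apply: H; apply/allP => j; rewrite mem_iota /= => hj.
  by have [->//|ne] := eqVneq j c.-1; apply: run; rewrite mem_iota; nlia.
- by rewrite ltn_sorted_uniq_leq sort_uniq undup_uniq sort_sorted //; apply: leq_total.
- by apply: sorted_filter => //; apply: ltn_trans.
- by move=> j; rewrite mem_sort mem_undup inE.
- by move=> j; rewrite mem_filter.
Qed.

(* The inverse of [estep]: a is the smallest maximizer and d ends the run of A above it. *)
Lemma fstep A B A' B' a d E : srt A -> srt B -> red (A ++ B) -> is_eps A B E ->
  cnt B a = E + cnt A a.+1 -> (forall s, s < a -> cnt B s < E + cnt A s.+1) ->
  a <= d -> (forall j, a <= j <= d -> j \in A) -> d.+1 \notin A ->
  srt A' -> srt B' -> (forall j, (j \in A') = (j != a) && (j \in A)) ->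
  (forall j, (j \in B') = (j == d) || (j \in B)) ->
  [/\ estep A' B' A B d a E.+1, celt (A' ++ B') = celt (A ++ B) & red (A' ++ B')].
Proof.
move=> sA sB rAB hE ea ha ad run dA sA' sB' mA mB.
have aA : a \in A by apply: run; rewrite leqnn ad.
have hrun : cnt A a.+1 = (d - a) + cnt A d.+1.
  have [_ h] := cnt_full (srt_uniq sA) (ad : a.+1 <= d.+1).
  by apply h => j hj; apply: run; nlia.
have [hB1 hB2] := cnt_full (srt_uniq sB) ad.
have hB : cnt B a = (d - a) + cnt B d by have := hE.1 d; nlia.
have runB j : a <= j < d -> j \in B by apply hB2.
have bot : ~~ ((0 < a) && (a.-1 \in B)).
  apply/negP => /andP[a0 aB]; have := ha a.-1; rewrite prednK // leqnn => /(_ isT).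
  have := cntS a.-1 (srt_uniq sB); have := cntS a (srt_uniq sA); rewrite prednK //.
  by rewrite aB aA; nlia.
have dB : d \notin B.
  apply/negP => dB; have := red_norun sA sB rAB ad; rewrite (negPf bot) => H.
  suff : false by []; apply: H => // j hj; rewrite run //=.
  by have [->//|ne] := eqVneq j d; apply: runB; nlia.
have cA t : cnt A t = (t <= a) + cnt A' t.
  apply: cnt_add => //; first by rewrite mA eqxx.
  by move=> j; rewrite mA; have [->|] := eqVneq j a.
have cB t : cnt B' t = (t <= d) + cnt B t by apply: cnt_add.
have hE' : is_eps A' B' E.+1.
  split=> [t|]; last by exists d; rewrite cB; have := cA d.+1; nlia.
  rewrite cB; have := cA t.+1; have := hE.1 t.
  by have [ta|ta] := ltnP t a; [have := ha _ ta; nlia|case: (leqP t d); nlia].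
have es : estep A' B' A B d a E.+1.
  split=> //.
  - by rewrite cB; have := cA d.+1; nlia.
  - by move=> s ds; rewrite cB; have := cA s.+1; have := hE.1 s; nlia.
  - by move=> j hj; rewrite mB; have [//|ne] := eqVneq j d; rewrite runB //; nlia.
  - by rewrite mB; case: (posnP a) => // a0; rewrite a0 /= in bot *; rewrite (negPf bot) orbF; nlia.
  - by move=> j; rewrite mA; have [->|] := eqVneq j a.
  - by move=> j; rewrite mB; have [->|] := eqVneq j d; rewrite ?(negPf dB).
have := red_ok rAB; rewrite okw_cat => /andP[/allP oA /allP oB].
have [oA' oB'] : okw A' /\ okw B'.
  split; apply/allP => j; first by rewrite mA => /andP[_ /oA].
  by rewrite mB => /predU1P[->|/oB//]; apply: oA; apply: run; rewrite ad leqnn.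
have ec : celt (A' ++ B') = celt (A ++ B).
  apply: esym; apply: (@celt_move n x A' B' A B d a) => //.
  - exact: (es_run es).
  - exact: (es_bot es).
  - by move=> j hj; rewrite mA run ?andbT; nlia.
  - by rewrite mA eqxx.
  - by rewrite mA (negPf dA) andbF.
  - exact: (es_mA es).
  - exact: (es_mB es).
split=> //; apply: (red_eq rAB); rewrite ?okw_cat ?oA' //.
by rewrite !size_cat -!cnt0; have := cA 0; have := cB 0; nlia.
Qed.

Lemma rins_nil A : srt A -> rins [::] A = (A, [::]).
Proof.
elim/last_ind: A => // A a IH; rewrite -cats1 srt_cat => /and3P[sA _ h].
rewrite rins_cat IH //= nrow_appE /= ?cats1 //.
by apply: sub_all h => r /= /andP[].
Qed.

(** Inserted into the empty row, an increasing word becomes the row itself, and the row is invariant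
    under the moves. *)
Lemma ck_srt_eq u v : red u -> srt u -> srt v -> ck u v -> u = v.
Proof.
move=> ru su sv h; have [] := ck_rins (R := [::]) isT ru h.
by rewrite !rins_nil.
Qed.

(** The old and new bumped pairs are Coxeter-Knuth equivalent and insert to the same rows. By
    [rins_inj] such a pair is determined by the size of its first member, and [eps_formula] supplies
    this size. *)
Lemma estep_local R A B A' B' b c E p :
  srt R -> srt A -> srt B -> red (R ++ A ++ B) -> estep A B A' B' b c E ->
  let r1 := rins R A in let r2 := rins r1.1 B in
  let r1' := rins R A' in let r2' := rins r1'.1 B' in
  is_eps r1.2 r2.2 p ->
  [/\ r2'.1 = r2.1, red (R ++ A' ++ B')
    & if size A - size r1.2 < p then exists b' c', estep r1.2 r2.2 r1'.2 r2'.2 b' c' p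
      else r1'.2 = r1.2 /\ r2'.2 = r2.2].
Proof.
move=> sR sA sB rRAB es r1 r2 r1' r2' hp.
have rAB : red (A ++ B) := red_infixl rRAB.
have cAB := estep_ck sA sB rAB es.
have rRAB' : red (R ++ A' ++ B').
  by have := ck_red (p := R) (q := [::]) cAB; rewrite !cats0; apply.
have [sA' sB'] := (es_sA' es, es_sB' es).
have [] := ck_rins sR rRAB cAB; rewrite !rins_cat -/r1 -/r2 -/r1' -/r2' /= => e1 cb.
have [gAB rb _] := rins_celt (p := [::]) sR rRAB.
have [gAB' rb' _] := rins_celt (p := [::]) sR rRAB'.
move: gAB gAB' rb rb'; rewrite !gins_cat !rins_cat -/r1 -/r1' /= -/r2 -/r2'.
move=> /andP[gA gB] /andP[gA' gB'] /red_infixr rb /red_infixr rb'.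
have [s1 s1'] := (rins_srt sR gA, rins_srt sR gA').
have [sAh sAh'] := (bumped_srt sR sA gA, bumped_srt sR sA' gA').
have [sBh sBh'] := (bumped_srt s1 sB gB, bumped_srt s1' sB' gB').
have [gh rh _] := rins_celt (p := [::]) sAh rb.
have [gh' _ _] := rins_celt (p := [::]) sAh' rb'.
have [] := ck_rins (R := [::]) isT rb cb; rewrite !rins_cat /=.
rewrite (rins_nil sAh) (rins_nil sAh') /= => eU cV.
(* Both sides are increasing and Coxeter-Knuth equivalent. *)
have eV : (rins r1.2 r2.2).2 = (rins r1'.2 r2'.2).2.
  apply: ck_srt_eq => //; try exact: bumped_srt.
  by move: rh => /= /red_infixr.
have nr := red_norun sA sB rAB.
have rAB' := estep_red sA sB rAB es; have nr' := red_norun sA' sB' rAB'.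
have hp2 := is_eps_rins sAh sBh gh.
have ep := is_eps_uniq hp hp2.
have f1 := eps_formula sR sA sB gA gB nr (es_eps es) hp2.
(* The two formulas, with values [E] and [E.-1], determine the size of the new first bumped row. *)
have f2 := eps_formula sR sA' sB' gA' gB' nr' (estep_eps sA sB rAB es)
  (is_eps_rins sAh' sBh' gh').
have szc := ck_size cb; rewrite !size_cat in szc.
have szA := estep_sizeA sA sB rAB es; have szB := estep_sizeB sB es.
have E0 := es_pos es.
have [q1 q2] := (bumped_le_size R A, bumped_le_size r1.1 B).
have [q1' q2'] := (bumped_le_size R A', bumped_le_size r1'.1 B').
have [q3 q3'] := (bumped_le_size r1.2 r2.2, bumped_le_size r1'.2 r2'.2).
rewrite -/r1 -/r1' -/r2 -/r2' in ep f1 f2 q1 q2 q1' q2'.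
rewrite -eV in f2 q3'.
have eR : rins r1.2 r2.2 = rins r1'.2 r2'.2.
  by rewrite [LHS]surjective_pairing [RHS]surjective_pairing eU eV.
split=> //; case: ltnP => lt.
  have p0 : 0 < p by apply: leq_ltn_trans lt.
  (* The candidate for the new bumped pair is e of the old one: it inserts to the same rows and has
     the right sizes. *)
  have [X [Y [b' [c' es']]]] := estep_ex sAh sBh rb hp p0.
  have rX := estep_rins sAh sBh rb es'.
  have rXY := estep_red sAh sBh rb es'.
  have [gX _ _] := rins_celt (p := [::]) (es_sA' es') rXY.
  have sX := estep_sizeA sAh sBh rb es'.
  have [] := @rins_inj X r1'.2 Y r2'.2 (es_sA' es') sAh' (es_sB' es') sBh' gX gh'.
  - by rewrite rX.
  - by rewrite sX -/r1; nlia.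
  by move=> <- <-; exists b', c'.
by have [] := @rins_inj r1'.2 r1.2 r2'.2 r2.2 sAh' sAh sBh' sBh gh' gh (esym eR); first nlia.
Qed.

End Pairs.

(** * Crystal operators on tableaux *)

Section Tableaux.

Implicit Types (t T : seq (seq nat)) (row : seq nat) (c d : nat * nat)
  (cs us vs : seq (nat * nat)).

Lemma tab_pairing_cat i t cs1 cs2 us vs : tab_pairing i t (cs1 ++ cs2) us vs =
  let r := tab_pairing i t cs1 us vs in tab_pairing i t cs2 r.1 r.2.
Proof.
elim: cs1 us vs => //= c cs1 IH us vs.
by case: ifP => // _; case: ifP => // _; case: us => [|u us].
Qed.

(* Letters i left over from an earlier scan pair with the i+1's that were unpaired,
   first scanned first. *)
Lemma tab_pairing_stack i t cs us vs : tab_pairing i t cs us vs =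
  let r := tab_pairing i t cs [::] [::] in
  (r.1 ++ drop (size r.2) us, take (size r.2 - size us) r.2 ++ vs).
Proof.
elim: cs us vs => [|c cs IH] us vs /=; first by rewrite drop0.
case: ifP => _.
  rewrite IH [in RHS]IH /=; case: (tab_pairing i t cs [::] [::]) => /= u v.
  rewrite size_cat /= addn0 size_take cats0.
  case: v => [|w v] /=; first by rewrite -!catA /= !drop0.
  rewrite subSS subn1 ltnSn /= cats0; congr (_, _ ++ _).
  by rewrite take_takel //; lia.
case: ifP => _; last by rewrite IH.
case: us => [|w us]; rewrite IH [in RHS]IH /=;
  case: (tab_pairing i t cs [::] [::]) => /= u v.
  by rewrite !cats0 !subn0 !take_size -catA.
rewrite !cats0 subn0 take_size size_cat addn1 /= subSS; congr (_, _ ++ _).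
rewrite take_cat; case: ltnP => // h.
by rewrite (_ : _ - size us - _ = 0) ?take0 ?cats0 ?take_oversize //; lia.
Qed.

Lemma tab_pairing_eq i t t' cs us vs :
  {in cs, forall c, tab_entry t c = tab_entry t' c} ->
  tab_pairing i t cs us vs = tab_pairing i t' cs us vs.
Proof.
elim: cs us vs => //= c cs IH us vs h; rewrite h ?inE ?eqxx //.
have IH' us' vs' : tab_pairing i t cs us' vs' = tab_pairing i t' cs us' vs'.
  by apply: IH => d dc; apply: h; rewrite inE dc orbT.
by rewrite !IH'; case: us => [|u us] //; rewrite !IH'.
Qed.

Lemma tab_pairing_count i t cs us vs :
  let r := tab_pairing i t cs us vs in
  size r.1 + size vs + count (fun c => tab_entry t c == i.+1) cs =
  size r.2 + size us + count (fun c => tab_entry t c == i) cs.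
Proof.
elim: cs us vs => [|c cs IH] us vs /=; first by lia.
case: eqP => [->|_]; first by rewrite (_ : (i == i.+1) = false); [have := IH (c :: us) vs; rewrite /=; lia|lia].
case: eqP => _; last by have := IH us vs; rewrite /=; lia.
by case: us => [|u us]; [have := IH [::] (c :: vs)|have := IH us vs]; rewrite /=; lia.
Qed.

Lemma tab_pairing_last i t cs us vs c : tab_pairing i t cs [::] [::] = (us, c :: vs) ->
  exists s1 s2, [/\ cs = s1 ++ c :: s2, tab_pairing i t s1 [::] [::] = ([::], vs),
    tab_pairing i t s2 [::] [::] = (us, [::]) & tab_entry t c = i.+1].
Proof.
elim/last_ind: cs us vs => [|cs d IH] us vs; first by [].
rewrite -cats1 tab_pairing_cat /=; case e : (tab_pairing i t cs [::] [::]) => [u v] /=.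
have ext s2 u' : tab_pairing i t s2 [::] [::] = (u', [::]) ->
    tab_pairing i t (s2 ++ [:: d]) [::] [::] = tab_pairing i t [:: d] u' [::].
  by rewrite tab_pairing_cat => ->.
case: ifP => [di|di].
  case=> <- ev; rewrite ev in e; have [s1 [s2 [-> h1 h2 h3]]] := IH _ _ e.
  by exists s1, (s2 ++ [:: d]); rewrite -catA; split=> //; rewrite (ext _ _ h2) /= di.
case: ifP => [di1|di1].
  case: u e => [|w u] e [<- ev].
    by case: ev => <- <-; exists cs, [::]; split=> //; apply/eqP.
  rewrite ev in e; have [s1 [s2 [-> h1 h2 h3]]] := IH _ _ e.
  by exists s1, (s2 ++ [:: d]); rewrite -catA; split=> //; rewrite (ext _ _ h2) /= di di1.
case=> <- ev; rewrite ev in e; have [s1 [s2 [-> h1 h2 h3]]] := IH _ _ e.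
by exists s1, (s2 ++ [:: d]); rewrite -catA; split=> //; rewrite (ext _ _ h2) /= di di1.
Qed.

Lemma mem_tab_cells t c : (c \in tab_cells t) = (c.1 < size t) && (c.2 < size (nth [::] t c.1)).
Proof.
case: c => r j /=; apply/allpairsPdep/andP => [[r' [j' [h1 h2 [-> ->]]]]|[h1 h2]].
  by move: h1 h2; rewrite !mem_iota.
by exists r, j; rewrite !mem_iota.
Qed.

Lemma tab_scan_uniq t : uniq (tab_scan t).
Proof.
apply: filter_uniq; apply: allpairs_uniq; rewrite ?rev_uniq ?iota_uniq //.
by move=> [j r] [j' r'] _ _ [-> ->].
Qed.

Lemma mem_tab_scan t c : c \in tab_scan t -> c \in tab_cells t.
Proof. by rewrite mem_filter => /andP[]. Qed.

Lemma size_set_nth_in (T' : Type) (x0 : T') s j y : j < size s -> size (set_nth x0 s j y) = size s.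
Proof. by move=> h; rewrite size_set_nth; apply/maxn_idPr. Qed.

Lemma tab_set_shape t c k : c \in tab_cells t -> tab_shape (tab_set t c k) = tab_shape t.
Proof.
rewrite mem_tab_cells => /andP[h1 h2]; apply: (@eq_from_nth _ 0).
  by rewrite !size_map size_set_nth_in.
move=> r; rewrite size_map size_set_nth_in // => rt.
rewrite !(nth_map [::]) ?size_set_nth_in // nth_set_nth /=.
by case: eqP => [->|//]; rewrite size_set_nth_in.
Qed.

Lemma tab_set_entry t c k d : c \in tab_cells t ->
  tab_entry (tab_set t c k) d = if d == c then k else tab_entry t d.
Proof.
case: c d => [r j] [r' j']; rewrite mem_tab_cells /= => /andP[h1 h2].
rewrite /tab_entry /= nth_set_nth /= xpair_eqE.
by case: eqP => [->|] //=; rewrite nth_set_nth /=.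
Qed.

Lemma tab_cells_shape t t' : tab_shape t = tab_shape t' -> tab_cells t =i tab_cells t'.
Proof.
move=> e c; rewrite !mem_tab_cells.
have es : size t = size t' by rewrite -(size_map size t) -(size_map size t') -!/(tab_shape _) e.
rewrite es; case: ltnP => //= h.
by rewrite -!(nth_map [::] 0 size) ?es // -!/(tab_shape _) e.
Qed.

Lemma tab_scan_shape t t' : tab_shape t = tab_shape t' -> tab_scan t = tab_scan t'.
Proof.
move=> e; rewrite /tab_scan.
have es : size t = size t' by rewrite -(size_map size t) -(size_map size t') -!/(tab_shape _) e.
have eh : size (head [::] t) = size (head [::] t').
  by case: t t' e {es} => [|a t] [|b t'] //= [].
by rewrite es eh; apply: eq_filter => c; apply: tab_cells_shape.
Qed.

Lemma tab_set_back t c k k' : c \in tab_cells t -> tab_entry t c = k' ->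
  tab_set (tab_set t c k) c k' = t.
Proof.
case: c => r j; rewrite mem_tab_cells /tab_entry /= => /andP[h1 h2] ek.
apply: (@eq_from_nth _ [::]); first by rewrite !size_set_nth_in // size_set_nth_in.
move=> r' _; rewrite !nth_set_nth /= !eqxx; case: eqP => [->|/eqP rr]; last first.
  by rewrite nth_set_nth /= (negPf rr).
apply: (@eq_from_nth _ 0); first by rewrite !size_set_nth_in // size_set_nth_in.
move=> j' _; rewrite !nth_set_nth /=; case: eqP => [->//|/eqP jj].
by rewrite nth_set_nth /= (negPf jj).
Qed.

(** Changing the last unpaired [i+1] into [i] leaves the pairing before and after it as it was, and
    makes this cell the first unpaired [i], which is the one f changes. *)
Lemma tab_e_inv i t t' : tab_e i t = Some t' ->
  [/\ tab_f i t' = Some t, tab_shape t' = tab_shape t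
    & size (tab_unpaired i t).2 = (size (tab_unpaired i t').2).+1].
Proof.
rewrite /tab_e; case e : (tab_unpaired i t) => [us [|c vs]] //= [<-].
have [s1 [s2 [es h1 h2 h3]]] := tab_pairing_last e.
have cc : c \in tab_cells t by apply: mem_tab_scan; rewrite es mem_cat inE eqxx orbT.
have sh := tab_set_shape i cc.
have := tab_scan_uniq t; rewrite es cat_uniq /= negb_or => /and3P[_ /andP[cs1 _] /andP[cs2 _]].
have ent d : d != c -> tab_entry t d = tab_entry (tab_set t c i) d.
  by move=> dc; rewrite tab_set_entry // (negPf dc).
have ue : tab_unpaired i (tab_set t c i) = (us ++ [:: c], vs).
  rewrite /tab_unpaired (tab_scan_shape sh) es tab_pairing_cat.
  rewrite -(@tab_pairing_eq i t); last first.
    by move=> d ds; apply: ent; apply: contraNneq cs1 => <-.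
  rewrite h1 /= tab_set_entry // eqxx eqxx tab_pairing_stack.
  rewrite -(@tab_pairing_eq i t) ?h2 //.
  by move=> d ds; apply: ent; apply: contraNneq cs2 => <-.
split=> //; last by rewrite ue.
by rewrite /tab_f ue /= rev_cat /= tab_set_back.
Qed.

(** * Removing the bottom row *)

Definition colok row T := (size (head [::] T) <= size row) &&
  all (fun j => nth 0 row j < nth 0 (head [::] T) j) (iota 0 (size (head [::] T))).

(** Semistandardness without a bound on the entries, in a recursive form that allows the bottom row
    to be removed. *)
Fixpoint tabl t := if t is row :: T then
  [&& sorted leq row, row != [::], colok row T & tabl T] else true.

Lemma colokP row T j : colok row T -> j < size (head [::] T) ->
  j < size row /\ nth 0 row j < nth 0 (head [::] T) j.
Proof.
case/andP=> h1 h2 hj; split; first exact: leq_trans hj h1.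
by apply: (allP h2); rewrite mem_iota.
Qed.

Lemma tabl_col row T r j : tabl (row :: T) -> (r, j) \in tab_cells T ->
  j < size row /\ nth 0 row j + r < tab_entry T (r, j).
Proof.
elim: T row r => [|row' T IH] row r; first by rewrite mem_tab_cells.
move=> /= /and4P[_ _ ck /and4P[s' n' ck' tT]]; rewrite mem_tab_cells /= => /andP[h1 h2].
case: r h1 h2 => [|r] h1 h2; first by rewrite addn0; apply: (colokP ck).
have [||h3 h4] := IH row' r; first by rewrite /= s' n' ck'.
  by rewrite mem_tab_cells /= h2 andbT.
have [h5 h6] := colokP ck h3; split=> //; rewrite /tab_entry /= in h4 h6 *; lia.
Qed.

Lemma sorted_nth row j k : sorted leq row -> j <= k -> k < size row -> nth 0 row j <= nth 0 row k.
Proof.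
move=> s jk kr; have := sorted_leq_nth leq_trans leqnn 0 s.
by apply; rewrite ?inE //; lia.
Qed.

Definition rowcells row : seq (nat * nat) := [seq (0, j) | j <- rev (iota 0 (size row))].
Definition cshift c : nat * nat := (c.1.+1, c.2).

(** The order in which [tab_scan] visits the cells. *)
Definition clt : rel (nat * nat) := fun c d => (d.2 < c.2) || ((c.2 == d.2) && (c.1 < d.1)).

Lemma clt_irr : irreflexive clt.
Proof. by move=> c; rewrite /clt ltnn eqxx ltnn. Qed.

Lemma clt_trans : transitive clt.
Proof. by move=> [a b] [c d] [e f]; rewrite /clt /=; lia. Qed.

Lemma tab_scan_sorted t : sorted clt (tab_scan t).
Proof.
apply: (sorted_filter clt_trans); rewrite (sorted_pairwise clt_trans).
have : pairwise (fun j k => k < j) (rev (iota 0 (size (head [::] t)))).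
  have h : transitive (fun j k : nat => k < j) by move=> a b c /=; lia.
  by rewrite -(sorted_pairwise h) rev_sorted; apply: iota_ltn_sorted.
elim: (rev _) => //= j js IH /andP[/allP hj hjs].
rewrite pairwise_cat IH // andbT; apply/andP; split.
  apply/allrelP => c d /mapP[r _ ->] /allpairsPdep[k [r' [kj _ ->]]].
  by rewrite /clt /= (hj _ kj).
rewrite pairwise_map; have := iota_ltn_sorted 0 (size t).
rewrite (sorted_pairwise ltn_trans); apply: sub_pairwise => a b /= ab.
by rewrite /clt /= eqxx ltnn.
Qed.

Lemma rowcells_sorted row : sorted clt (rowcells row).
Proof.
rewrite /rowcells sorted_map.
rewrite (@eq_sorted _ _ (fun j k => k < j)) => [|j k]; last by rewrite /= /clt /= andbF orbF.
by rewrite rev_sorted; apply: iota_ltn_sorted.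
Qed.

Lemma filter_suffix (T0 : eqType) (P : pred T0) (r : rel T0) s : transitive r -> sorted r s ->
  (forall c d : T0, c \in s -> d \in s -> r c d -> P c -> P d) ->
  s = filter (predC P) s ++ filter P s.
Proof.
move=> tr; elim: s => //= c s IH sc h.
have cs : all (r c) s by apply: order_path_min sc.
have ss : sorted r s by apply: path_sorted sc.
have [Pc|Pc] := boolP (P c); rewrite /=; last first.
  congr cons; apply: IH => // d e ds es; apply: h; by rewrite inE ?ds ?es orbT.
have Ps : all P s.
  by apply/allP => d ds; apply: (h c d) => //; rewrite ?inE ?eqxx ?ds ?orbT //; apply: (allP cs).
rewrite (all_filterP Ps) (_ : filter _ s = [::]) //.
by apply/eqP; rewrite -(negbK (_ == _)) -has_filter -all_predC; apply: sub_all Ps => d /= ->.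
Qed.

Section RemoveRow.
Variables (i : nat) (row : seq nat) (T : seq (seq nat)).
Hypothesis tt : tabl (row :: T).

(** The cells of the vertical dominoes that consist of an [i] in the bottom row and an [i+1] on top
    of it. *)
Definition vdom c := [&& c.1 <= 1, c.2 < size (head [::] T), nth 0 row c.2 == i
                       & nth 0 (head [::] T) c.2 == i.+1].

Definition rlv c := (tab_entry (row :: T) c == i) || (tab_entry (row :: T) c == i.+1).

Lemma tab_pairing_rlv cs us vs :
  tab_pairing i (row :: T) cs us vs = tab_pairing i (row :: T) (filter rlv cs) us vs.
Proof.
elim: cs us vs => //= c cs IH us vs; rewrite /rlv; case: eqP => /= [e|_].
  by rewrite e eqxx IH.
case: eqP => /= e; last exact: IH.
rewrite e eqxx (_ : (i.+1 == i) = false); last by lia.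
by case: us => [|u us]; rewrite IH.
Qed.


(** In the scan of a column the two cells of a domino are consecutive, and they pair with each
    other. *)
Lemma vdom_cancel j us vs : let col := [seq (r, j) | r <- iota 0 (size T).+1] in
  let f := filter (fun c => c \in tab_cells (row :: T)) in
  tab_pairing i (row :: T) (f col) us vs =
  tab_pairing i (row :: T) (filter (predC vdom) (f col)) us vs.
Proof.
move=> col f; have [d|nd] := boolP (vdom (0, j)); last first.
  rewrite (_ : filter (predC vdom) (f col) = f col) //; apply/all_filterP/allP => c.
  rewrite mem_filter => /andP[_ /mapP[r _ ->]] /=; apply: contra nd.
  by rewrite /vdom /= => /and4P[_ -> -> ->].
move: (d) => /and4P[_ /= jT /eqP e0 /eqP e1].
have [jr _] := colokP (let: conj _ h := andP (andP (andP tt).2).2 in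
  (andP ((andP (andP tt).2).2)).1 : colok row T) jT.
move: jT e1 @col @f; case eT : T => [//|row' T'] /= jT e1.
rewrite !mem_tab_cells /= jr jT /= /tab_entry /= e0 eqxx.
rewrite e1 eqxx (_ : (i.+1 == i) = false); last by lia.
have d' : vdom (1, j) by move: d; rewrite /vdom.
rewrite -eT d d' /=; congr tab_pairing.
apply/esym/all_filterP/allP => c; rewrite mem_filter => /andP[_ /mapP[r]].
by rewrite mem_iota => hr -> /=; rewrite /vdom /=; lia.
Qed.

Lemma tab_pairing_scan us vs : tab_pairing i (row :: T) (tab_scan (row :: T)) us vs =
  tab_pairing i (row :: T) (filter (predC vdom) (tab_scan (row :: T))) us vs.
Proof.
rewrite /tab_scan !filter_flatten -!map_comp.
elim: (rev _) us vs => //= j js IH us vs; rewrite !tab_pairing_cat.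
by rewrite vdom_cancel /= -IH.
Qed.

Lemma tab_pairing_push D us vs : all (fun c => tab_entry (row :: T) c == i) D ->
  tab_pairing i (row :: T) D us vs = (rev D ++ us, vs).
Proof.
elim: D us => //= c D IH us /andP[/eqP-> h]; rewrite eqxx IH //.
by rewrite rev_cons cat_rcons.
Qed.

Lemma tab_pairing_pop D us vs : all (fun c => tab_entry (row :: T) c == i.+1) D ->
  size D <= size us ->
  tab_pairing i (row :: T) D us vs = (drop (size D) us, vs).
Proof.
elim: D us => [|c D IH] [|u us] //=; rewrite ?drop0 // => /andP[/eqP-> h] sz.
by rewrite eqxx (_ : (i.+1 == i) = false) ?IH //; lia.
Qed.

(** In the scan by rows the domino cells form two adjacent blocks of equal size, which cancel. *)
Lemma tab_pairing_vdom X D' D Y us vs : size D' = size D ->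
  all (fun c => tab_entry (row :: T) c == i) D' ->
  all (fun c => tab_entry (row :: T) c == i.+1) D ->
  tab_pairing i (row :: T) (X ++ D' ++ D ++ Y) us vs =
  tab_pairing i (row :: T) (X ++ Y) us vs.
Proof.
move=> sD h1 h2; rewrite [LHS]tab_pairing_cat [RHS]tab_pairing_cat.
case: (tab_pairing i (row :: T) X us vs) => u v; cbv zeta.
rewrite tab_pairing_cat tab_pairing_push //; cbv zeta.
rewrite tab_pairing_cat tab_pairing_pop //; last by rewrite size_cat size_rev sD leq_addr.
by rewrite [fst _]/= -sD -(size_rev D') drop_size_cat.
Qed.

Definition rcs := rowcells row.
Definition tcs := map cshift (tab_scan T).

Lemma mem_rcs c : (c \in rcs) = (c.1 == 0) && (c.2 < size row).
Proof.
apply/mapP/andP => [[j]|[/eqP h1 h2]].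
  by rewrite mem_rev mem_iota => hj ->.
by exists c.2; rewrite ?mem_rev ?mem_iota // -h1; case: c {h1 h2}.
Qed.

Lemma tabl_parts : [/\ sorted leq row, colok row T & tabl T].
Proof. by move: tt => /= /and4P[]. Qed.

Lemma mem_tab_scanE t : tabl t -> tab_scan t =i tab_cells t.
Proof.
move=> tbl [r j]; rewrite mem_filter andb_idr // mem_tab_cells /= => /andP[h1 h2].
apply/allpairsP; exists (j, r); rewrite mem_rev !mem_iota /= h1; split=> //.
case: t tbl h1 h2 => [//|row0 T0] tbl h1 h2.
case: r h1 h2 => [|r] //= h1 h2.
by have [] := @tabl_col row0 T0 r j tbl _; rewrite ?mem_tab_cells /= ?h2 ?andbT.
Qed.

Lemma mem_tcs c : (c \in tcs) = (0 < c.1) && ((c.1.-1, c.2) \in tab_cells T).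
Proof.
have [_ _ tT] := tabl_parts.
apply/mapP/andP => [[d + ->]|[h1 h2]].
  by rewrite mem_tab_scanE //; case: d.
exists (c.1.-1, c.2); first by rewrite mem_tab_scanE.
by rewrite /cshift /= prednK //; case: c {h1 h2}.
Qed.

Lemma tcs_sorted : sorted clt tcs.
Proof.
by rewrite sorted_map (@eq_sorted _ _ clt) ?tab_scan_sorted.
Qed.

(* In the row-by-row scan the i's of the bottom row that lie below an i+1 are
   scanned last, and these i+1's first among the upper rows, so that they pair
   with each other; the other letters are scanned in the same order as in the
   column scan. *)
Lemma tab_unpaired_cons :
  tab_unpaired i (row :: T) = tab_pairing i (row :: T) (rcs ++ tcs) [::] [::].
Proof.
have [sr ck tT] := tabl_parts.
have ent c : c \in tcs -> tab_entry (row :: T) c = tab_entry T (c.1.-1, c.2).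
  by rewrite mem_tcs => /andP[h _]; case: c h => [[|r] j].
have ent0 c : c \in rcs -> tab_entry (row :: T) c = nth 0 row c.2.
  by rewrite mem_rcs => /andP[/eqP h _]; rewrite /tab_entry h.
have colT c : c \in tcs -> c.2 < size row /\ nth 0 row c.2 + c.1 <= tab_entry (row :: T) c.
  move=> h; rewrite ent //; move: h; rewrite mem_tcs => /andP[h1 h2].
  by have [h3] := tabl_col tt h2; rewrite /=; split=> //; nlia.
have headT j : j < size (head [::] T) -> (1, j) \in tcs.
  by rewrite mem_tcs mem_tab_cells /=; case: T => [|row' T'] //= ->.
have entH j : tab_entry (row :: T) (1, j) = nth 0 (head [::] T) j.
  by rewrite /tab_entry /=; case: T.
(* To the left of a domino, the entry above an [i] of the bottom row is greater than [i] and at most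
   [i+1]. *)
have HR (c d : nat * nat) : c \in filter rlv rcs -> d \in filter rlv rcs -> clt c d ->
    vdom c -> vdom d.
  rewrite !mem_filter => /andP[rc cr] /andP[rd dr] cd.
  move: (cr) (dr); rewrite !mem_rcs => /andP[/eqP c1 c2] /andP[/eqP d1 d2].
  rewrite /vdom c1 d1 /= => /and3P[h1 /eqP h2 /eqP h3].
  have dc : d.2 < c.2 by move: cd; rewrite /clt c1 d1 ltnn andbF orbF.
  have rdc := sorted_nth sr (ltnW dc) c2.
  have ed : nth 0 row d.2 = i.
    by move: rd; rewrite /rlv ent0 // => /orP[/eqP//|/eqP e]; move: rdc; rewrite h2 e ltnn.
  have dT : d.2 < size (head [::] T) by nlia.
  have [_ h4] := colokP ck dT; rewrite dT ed eqxx /=.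
  have := colokP ck h1 => -[_ h5].
  have sT : sorted leq (head [::] T) by case: T tT => //= row' T' /and4P[].
  have := sorted_nth sT (ltnW dc) h1; nlia.
have eR : filter rlv rcs = filter (predC vdom) (filter rlv rcs) ++ filter vdom (filter rlv rcs).
  apply: (filter_suffix (r := clt)); first exact: clt_trans.
    by apply: sorted_filter; [apply: clt_trans|apply: rowcells_sorted].
  exact: HR.
have HT (c d : nat * nat) : c \in filter rlv tcs -> d \in filter rlv tcs -> clt c d ->
    ~~ vdom c -> ~~ vdom d.
  rewrite !mem_filter => /andP[rc cr] /andP[rd dr] cd; apply: contra.
  rewrite /vdom => /and4P[h0 h1 /eqP h2 /eqP h3].
  have d1 : d.1 = 1 by move: dr; rewrite mem_tcs => /andP[]; nlia.
  have [cs cc] := colT _ cr.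
  have dc : d.2 <= c.2 by move: cd; rewrite /clt; nlia.
  have rdc := sorted_nth sr dc cs.
  have ci : tab_entry (row :: T) c <= i.+1 by move: rc; rewrite /rlv; nlia.
  have c0 : 0 < c.1 by move: cr; rewrite mem_tcs => /andP[].
  have c1 : c.1 = 1 by nlia.
  have ec : nth 0 row c.2 = i by nlia.
  have cT : c.2 < size (head [::] T).
    by move: cr; rewrite mem_tcs c1 mem_tab_cells /=; case: T => [|row' T'].
  rewrite c1 /= cT ec eqxx /=.
  move: rc; rewrite /rlv (surjective_pairing c) c1 entH => /orP[/eqP|//].
  by have [_] := colokP ck cT; nlia.
have eT : filter rlv tcs = filter vdom (filter rlv tcs) ++ filter (predC vdom) (filter rlv tcs).
  have := @filter_suffix _ (predC vdom) clt (filter rlv tcs) clt_trans.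
  rewrite (@eq_filter _ (predC (predC vdom)) vdom) => [|c /=]; last by rewrite negbK.
  apply; first by apply: sorted_filter; [apply: clt_trans|apply: tcs_sorted].
  exact: HT.
pose D' := filter vdom (filter rlv rcs); pose D := filter vdom (filter rlv tcs).
have sD : size D' = size D.
  have uc s : sorted clt s -> uniq s by apply: sorted_uniq clt_trans clt_irr s.
  have e : perm_eq (map snd D') (map snd D).
    apply: uniq_perm.
    - rewrite map_inj_in_uniq; first by do 2 apply: filter_uniq; apply: uc; apply: rowcells_sorted.
      move=> [a b] [c d]; rewrite !mem_filter !mem_rcs /= => /and3P[_ _ /andP[/eqP-> _]].
      by case/and3P=> _ _ /andP[/eqP-> _] ->.
    - rewrite map_inj_in_uniq; first by do 2 apply: filter_uniq; apply: uc; apply: tcs_sorted.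
      by move=> [[|[|a]] b] [[|[|c]] d]; rewrite !mem_filter !mem_tcs /vdom /= ?andbF // => _ _ ->.
    - move=> j; apply/mapP/mapP => -[c]; rewrite !mem_filter => /and3P[vd rc cr] ->.
        move: vd; rewrite /vdom => /and4P[_ h1 h2 h3].
        exists (1, c.2); rewrite // !mem_filter /vdom /= h1 h2 h3 headT // andbT.
        by rewrite /rlv entH h3 orbT.
      move: vd; rewrite /vdom => /and4P[_ h1 h2 h3]; have [h4 _] := colokP ck h1.
      exists (0, c.2); rewrite // !mem_filter /vdom /= h1 h2 h3 mem_rcs /= h4 andbT.
      by rewrite /rlv /tab_entry /= h2.
  by have := perm_size e; rewrite !size_map.
have D'i : all (fun c => tab_entry (row :: T) c == i) D'.
  apply/allP => c; rewrite !mem_filter => /and3P[/and4P[_ _ h _] _ cr].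
  by rewrite ent0.
have Di : all (fun c => tab_entry (row :: T) c == i.+1) D.
  apply/allP => -[[|[|r]] j]; rewrite !mem_filter mem_tcs /= ?andbF // => /andP[/and4P[_ _ _ /= h] _].
  by rewrite entH.
(* An [i] or [i+1] of the bottom row in a column to the left of an [i] or [i+1] of an upper row
   would force the latter cell into a domino. *)
have HC (c d : nat * nat) : c \in filter (predC vdom) (filter rlv rcs) ->
    d \in filter (predC vdom) (filter rlv tcs) -> clt c d.
  rewrite !mem_filter => /and3P[vc rc cr] /and3P[vd rd dr].
  have [ds dd] := colT _ dr; have d0 : 0 < d.1 by move: dr; rewrite mem_tcs => /andP[].
  move: (cr); rewrite mem_rcs => /andP[/eqP c1 c2]; suff : ~~ (c.2 < d.2) by rewrite /clt; nlia.
  apply/negP => cd; have := sorted_nth sr (ltnW cd) ds => rcd.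
  have di : tab_entry (row :: T) d <= i.+1 by move: rd; rewrite /rlv; nlia.
  have ci : i <= nth 0 row c.2 by move: rc; rewrite /rlv ent0 //; nlia.
  have d1 : d.1 = 1 by nlia.
  have ed : nth 0 row d.2 = i by nlia.
  have dT : d.2 < size (head [::] T).
    by move: dr; rewrite mem_tcs d1 mem_tab_cells /=; case: T => [|row' T'].
  move: vd; rewrite /= /vdom d1 /= dT ed eqxx /=.
  move: rd; rewrite /rlv (surjective_pairing d) d1 entH => /orP[/eqP e|->//].
  by move: dd; rewrite (surjective_pairing d) d1 entH /= e; nlia.
rewrite [RHS]tab_pairing_rlv filter_cat eR eT -/D' -/D -!catA.
rewrite tab_pairing_vdom //.
rewrite [LHS]tab_pairing_scan tab_pairing_rlv.
have -> : filter rlv (filter (predC vdom) (tab_scan (row :: T))) =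
  filter (predC vdom) (filter rlv rcs) ++ filter (predC vdom) (filter rlv tcs).
  apply: (irr_sorted_eq clt_trans clt_irr).
  - by do 2 apply: (sorted_filter clt_trans); apply: tab_scan_sorted.
  - rewrite (sorted_pairwise clt_trans) pairwise_cat -!(sorted_pairwise clt_trans).
    rewrite !(sorted_filter clt_trans) ?rowcells_sorted ?tcs_sorted ?andbT //;
      try by apply: (sorted_filter clt_trans); rewrite ?rowcells_sorted ?tcs_sorted.
    by apply/allrelP => c d; apply: HC.
  - move=> c; rewrite mem_cat 2!mem_filter (mem_tab_scanE tt) !mem_filter.
    rewrite mem_rcs mem_tcs !mem_tab_cells /=.
    by case: c => [[|r] j] /=; case: rlv; case: vdom; rewrite //= ?orbF.
by [].
Qed.

End RemoveRow.

(** * String lengths and e by removal of the bottom row *)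

Definition teps i t := size (tab_unpaired i t).2.

Lemma tab_pairing_shift i row T cs us vs :
  tab_pairing i (row :: T) (map cshift cs) (map cshift us) (map cshift vs) =
  let r := tab_pairing i T cs us vs in (map cshift r.1, map cshift r.2).
Proof.
elim: cs us vs => //= c cs IH us vs.
have -> : tab_entry (row :: T) (cshift c) = tab_entry T c by [].
case: ifP => _; first by rewrite -IH.
by case: ifP => _ //; case: us => [|u us] //; rewrite -IH.
Qed.

Lemma tab_pairing_noi i t cs vs : {in cs, forall c, tab_entry t c != i} ->
  tab_pairing i t cs [::] vs =
  ([::], rev (filter (fun c => tab_entry t c == i.+1) cs) ++ vs).
Proof.
elim: cs vs => //= c cs IH vs h; rewrite (negPf (h c _)) ?inE ?eqxx //.
have h' : {in cs, forall c, tab_entry t c != i} by move=> d dc; apply: h; rewrite inE dc orbT.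
by case: ifP => _; rewrite IH // rev_cons cat_rcons.
Qed.

Lemma tab_pairing_noi1 i t cs us vs : {in cs, forall c, tab_entry t c != i.+1} ->
  tab_pairing i t cs us vs = (rev (filter (fun c => tab_entry t c == i) cs) ++ us, vs).
Proof.
elim: cs us => //= c cs IH us h; have := h c; rewrite inE eqxx => /(_ isT)/negPf->.
have h' : {in cs, forall c, tab_entry t c != i.+1} by move=> d dc; apply: h; rewrite inE dc orbT.
by case: ifP => _; rewrite IH // rev_cons cat_rcons.
Qed.

Lemma count_nth (P : pred nat) row :
  count (fun j => P (nth 0 row j)) (iota 0 (size row)) = count P row.
Proof.
rewrite -[in RHS](mkseq_nth 0 row) /mkseq count_map; exact: eq_count.
Qed.

Definition rowpos i row : seq (nat * nat) :=
  [seq (0, j) | j <- iota 0 (size row) & nth 0 row j == i].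

Lemma size_rowpos i row : size (rowpos i row) = count_mem i row.
Proof. by rewrite size_map size_filter (count_nth (pred1 i)). Qed.

Lemma rowpos_filter i row T :
  rev (filter (fun c => tab_entry (row :: T) c == i) (rowcells row)) = rowpos i row.
Proof.
by rewrite /rowcells map_rev filter_rev revK /rowpos filter_map.
Qed.

(* A sorted row, scanned from right to left, shows its i+1's before its i's. *)
Lemma rowcells_pairing i row T : sorted leq row ->
  tab_pairing i (row :: T) (rowcells row) [::] [::] = (rowpos i row, rowpos i.+1 row).
Proof.
move=> sr; pose gt c := i < tab_entry (row :: T) c.
have split_ : rowcells row = filter gt (rowcells row) ++ filter (predC gt) (rowcells row).
  have := @filter_suffix _ (predC gt) clt (rowcells row) clt_trans (rowcells_sorted row).
  rewrite (@eq_filter _ (predC (predC gt)) gt) => [|c /=]; last by rewrite negbK.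
  apply=> -[r j] [r' j'] /mapP[k]; rewrite mem_rev mem_iota => kr [-> ->].
  move=> /mapP[k']; rewrite mem_rev mem_iota => kr' [-> ->].
  rewrite /clt /= /gt /tab_entry /= ltnn andbF orbF -!leqNgt => kk.
  by apply: leq_trans; apply: sorted_nth => //; lia.
rewrite split_ tab_pairing_cat tab_pairing_noi; last first.
  by move=> c; rewrite mem_filter => /andP[]; rewrite /gt => /gtn_eqF ->.
cbv zeta; rewrite tab_pairing_noi1; last first.
  move=> c; rewrite mem_filter /gt /= => /andP[+ _].
  by apply: contraNneq => ->.
rewrite /= !cats0 -!filter_predI -!(rowpos_filter _ row T); congr (rev _, rev _).
  by apply: eq_filter => c /=; rewrite /gt; case: eqP => //= ->; rewrite ltnn.
by apply: eq_filter => c /=; rewrite /gt; case: eqP => //= ->; rewrite ltnSn.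
Qed.

Lemma tab_unpaired_rec i row T : tabl (row :: T) ->
  let r := tab_unpaired i T in
  (tab_unpaired i (row :: T)).2 =
  take (size r.2 - count_mem i row) (map cshift r.2) ++ rowpos i.+1 row.
Proof.
move=> tt r; rewrite tab_unpaired_cons // tab_pairing_cat.
have [sr _ _] := tabl_parts tt.
rewrite /rcs rowcells_pairing // tab_pairing_stack /=.
have := tab_pairing_shift i row T (tab_scan T) [::] [::].
by rewrite /tcs -/(tab_unpaired i T) -/r /= => ->; rewrite /= size_map size_rowpos.
Qed.

(** With the numbers of [i+1] and of [i] in the row standing for |B| - |B^| and |A| - |A^|, this is
    the recursion of [eps_formula]. *)
Lemma teps_cons i row T : tabl (row :: T) ->
  teps i (row :: T) = count_mem i.+1 row + (teps i T - count_mem i row).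
Proof.
move=> tt; rewrite /teps tab_unpaired_rec // size_cat size_take size_map size_rowpos addnC.
by congr addn; case: ltnP => //; lia.
Qed.

Lemma rowpos_index i row : i \in row -> ohead (rowpos i row) = Some (0, index i row).
Proof.
move=> ir; have ix : index i row < size row by rewrite index_mem.
rewrite /rowpos -(subnKC (ltnW ix)) iotaD filter_cat.
rewrite (_ : filter _ (iota 0 _) = [::]) /=; last first.
  apply/eqP; rewrite -(negbK (_ == _)) -has_filter; apply/hasPn => j.
  by rewrite mem_iota /= add0n => /(before_find 0) /negbT.
have : 0 < size row - index i row by lia.
by case: (size row - index i row) => //= k _; rewrite nth_index // eqxx.
Qed.

(** The upper rows are scanned last, so e acts there as soon as one of their unpaired [i+1] survives
    the [i]s of the bottom row. *)
Lemma tab_e_cons i row T : tabl (row :: T) ->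
  tab_e i (row :: T) =
  if count_mem i row < teps i T then omap (cons row) (tab_e i T)
  else if i.+1 \in row then Some (set_nth 0 row (index i.+1 row) i :: T) else None.
Proof.
move=> tt; rewrite /tab_e tab_unpaired_rec // /teps.
case: ltnP => h.
  case: (tab_unpaired i T).2 h => [//|c v] /= h.
  by rewrite subSn.
rewrite (_ : _ - _ = 0); last by lia.
rewrite take0 /=; case: ifP => ir; first by rewrite rowpos_index.
have : size (rowpos i.+1 row) = 0 by rewrite size_rowpos; apply/count_memPn; rewrite ir.
by case: (rowpos _ _).
Qed.

Lemma tab_e_None i t : (tab_e i t == None) = (teps i t == 0).
Proof. by rewrite /tab_e /teps; case: (tab_unpaired i t).2. Qed.

(** * Semistandard tableaux *)

Lemma set_nth_index (row : seq nat) i k : i \in row -> exists r1 r2,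
  [/\ row = r1 ++ i :: r2, i \notin r1 & set_nth 0 row (index i row) k = r1 ++ k :: r2].
Proof.
elim: row => // a row IH; rewrite inE /=; have [->|ne] := eqVneq i a.
  by move=> _; exists [::], row.
rewrite /= => /IH[r1 [r2 [-> h ->]]]; exists (a :: r1), r2.
by rewrite inE (negPf ne).
Qed.

Lemma sorted_leq_cat (r1 r2 : seq nat) : sorted leq (r1 ++ r2) =
  [&& sorted leq r1, sorted leq r2 & all (fun a => all (leq a) r2) r1].
Proof. by rewrite !(sorted_pairwise leq_trans) pairwise_cat andbC -andbA. Qed.

Lemma sorted_row_e i row : sorted leq row -> i.+1 \in row ->
  sorted leq (set_nth 0 row (index i.+1 row) i).
Proof.
move=> sr /(@set_nth_index row i.+1 i)[r1 [r2 [er nr1 ->]]].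
move: sr; rewrite er !sorted_leq_cat => /and3P[-> ]; rewrite !(sorted_pairwise leq_trans) /=.
move=> /andP[h1 h2] h3; rewrite h2 andbT /=; apply/andP; split.
  by apply: sub_all h1 => a /=; lia.
apply/allP => a ar; have /= /andP[h4 ->] := allP h3 _ ar.
have : a != i.+1 by apply: contraNneq nr1 => <-.
by rewrite andbT; lia.
Qed.

Lemma row_e_unique i row s : sorted leq row -> sorted leq s -> i.+1 \in row ->
  (forall k, count_mem k s + (k == i.+1) = count_mem k row + (k == i)) ->
  s = set_nth 0 row (index i.+1 row) i.
Proof.
move=> sr ss ir h; apply: (sorted_eq leq_trans anti_leq) => //; first exact: sorted_row_e.
have [r1 [r2 [er _ ->]]] := set_nth_index i ir.
apply/allP => k _ /=; apply/eqP; have := h k.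
by rewrite er !count_cat /= (eq_sym k) (eq_sym k); lia.
Qed.

Lemma count_le_below i row row' : sorted leq row -> size row' <= size row ->
  (forall j, j < size row' -> nth 0 row' j = i.+1 -> nth 0 row j = i) ->
  count_mem i.+1 row' <= count_mem i row.
Proof.
move=> sr sz h; rewrite -(count_nth (pred1 i.+1)) -(count_nth (pred1 i) row).
rewrite -(subnKC sz) iotaD count_cat; apply: leq_trans (leq_addr _ _).
rewrite -!size_filter; apply: uniq_leq_size; first exact/filter_uniq/iota_uniq.
move=> j; rewrite !mem_filter !mem_iota /= => /andP[/eqP e hj]; rewrite hj andbT.
by apply/eqP; apply: h.
Qed.

Lemma sumn_set_nth (s : seq nat) j v : j < size s ->
  sumn (set_nth 0 s j v) + nth 0 s j = sumn s + v.
Proof. by elim: s j => //= a s IH [|j] /=; [lia|rewrite ltnS => /IH; lia]. Qed.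

Lemma tabl_e i t t' : tabl t -> tab_e i t = Some t' ->
  [/\ tabl t', (sumn (flatten t')).+1 = sumn (flatten t)
    & forall P : pred nat, P i -> all (all P) t -> all (all P) t'].
Proof.
elim: t t' => [|row T IH] t' tt; first by [].
rewrite tab_e_cons //; move: (tt) => /= /and4P[sr nr ck tT].
case: ltnP => lt; last first.
  case: ifP => // ir [<-].
  have ix : index i.+1 row < size row by rewrite index_mem.
  split=> /=.
  - rewrite sorted_row_e //= tT /=; apply/and3P; split=> //.
      by rewrite -size_eq0 size_set_nth_in // size_eq0.
    case/andP: ck => h1 /allP h2; rewrite /colok size_set_nth_in // h1 /=.
    apply/allP => j hj; rewrite nth_set_nth /=; case: eqP => [ej|_]; last exact: h2.
    by have := h2 _ hj; rewrite ej nth_index //; lia.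
  - by rewrite !sumn_cat; have := sumn_set_nth i ix; rewrite nth_index //; lia.
  - move=> P Pi /andP[h1 ->]; rewrite andbT.
    by have [r1 [r2 [er _ ->]]] := set_nth_index i ir; move: h1; rewrite er !all_cat /= Pi => /and3P[-> _ ->].
case e : (tab_e i T) => [T'|] //= [<-]; have [h1 h2 h3] := IH _ tT e.
split=> /=; last 2 first.
- by rewrite !sumn_cat -h2; lia.
- by move=> P Pi /andP[-> h]; apply: h3.
rewrite sr nr h1 /= andbT.
case: T tT ck lt e {IH h1 h2 h3 tt} => [//|row' T] tT ck lt.
rewrite tab_e_cons //; case: ltnP => lt'.
  by case: (tab_e i T) => //= T'' [<-].
case: ifP => // ir [<-]; move: (ck) => /andP[/= h1 /allP h2].
have ix : index i.+1 row' < size row' by rewrite index_mem.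
rewrite /colok /= size_set_nth_in // h1 /=; apply/allP => j hj.
rewrite nth_set_nth /=; case: eqP => [ej|_]; last exact: h2.
(* If the changed cell sat on an [i], every [i+1] of [row'] would sit on an [i] of [row], and then e
   would not act above [row]. *)
rewrite ltnNge; apply/negP => ge.
move: lt; rewrite teps_cons // (_ : _ - _ = 0) ?addn0 ?ltnNge; last by lia.
move/negP; apply; apply: count_le_below => // k kr ek.
have jk : j <= k.
  rewrite leqNgt; apply/negP => kj; have := @before_find _ 0 (pred1 i.+1) row' k.
  by rewrite -/(index i.+1 row') -ej kj /= ek eqxx => /(_ isT).
have := sorted_nth sr jk (leq_trans kr h1).
by have := h2 k; rewrite mem_iota /= ek => /(_ kr); lia.
Qed.

Lemma tab_highest m k t : tabl t -> all (all (fun a => k < a <= m)) t ->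
  (forall i, k < i < m -> tab_e i t = None) ->
  forall r, r < size t -> nth [::] t r = nseq (size (nth [::] t r)) (k + r).+1.
Proof.
elim: t k => [//|row T IH] k tt /= /andP[ar aT] he.
have rk : row = nseq (size row) k.+1.
  apply/all_pred1P/allP => a arow /=; apply/negPn/negP => ne.
  (* An entry [a] above [k+1] in the bottom row lets the operator of index [a.-1] act, on this row
     if not on the rows above. *)
  have := allP ar _ arow => ha; have := he a.-1.
  rewrite tab_e_cons // => H; have {H} : None <> None :> option (seq (seq nat)); last by [].
  rewrite -{1}H; last by lia.
  case: ltnP => lt.
    have : tab_e a.-1 T != None by rewrite tab_e_None; lia.
    by case: (tab_e a.-1 T).
  by rewrite prednK ?arow //; lia.
have [sr ck tT] := tabl_parts tt.
case=> [_|r rT]; first by rewrite addn0.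
rewrite addnS -addSn; apply: IH => //.
  apply/allP => row' /(nthP [::])[r' r'T <-]; apply/allP => a /(nthP 0)[j hj <-].
  have cc : (r', j) \in tab_cells T by rewrite mem_tab_cells /= r'T.
  have [jr] := tabl_col tt cc; rewrite /tab_entry /= {1}rk nth_nseq jr => hlt.
  have /= /andP[_ ->] := allP (allP aT _ (mem_nth [::] r'T)) _ (mem_nth 0 hj).
  by rewrite andbT; apply: leq_ltn_trans hlt; apply: leq_addr.
move=> i hi; apply/eqP; rewrite tab_e_None.
have /eqP : tab_e i (row :: T) = None by apply: he; lia.
rewrite tab_e_None teps_cons // rk !count_nseq /=.
by rewrite (_ : (k.+1 == i) = false) ?mul0n ?subn0; lia.
Qed.

End Tableaux.

(** * Insertion of a sequence of factors *)

Fixpoint ninsert a (P : seq (seq nat)) : seq (seq nat) :=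
  if P is R :: P' then
    let ro := nrow a R in
    ro.1 :: (if ro.2 is Some b then ninsert b P' else P')
  else [:: [:: a]].

Definition tins P u := foldl (fun P a => ninsert a P) P u.

Section Insertion.

Implicit Types (P Q : seq (seq nat)) (F G : seq (seq nat)) (A B R u : seq nat).

Lemma tins_cons R P u : tins (R :: P) u = (rins R u).1 :: tins P (rins R u).2.
Proof.
elim: u R P => //= a u IH R P; rewrite /tins /= -/(tins _ _) IH.
by case: (nrow a R).2.
Qed.

Lemma tins_nil u : u != [::] -> tins [::] u = (rins [::] u).1 :: tins [::] (rins [::] u).2.
Proof. by case: u => // a u _; rewrite -tins_cons. Qed.

Lemma tins_cat P u v : tins P (u ++ v) = tins (tins P u) v.
Proof. exact: foldl_cat. Qed.

Lemma nrow_size_ge a R : size R <= size (nrow a R).1.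
Proof.
rewrite /nrow; case e : [seq r <- R | a < r] => [|b R2] /=; first by rewrite size_rcons.
case: ifP => //= _; rewrite size_cat size_filter /=.
have := count_predC (fun r => r <= a) R.
rewrite (@eq_count _ (predC _) (fun r => a < r)) => [|r /=]; last by rewrite ltnNge.
by rewrite -[count (fun r => a < r) R]size_filter e /=; lia.
Qed.

Lemma rins_size_ge R u : size R <= size (rins R u).1.
Proof.
elim: u R => //= a u IH R; apply: leq_trans (nrow_size_ge a R) (IH _).
Qed.

Definition shp P r := size (nth [::] P r).

Lemma ninsert_shp a P r : shp P r <= shp (ninsert a P) r.
Proof.
elim: P a r => [|R P IH] a [|r] //=; rewrite /shp /= ?nth_nil //; first exact: nrow_size_ge.
by case: (nrow a R).2 => [b|//]; apply: IH.
Qed.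

Lemma tins_shp P u r : shp P r <= shp (tins P u) r.
Proof.
elim: u P => //= a u IH P; apply: leq_trans (IH _); exact: ninsert_shp.
Qed.

Definition nP F := tins [::] (flatten F).

Definition nQ F := foldl (fun Q i => fill_cells (tab_shape (nP (take i F))) i Q) [::]
  (iota 1 (size F)).

(** Row [r] of Q after [k] factors, written out label by label instead of through repeated
    [fill_cells]. *)
Definition qrow F k r :=
  flatten [seq nseq (shp (nP (take i.+1 F)) r - shp (nP (take i F)) r) i.+1 | i <- iota 0 k].

Lemma nP_take F i j : i <= j -> exists u, nP (take j F) = tins (nP (take i F)) u.
Proof.
move=> ij; exists (flatten (take (j - i) (drop i F))).
by rewrite /nP -tins_cat -flatten_cat -takeD subnKC.
Qed.

Lemma nP_shp F r i j : i <= j -> shp (nP (take i F)) r <= shp (nP (take j F)) r.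
Proof. by move=> ij; have [u ->] := nP_take F ij; apply: tins_shp. Qed.

Lemma qrowS F k r : qrow F k.+1 r =
  qrow F k r ++ nseq (shp (nP (take k.+1 F)) r - shp (nP (take k F)) r) k.+1.
Proof. by rewrite /qrow -[in LHS]addn1 iotaD map_cat flatten_cat /= cats0. Qed.

Lemma size_qrow F k r : size (qrow F k r) = shp (nP (take k F)) r.
Proof.
elim: k => [|k IH]; first by rewrite take0 /shp /= nth_nil.
by rewrite qrowS size_cat IH size_nseq subnKC // nP_shp.
Qed.

Lemma nQE F : nQ F = mkseq (qrow F (size F)) (size (nP F)).
Proof.
suff H k : foldl (fun Q i => fill_cells (tab_shape (nP (take i F))) i Q) [::] (iota 1 k) =
    mkseq (qrow F k) (size (nP (take k F))) by rewrite /nQ H take_size.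
elim: k => [|k IH]; first by rewrite take0.
rewrite -[in LHS](addn1 k) iotaD foldl_cat IH /= add1n.
rewrite /fill_cells size_map; apply: (@eq_from_nth _ [::]); first by rewrite !size_mkseq.
move=> r; rewrite size_mkseq => hr; rewrite nth_mkseq // [RHS]nth_mkseq //.
have [lt|ge] := ltnP r (size (nP (take k F))).
  by rewrite nth_mkseq // size_qrow qrowS (nth_map [::]).
rewrite nth_default ?size_mkseq //= subn0 qrowS (nth_map [::]) //.
have e0 : shp (nP (take k F)) r = 0 by rewrite /shp nth_default.
by have := size_qrow F k r; rewrite e0 subn0 => /size0nil ->.
Qed.

Fixpoint fpass R F : seq nat * seq (seq nat) :=
  if F is A :: F' then
    let r := rins R A in let s := fpass r.1 F' in (s.1, r.2 :: s.2)
  else (R, [::]).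

Lemma fpass_rins R F : (fpass R F).1 = (rins R (flatten F)).1 /\
  flatten (fpass R F).2 = (rins R (flatten F)).2.
Proof.
elim: F R => //= A F IH R; rewrite rins_cat /=.
by have [-> ->] := IH (rins R A).1.
Qed.

Lemma fpass_cat R F G : fpass R (F ++ G) =
  ((fpass (fpass R F).1 G).1, (fpass R F).2 ++ (fpass (fpass R F).1 G).2).
Proof.
elim: F R => [|A F IH] R /=; first by case: (fpass R G).
by rewrite IH.
Qed.

Lemma fpass_size R F : size (fpass R F).2 = size F.
Proof. by elim: F R => //= A F IH R; rewrite IH. Qed.

Lemma fpass_take R F i : (fpass R (take i F)).2 = take i (fpass R F).2.
Proof. by elim: F R i => [|A F IH] R [|i] //=; rewrite IH. Qed.

(** The part of the bottom row of Q recorded while the factors [F], labelled from [k] on, pass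
    through the row [R]. *)
Fixpoint crow k R F : seq nat :=
  if F is A :: F' then
    nseq (size (rins R A).1 - size R) k ++ crow k.+1 (rins R A).1 F'
  else [::].

Lemma crow_cat k R F G : crow k R (F ++ G) = crow k R F ++ crow (k + size F) (fpass R F).1 G.
Proof.
elim: F k R => [|A F IH] k R /=; first by rewrite addn0.
by rewrite IH catA addSnnS.
Qed.

Lemma crow_bounds k R F : all (fun a => k <= a < k + size F) (crow k R F).
Proof.
elim: F k R => //= A F IH k R; rewrite all_cat; apply/andP; split.
  by apply/allP => a; rewrite mem_nseq => /andP[_ /eqP->]; lia.
by apply: sub_all (IH k.+1 (rins R A).1) => a; lia.
Qed.

Lemma crow_sorted k R F : sorted leq (crow k R F).
Proof.
elim: F k R => //= A F IH k R; rewrite sorted_leq_cat IH /=.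
apply/andP; split.
  by elim: (_ - _) => //= p; case: p => //= p ->; rewrite leqnn.
apply/allP => a; rewrite mem_nseq => /andP[_ /eqP->].
by apply: sub_all (crow_bounds k.+1 (rins R A).1 F) => b; lia.
Qed.

Lemma crow_size k R F : size (crow k R F) = size (fpass R F).1 - size R.
Proof.
elim: F k R => [|A F IH] k R /=; first by rewrite subnn.
rewrite size_cat size_nseq IH; have := rins_size_ge R A.
have [-> _] := fpass_rins (rins R A).1 F.
by have := rins_size_ge (rins R A).1 (flatten F); lia.
Qed.

Lemma count_crow_out k R F a : ~~ (k <= a < k + size F) -> count_mem a (crow k R F) = 0.
Proof.
move=> h; apply/count_memPn; apply: contra h => ac.
exact: (allP (crow_bounds k R F)).
Qed.

Lemma nP_cons F : flatten F != [::] -> nP F = (fpass [::] F).1 :: nP (fpass [::] F).2.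
Proof.
move=> h; rewrite /nP tins_nil //; have [-> ->] := fpass_rins [::] F.
by [].
Qed.

Lemma shp0 F i : shp (nP (take i F)) 0 = size (fpass [::] (take i F)).1.
Proof.
have [e|ne] := eqVneq (flatten (take i F)) [::]; last by rewrite nP_cons.
by rewrite /nP e /shp /=; have [-> _] := fpass_rins [::] (take i F); rewrite e.
Qed.

Lemma shpS F i r : shp (nP (take i F)) r.+1 = shp (nP (take i (fpass [::] F).2)) r.
Proof.
rewrite -fpass_take; have [e|ne] := eqVneq (flatten (take i F)) [::]; last by rewrite nP_cons.
by rewrite /nP; have [_ ->] := fpass_rins [::] (take i F); rewrite e /shp !nth_nil.
Qed.

Lemma crowE k R F : crow k R F =
  flatten [seq nseq (size (fpass R (take i.+1 F)).1 - size (fpass R (take i F)).1) (k + i)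
          | i <- iota 0 (size F)].
Proof.
elim: F k R => [//|A F IH] k R /=; rewrite take0 addn0 /= IH; congr (_ ++ flatten _).
rewrite -[1]/(1 + 0) iotaDl -map_comp; apply: eq_map => i /=.
by rewrite addnA addn1.
Qed.

Lemma nQ_cons F : flatten F != [::] -> nQ F = crow 1 [::] F :: nQ (fpass [::] F).2.
Proof.
move=> h; rewrite !nQE nP_cons //= /mkseq /= -[1]/(1 + 0) iotaDl -map_comp; congr cons.
  by rewrite crowE /qrow; congr flatten; apply: eq_map => i; rewrite !shp0.
rewrite fpass_size; apply: eq_map => r /=.
by rewrite /qrow; congr flatten; apply: eq_map => i; rewrite !add1n !shpS.
Qed.

Lemma nQ_nil F : flatten F = [::] -> nQ F = [::].
Proof. by move=> e; rewrite nQE /nP e. Qed.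

Lemma nQ_shape F : tab_shape (nQ F) = tab_shape (nP F).
Proof.
rewrite nQE; apply: (@eq_from_nth _ 0); first by rewrite !size_map size_iota.
move=> r; rewrite size_map size_mkseq => hr.
by rewrite !(nth_map [::]) ?size_mkseq // nth_mkseq // size_qrow take_size.
Qed.

(** * Column strictness *)

(* The tableau condition for a row S above a row R: at most as many letters <= t in S
   as letters < t in R. *)
Definition above (S R : seq nat) := forall t, size S + cnt R t <= size R + cnt S t.+1.

(** For large thresholds the inequality follows from the one at a letter of [R], namely [a] or [b],
    past which the count of [R] has dropped by at least one. *)
Lemma above_nrow a R S : srt R -> (a \in R) ==> (a.+1 \in R) -> srt S ->
  gins S (oseq (nrow a R).2) -> above S R ->
  above (rins S (oseq (nrow a R).2)).1 (nrow a R).1.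
Proof.
move=> sR g sS; case: (nrowP sR g) => [h|R1 R2 eR h1 h2|R1 b R2 eR h1 h2 h3] /=.
- by move=> _ ab t; have := ab t; rewrite size_rcons -cats1 cnt_cat cnt_cons cnt_nil; nlia.
- rewrite andbT => gS ab; have aR : a \in R by rewrite eR mem_cat inE eqxx orbT.
  have cR t : a < t -> cnt R t + 1 <= cnt R a.
    move=> at_; have := cntS a (srt_uniq sR); rewrite aR.
    have : cnt R t <= cnt R a.+1 by apply: sub_count => y /=; apply: leq_trans.
    nlia.
  case: (nrowP sS gS) => [h|S1 S2 eS k1 k2|S1 b S2 eS k1 k2 k3] //= t; have := ab t; have := ab a.
  + rewrite size_rcons -cats1 cnt_cat cnt_cons cnt_nil => e1 e2.
    have [lt|ge] := ltnP t a.+1; first by nlia.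
    have s0 (u : nat) : a < u -> cnt S u = 0 by move=> au; apply: cnt_eq0 => y /(allP h) /=; nlia.
    by have := cR _ ge; rewrite !s0 in e1 e2 *; nlia.
  + rewrite eS !size_cat !cnt_cat !cnt_cons /= => e1 e2.
    have [lt|ge] := ltnP t a.+1; first by nlia.
    have [lt'|ge'] := ltnP t b; last by nlia.
    have s0 (u : nat) : a < u -> cnt S1 u = 0 by move=> au; apply: cnt_eq0 => y /(allP k1) /=; nlia.
    have s1 (u : nat) : u <= b -> cnt S2 u = size S2.
      by move=> ub; apply/eqP; rewrite -all_count; apply: sub_all k3 => y /=; nlia.
    by have := cR _ ge; rewrite !s0 ?s1 in e1 e2 *; try nlia.
- rewrite andbT => gS ab; have bR : b \in R by rewrite eR mem_cat inE eqxx orbT.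
  have cR t : b < t -> cnt R t + 1 <= cnt R b.
    move=> at_; have := cntS b (srt_uniq sR); rewrite bR.
    have : cnt R t <= cnt R b.+1 by apply: sub_count => y /=; apply: leq_trans.
    nlia.
  have eC t : cnt (R1 ++ a :: R2) t + (t <= b) = cnt R t + (t <= a).
    by rewrite eR !cnt_cat !cnt_cons; nlia.
  have eZ : size (R1 ++ a :: R2) = size R by rewrite eR !size_cat.
  rewrite /above eZ.
  case: (nrowP sS gS) => [h|S1 S2 eS k1 k2|S1 d S2 eS k1 k2 k3] //= t;
    have := eC t; move: (cnt (R1 ++ a :: R2) t) => X e3; have := ab t; have := ab b.
  + rewrite size_rcons -cats1 cnt_cat cnt_cons cnt_nil => e1 e2.
    have [lt|ge] := leqP t b; first by nlia.
    have s0 (u : nat) : b < u -> cnt S u = 0 by move=> au; apply: cnt_eq0 => y /(allP h) /=; nlia.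
    by have := cR _ ge; rewrite !s0 in e1 e2 *; nlia.
  + nlia.
  + rewrite eS !size_cat !cnt_cat !cnt_cons /= => e1 e2.
    have [lt|ge] := leqP t b; first by nlia.
    have [lt'|ge'] := ltnP t d; last by nlia.
    have s0 (u : nat) : b < u -> cnt S1 u = 0 by move=> au; apply: cnt_eq0 => y /(allP k1) /=; nlia.
    have s1 (u : nat) : u <= d -> cnt S2 u = size S2.
      by move=> ub; apply/eqP; rewrite -all_count; apply: sub_all k3 => y /=; nlia.
    by have := cR _ ge; rewrite !s0 ?s1 in e1 e2 *; try nlia.
Qed.

Lemma above_rins R S u : srt R -> srt S -> gins R u -> gins S (rins R u).2 -> above S R ->
  above (rins S (rins R u).2).1 (rins R u).1.
Proof.
elim: u R S => //= a u IH R S sR sS /andP[g gu]; rewrite gins_cat => /andP[gS gS'] ab.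
rewrite rins_cat; apply: IH => //; first exact: nrow_srt.
  exact: rins_srt.
exact: above_nrow.
Qed.

Lemma sorted_count_nth (s : seq nat) j a : sorted leq s -> j < size s ->
  (nth 0 s j <= a) = (j < count (leq^~ a) s).
Proof.
elim: s j => //= b s IH [|j] sb js /=; have ss := path_sorted sb.
  have [//|ab] := leqP b a; rewrite add0n; apply/esym/negbTE; rewrite -leqNgt leqn0.
  rewrite -(negbK (_ == 0)) -lt0n -has_count; apply/hasPn => c cs.
  have /allP/(_ _ cs) /= := order_path_min leq_trans sb; lia.
rewrite IH //; have [//|ab] := leqP b a.
have -> : count (leq^~ a) s = 0.
  apply/eqP; rewrite -leqn0 leqNgt -has_count; apply/hasPn => c cs.
  have /allP/(_ _ cs) /= := order_path_min leq_trans sb; lia.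
by [].
Qed.

Lemma count_crow_le R F i : i <= size F ->
  count (leq^~ i) (crow 1 R F) = size (fpass R (take i F)).1 - size R.
Proof.
move=> iF; rewrite -{1}(cat_take_drop i F) crow_cat count_cat -(crow_size 1).
have -> : count (leq^~ i) (crow 1 R (take i F)) = size (crow 1 R (take i F)).
  apply/eqP; rewrite -all_count; apply: sub_all (crow_bounds 1 R (take i F)) => a.
  by rewrite size_takel //; lia.
rewrite (_ : count _ (crow (1 + _) _ _) = 0) ?addn0 //.
apply/eqP; rewrite -leqn0 leqNgt -has_count; apply/hasPn => a.
move=> /(allP (crow_bounds _ _ _)); rewrite size_takel //; lia.
Qed.

Section Factors.
Variables (n : nat) (x : 'I_n).
Notation okw := (okw n).
Notation red := (red x).
Notation celt := (celt x).

Definition facts F := all (fun A => srt A) F && red (flatten F).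

Lemma facts_fpass R F : srt R -> all (fun A => srt A) F -> red (R ++ flatten F) ->
  facts (fpass R F).2.
Proof.
move=> sR sF rF; have [e1 e2] := fpass_rins R F.
have [g r _] := rins_celt (p := [::]) sR rF.
apply/andP; split; last by rewrite e2; move: r => /= /red_infixr.
elim: F R sR sF g {e1 e2 r rF} => //= A F IH R sR /andP[sA sF].
rewrite gins_cat => /andP[gA gF]; rewrite bumped_srt // IH //.
exact: rins_srt.
Qed.

Lemma facts_fpass0 F : facts F -> facts (fpass [::] F).2.
Proof. by case/andP=> sF rF; apply: facts_fpass. Qed.

Lemma facts_gins F : facts F -> gins [::] (flatten F).
Proof. by case/andP=> _ rF; have [] := rins_celt (p := [::]) (R := [::]) isT rF. Qed.

Lemma facts_take F i : facts F -> facts (take i F).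
Proof.
case/andP=> sF rF; apply/andP; split.
  by move: sF; rewrite -{1}(cat_take_drop i F) all_cat => /andP[].
by move: rF; rewrite -{1}(cat_take_drop i F) flatten_cat => /red_infixr.
Qed.

(** Let A^ be the letters bumped from the bottom row R into the second row S. The growth of S is the
    maximum of [cnt A^ t - cnt S t.+1]. As A^ is contained in R, [above] bounds it by |R| - |S|. *)
Lemma second_row_le F i : facts F -> i < size F ->
  size (fpass [::] (take i.+1 (fpass [::] F).2)).1 <= size (fpass [::] (take i F)).1.
Proof.
move=> fF iF; have fi := facts_take i.+1 fF; have fi' := facts_fpass0 fi.
rewrite -fpass_take.
move: fi fi'; rewrite (take_nth [::]) // -cats1; set G := take i F; set A := nth [::] F i => fi fi'.
have gi := facts_gins fi; have gi' := facts_gins fi'.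
have sA : srt A by move: fi => /andP[]; rewrite all_cat /= andbT => /andP[].
move: gi gi'; rewrite fpass_cat !flatten_cat /= cats0 gins_cat => /andP[gG gA].
rewrite cats0 gins_cat => /andP[gG' gA'].
rewrite fpass_cat /=.
have [e1 e2] := fpass_rins [::] G; rewrite -e1 in gA; rewrite e2 in gG'.
have [e3 e4] := fpass_rins [::] (fpass [::] G).2; rewrite e2 in e3 e4; rewrite e2 -e3 in gA'.
have sR : srt (fpass [::] G).1 by rewrite e1; apply: rins_srt.
have sS : srt (fpass [::] (fpass [::] G).2).1 by rewrite e3; apply: rins_srt.
have ab : above (fpass [::] (fpass [::] G).2).1 (fpass [::] G).1.
  by rewrite e1 e3; apply: above_rins.
have sAh := bumped_srt sR sA gA.
have [_ [t et]] := is_eps_rins sS sAh gA'.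
have sz := rins_size sS gA'; have bs := bumped_le_size (fpass [::] (fpass [::] G).2).1 (rins (fpass [::] G).1 A).2.
have := uniq_cnt_sub t (srt_uniq sAh) (bumped_sub sR sA gA).
have := ab t; nlia.
Qed.

Lemma tabl_nQ F : facts F -> tabl (nQ F).
Proof.
have [N] := ubnP (size (flatten F)); elim: N F => // N IH F sz fF.
have [e|ne] := eqVneq (flatten F) [::]; first by rewrite nQ_nil.
have fF' := facts_fpass0 fF; rewrite nQ_cons //=.
have gF := facts_gins fF; have [e1 e2] := fpass_rins [::] F.
have R0 : 0 < size (fpass [::] F).1.
  by rewrite e1; case: (flatten F) ne => //= a u _; apply: leq_trans (rins_size_ge _ _).
apply/and4P; split.
- exact: crow_sorted.
- by rewrite -size_eq0 crow_size subn0 -lt0n.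
- rewrite /colok; have -> : head [::] (nQ (fpass [::] F).2) = crow 1 [::] (fpass [::] F).2.
    have [e|ne'] := eqVneq (flatten (fpass [::] F).2) [::]; last by rewrite nQ_cons.
    rewrite nQ_nil //=; apply/esym/size0nil; rewrite crow_size.
    by have [-> _] := fpass_rins [::] (fpass [::] F).2; rewrite e.
  set S := crow _ _ (fpass _ _).2.
  (* A label [e] in column [j] of the second row means that this column is reached after [e]
     factors; the bottom row then reaches it after [e.-1] factors and has a smaller label there. *)
  have H j : j < size S -> nth 0 (crow 1 [::] F) j < nth 0 S j /\ j < size (crow 1 [::] F).
    move=> jS; have sS : sorted leq S by apply: crow_sorted.
    have := allP (crow_bounds 1 [::] (fpass [::] F).2) _ (mem_nth 0 jS); rewrite fpass_size -/S.
    set e := nth 0 S j => /andP[e0 es].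
    have je : j < count (leq^~ e) S by rewrite -sorted_count_nth.
    move: je; rewrite count_crow_le ?fpass_size ?subn0; last by lia.
    have eF : e.-1 < size F by lia.
    have := second_row_le fF eF; rewrite prednK // => le jl.
    have jc : j < count (leq^~ e.-1) (crow 1 [::] F).
      by rewrite count_crow_le ?subn0; [apply: leq_trans jl le|lia].
    have jr : j < size (crow 1 [::] F) by apply: leq_trans jc (count_size _ _).
    by split=> //; rewrite -(sorted_count_nth _ (crow_sorted _ _ _)) // in jc; lia.
  apply/andP; split.
    by case e : (size S) => [//|k]; have [] := H k; rewrite ?e.
  by apply/allP => j; rewrite mem_iota => hj; have [] := H j.
- apply: IH => //; rewrite e2; move: sz.
  by have := rins_size (isT : srt [::]) gF; rewrite -e1 /=; nlia.
Qed.

Lemma nQ_bounds F : facts F -> all (all (fun a => 0 < a <= size F)) (nQ F).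
Proof.
have [N] := ubnP (size (flatten F)); elim: N F => // N IH F sz fF.
have [e|ne] := eqVneq (flatten F) [::]; first by rewrite nQ_nil.
have fF' := facts_fpass0 fF; rewrite nQ_cons //=; apply/andP; split.
  by apply: sub_all (crow_bounds 1 [::] F) => a; lia.
have gF := facts_gins fF; have [e1 e2] := fpass_rins [::] F.
have R0 : 0 < size (fpass [::] F).1.
  by rewrite e1; case: (flatten F) ne => //= a u _; apply: leq_trans (rins_size_ge _ _).
rewrite -(fpass_size [::] F); apply: IH => //; rewrite e2; move: sz.
by have := rins_size (isT : srt [::]) gF; rewrite -e1 /=; nlia.
Qed.


Lemma fpass_shrinks F : facts F -> flatten F != [::] ->
  size (flatten (fpass [::] F).2) < size (flatten F).
Proof.
move=> fF ne; have gF := facts_gins fF; have [e1 e2] := fpass_rins [::] F.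
have R0 : 0 < size (fpass [::] F).1.
  by rewrite e1; case: (flatten F) ne => //= a u _; apply: leq_trans (rins_size_ge _ _).
by rewrite e2; have := rins_size (isT : srt [::]) gF; rewrite -e1 /=; nlia.
Qed.

Lemma nQ_weight F i : facts F -> i < size F ->
  count_mem i.+1 (flatten (nQ F)) = size (nth [::] F i).
Proof.
have [N] := ubnP (size (flatten F)); elim: N F => // N IH F sz fF iF.
have [e|ne] := eqVneq (flatten F) [::].
  rewrite nQ_nil //=; have : size (nth [::] F i) <= size (flatten F).
    rewrite size_flatten sumnE big_map (big_nth [::]) big_mkord.
    by rewrite (bigD1 (Ordinal iF)) //= leq_addr.
  by rewrite e; case: (nth _ _ _).
rewrite nQ_cons //= count_cat IH ?facts_fpass0 ?fpass_size //; last first.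
  by have := fpass_shrinks fF ne; lia.
have eF : F = take i F ++ nth [::] F i :: drop i.+1 F by rewrite -drop_nth // cat_take_drop.
have := facts_gins fF; have /andP[sF _] := fF; move: sF.
have sz1 : size (take i F) = i by rewrite size_takel // ltnW.
move: eF sz1; set F1 := take i F; set A := nth [::] F i; set F2 := drop i.+1 F => eF sz1.
rewrite eF all_cat /= => /and3P[_ sA _]; rewrite flatten_cat gins_cat /= gins_cat.
have [e1 e2] := fpass_rins [::] F1; rewrite -e1 => /and3P[gF1 gA _].
have sR : srt (fpass [::] F1).1 by rewrite e1; apply: rins_srt.
rewrite crow_cat count_cat count_crow_out ?sz1; last by lia.
rewrite add0n /= count_cat count_nseq /= eqxx mul1n.
rewrite count_crow_out ?addn0; last by lia.
rewrite fpass_cat nth_cat fpass_size sz1 ltnn subnn /=.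
have := rins_size sR gA; have := bumped_le_size (fpass [::] F1).1 A; nlia.
Qed.

Lemma tins_ck u v : red u -> ck u v -> tins [::] u = tins [::] v.
Proof.
have [N] := ubnP (size u); elim: N u v => // N IH u v su ru h.
have [e|ne] := eqVneq u [::].
  by move: (ck_size h); rewrite e; case: v {h}.
have ne' : v != [::] by rewrite -size_eq0 -(ck_size h) size_eq0.
rewrite (tins_nil ne) (tins_nil ne'); have [-> cb] := ck_rins (R := [::]) isT ru h; congr cons.
have [g r _] := rins_celt (p := [::]) (R := [::]) isT ru.
apply: IH => //; last by move: r => /= /red_infixr.
have := rins_size (isT : srt [::]) g.
have : 0 < size (rins [::] u).1.
  by case: (u) ne => //= a w _; apply: leq_trans (rins_size_ge _ _).
rewrite /=; nlia.
Qed.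

Lemma flatten_pair F1 A B F2 :
  flatten (F1 ++ A :: B :: F2) = flatten F1 ++ (A ++ B) ++ flatten F2.
Proof. by rewrite flatten_cat /= !catA. Qed.

Section Step.
Variables (F1 F2 : seq (seq nat)) (A B A' B' : seq nat) (b c E : nat).
Hypotheses (fF : facts (F1 ++ A :: B :: F2)) (es : estep A B A' B' b c E).

Lemma facts_pair : [/\ srt A, srt B & red (A ++ B)].
Proof.
move: fF => /andP[]; rewrite all_cat /= => /and4P[_ -> -> _].
by rewrite flatten_pair => /red_infix.
Qed.

Lemma step_ck : ck (flatten (F1 ++ A :: B :: F2)) (flatten (F1 ++ A' :: B' :: F2)).
Proof.
have [sA sB rAB] := facts_pair; rewrite !flatten_pair; apply: ck_ctx.
exact: (estep_ck sA sB rAB es).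
Qed.

Lemma step_facts : facts (F1 ++ A' :: B' :: F2).
Proof.
move: fF => /andP[sF rF]; apply/andP; split.
  move: sF; rewrite !all_cat /= => /and4P[-> _ _ ->].
  by rewrite (es_sA' es) (es_sB' es).
have := ck_red (p := [::]) (q := [::]) step_ck; rewrite /= !cats0; exact.
Qed.

Lemma step_nP : nP (F1 ++ A' :: B' :: F2) = nP (F1 ++ A :: B :: F2).
Proof. by apply/esym/tins_ck; [case/andP: fF|exact: step_ck]. Qed.

Lemma step_celt : celt (flatten (F1 ++ A' :: B' :: F2)) = celt (flatten (F1 ++ A :: B :: F2)).
Proof.
have [sA sB rAB] := facts_pair; rewrite !flatten_pair; apply: celt_ctx.
exact: (estep_celt sA sB rAB es).
Qed.

End Step.

Lemma crow_pair F1 A B F2 : crow 1 [::] (F1 ++ A :: B :: F2) =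
  crow 1 [::] F1 ++
  nseq (size (rins (fpass [::] F1).1 A).1 - size (fpass [::] F1).1) (size F1).+1 ++
  nseq (size (rins (rins (fpass [::] F1).1 A).1 B).1 - size (rins (fpass [::] F1).1 A).1) (size F1).+2 ++
  crow (size F1).+3 (rins (rins (fpass [::] F1).1 A).1 B).1 F2.
Proof. by rewrite crow_cat /= add1n. Qed.

(** String length and operator are treated in one induction, because the string length of the upper
    rows decides whether e acts above the bottom row ([tab_e_cons]). *)
Lemma core_e F1 A B F2 : let F := F1 ++ A :: B :: F2 in let i := (size F1).+1 in
  facts F ->
  (forall E, is_eps A B E -> teps i (nQ F) = E) /\
  (forall A' B' b c E, estep A B A' B' b c E ->
     tab_e i (nQ F) = Some (nQ (F1 ++ A' :: B' :: F2))).
Proof.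
move=> F i; rewrite /F /i {F i}.
have [N] := ubnP (size (flatten (F1 ++ A :: B :: F2))).
elim: N F1 A B F2 => // N IH F1 A B F2 sz fF.
have [sA sB rAB] := facts_pair fF.
have [e|ne] := eqVneq (flatten (F1 ++ A :: B :: F2)) [::].
  have [eA eB] : A = [::] /\ B = [::].
    have := congr1 size e; rewrite flatten_pair !size_cat /=.
    by case: (A); case: (B) => //=; nlia.
  have z E : is_eps A B E -> E = 0 by rewrite eA eB => -[_ [t]]; rewrite !cnt_nil; nlia.
  split=> [E /z ->|A' B' b c E es]; first by rewrite nQ_nil.
  by have := es_pos es; rewrite (z _ (es_eps es)).
have tQ := tabl_nQ fF; have gF := facts_gins fF.
have fF' := facts_fpass0 fF; have shr := fpass_shrinks fF ne.
move: (fF) => /andP[_ rF].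
rewrite nQ_cons // in tQ *.
have [e1 e2] := fpass_rins [::] F1.
move: gF; rewrite flatten_pair !gins_cat rins_cat /= -e1 => /and3P[gF1 /andP[gA gB] gF2].
set R := (fpass [::] F1).1 in gA gB gF2 *.
have sR : srt R by rewrite /R e1; apply: rins_srt.
(* The factors before [A] may be replaced by the word that their insertion produces, of the same
   element and the same length. *)
have rRAB : red (R ++ A ++ B).
  move: rF; rewrite flatten_pair => rF.
  have rF1 : red (flatten F1 ++ (A ++ B)) by move: rF; rewrite catA => /red_infixr.
  have [_ r1 ec] := rins_celt (p := [::]) (R := [::]) (u := flatten F1) isT (red_infixr rF1).
  have := red_ok rF1; rewrite okw_cat => /andP[_ oAB].
  have : red ((rins [::] (flatten F1)).2 ++ R ++ A ++ B).
    apply: (red_eq rF1).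
    - by have := red_ok r1; rewrite /= /R e1 !okw_cat => /andP[-> ->]; rewrite -okw_cat.
    - by have := rins_size (isT : srt [::]) gF1; rewrite /R e1 !size_cat /=; nlia.
    - by rewrite catA celt_cat /R e1 ec -celt_cat.
  by move/red_infixl.
pose r1 := rins R A; pose r2 := rins r1.1 B.
have sr1 : srt r1.1 by apply: rins_srt.
have sBh : srt r2.2 by apply: bumped_srt.
have eF : (fpass [::] (F1 ++ A :: B :: F2)).2 =
    (fpass [::] F1).2 ++ r1.2 :: r2.2 :: (fpass r2.1 F2).2 by rewrite fpass_cat.
rewrite eF in tQ fF' shr *.
have szh : size (flatten ((fpass [::] F1).2 ++ r1.2 :: r2.2 :: (fpass r2.1 F2).2)) < N by nlia.
have [IH1 IH2] := IH _ _ _ _ szh fF'; rewrite fpass_size in IH1 IH2.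
have [sAh sBh' rh] := facts_pair fF'.
have [gh _ _] := rins_celt (p := [::]) sAh rh.
have hp := is_eps_rins sAh sBh' gh; set p := _ - _ in hp.
have ep := IH1 _ hp.
have [q1 q2] := (bumped_le_size R A, bumped_le_size r1.1 B).
have [z1 z2] := (rins_size sR gA, rins_size sr1 gB); rewrite -/r1 -/r2 in q1 q2 z1 z2.
have eC := crow_pair F1 A B F2; rewrite -/R -/r1 -/r2 in eC.
have cA : count_mem (size F1).+1 (crow 1 [::] (F1 ++ A :: B :: F2)) = size A - size r1.2.
  by rewrite eC !count_cat !count_nseq /= eqxx !count_crow_out; nlia.
have cB : count_mem (size F1).+2 (crow 1 [::] (F1 ++ A :: B :: F2)) = size B - size r2.2.
  by rewrite eC !count_cat !count_nseq /= eqxx !count_crow_out; nlia.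
have nr := red_norun sA sB rAB.
have f1 E hE := @eps_formula R A B E p sR sA sB gA gB nr hE hp.
split=> [E hE|A' B' b c E es].
  by rewrite teps_cons // ep cA cB; apply: esym (f1 _ hE).
have [eR2 rR' loc] := estep_local sR sA sB rRAB es hp.
have szA := estep_sizeA sA sB rAB es; have szB := estep_sizeB sB es.
have E0 := es_pos es; have fE := f1 _ (es_eps es); rewrite -/r1 -/r2 in fE loc eR2.
have [sA' sB'] := (es_sA' es, es_sB' es).
have [gAB' _ _] := rins_celt (p := [::]) sR rR'; move: gAB'; rewrite gins_cat => /andP[gA' gB'].
have sr1' := rins_srt sR gA'.
have [z1' z2'] := (rins_size sR gA', rins_size sr1' gB').
have [q1' q2'] := (bumped_le_size R A', bumped_le_size (rins R A').1 B').
have ne' : flatten (F1 ++ A' :: B' :: F2) != [::].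
  by rewrite -size_eq0 flatten_pair !size_cat !addn_eq0 szA /= andbF.
rewrite (nQ_cons ne') fpass_cat /= -/R eR2.
have eC' := crow_pair F1 A' B' F2; rewrite -/R eR2 in eC'.
rewrite tab_e_cons // cA ep -/p; move: loc; case: ltnP => lt.
  (* Each of the two factors changes its size together with its bumped part, so the bottom row of Q
     stays the same. *)
  move=> [b' [c' es']]; rewrite (IH2 _ _ _ _ _ es') /=.
  have [h1 h2] := (estep_sizeA sAh sBh rh es', estep_sizeB sBh es').
  congr (Some (_ :: _)); rewrite eC eC'; congr (_ ++ nseq _ _ ++ nseq _ _ ++ _); nlia.
move=> [h1 h2]; rewrite h1 h2.
(* The bumped pair is unchanged, so the cell lost by [B] and gained by [A] lies in the bottom row,
   where one label [i+1] becomes [i]. *)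
have cB0 : 0 < size B - size r2.2 by rewrite fE in E0; nlia.
have inr : (size F1).+2 \in crow 1 [::] (F1 ++ A :: B :: F2).
  by rewrite -has_pred1 has_count cB.
rewrite inr; congr (Some (_ :: _)); apply/esym; apply: row_e_unique => //; try exact: crow_sorted.
rewrite h1 in z1' q1'; rewrite h2 in z2' q2'.
move=> k; rewrite eC eC' !count_cat !count_nseq /= eR2 in z2' *.
rewrite !(eq_sym k).
have w1 : size (rins R A').1 - size R = (size r1.1 - size R).+1 by nlia.
have w2 : size r2.1 - size r1.1 = (size r2.1 - size (rins R A').1).+1 by nlia.
by rewrite w1 w2; do 2 case: (_ == k); rewrite ?mul1n ?mul0n; nlia.
Qed.

(** * Recovering the factors from P and Q *)

Lemma fpass_inj F G : all (fun A => srt A) F -> all (fun A => srt A) G ->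
  gins [::] (flatten F) -> gins [::] (flatten G) -> size F = size G ->
  fpass [::] F = fpass [::] G -> crow 1 [::] F = crow 1 [::] G -> F = G.
Proof.
elim/last_ind: F G => [|F A IH] G; first by case: G.
case/lastP: G => [|G B]; first by rewrite size_rcons.
rewrite !size_rcons -!cats1 !all_cat /= !andbT => /andP[sF sA] /andP[sG sB].
rewrite !flatten_cat /= !cats0 !gins_cat => /andP[gF gA] /andP[gG gB] [sz].
rewrite !fpass_cat /= !cats1 => -[er /rcons_inj[eF eb]].
rewrite -!cats1 !crow_cat /= !cats0 sz => ec.
have [e1 _] := fpass_rins [::] F; have [e2 _] := fpass_rins [::] G.
rewrite -e1 in gA; rewrite -e2 in gB.
have sR : srt (fpass [::] F).1 by rewrite e1; apply: rins_srt.
have sS : srt (fpass [::] G).1 by rewrite e2; apply: rins_srt.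
(* The number of cells with the last label gives the size of the row before the last factor, as
   [rins_inj] requires. *)
have szR : size (fpass [::] F).1 = size (fpass [::] G).1.
  have := congr1 (count_mem (1 + size G)) ec; rewrite !count_cat !count_nseq /= eqxx !mul1n.
  rewrite !count_crow_out ?sz; try lia.
  have := rins_size_ge (fpass [::] F).1 A; have := rins_size_ge (fpass [::] G).1 B.
  by rewrite er; nlia.
have [eR eA] := @rins_inj (fpass [::] F).1 (fpass [::] G).1 A B sR sS sA sB gA gB
  (eq_trans (surjective_pairing _) (eq_trans (f_equal2 pair er eb) (esym (surjective_pairing _)))) szR.
rewrite eA; congr (_ ++ _); apply: IH => //.
  by rewrite [LHS]surjective_pairing [RHS]surjective_pairing eR eF.
have : size (crow 1 [::] F) = size (crow 1 [::] G) by rewrite !crow_size szR.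
by move=> szc; have /eqP := ec; rewrite eqseq_cat // => /andP[/eqP].
Qed.

Lemma tins_nil_eq u : (tins [::] u == [::]) = (u == [::]).
Proof. by case: u => // a u; rewrite tins_nil. Qed.

Lemma nPQ_inj F G : facts F -> facts G -> size F = size G ->
  nP F = nP G -> nQ F = nQ G -> F = G.
Proof.
have [N] := ubnP (size (flatten F)); elim: N F G => // N IH F G sz fF fG eS eP eQ.
have [e|ne] := eqVneq (flatten F) [::].
  have eG : flatten G = [::].
    by apply/eqP; rewrite -tins_nil_eq -/(nP G) -eP /nP e.
  have al (H : seq (seq nat)) : flatten H = [::] -> H = nseq (size H) [::].
    by elim: H => [//|[|c C] H IHH] //= /IHH {1}->.
  by rewrite (al _ e) (al _ eG) eS.
have neG : flatten G != [::].
  by rewrite -tins_nil_eq -/(nP G) -eP /nP tins_nil_eq.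
rewrite (nP_cons ne) (nP_cons neG) in eP; rewrite (nQ_cons ne) (nQ_cons neG) in eQ.
case: eP => eR eP; case: eQ => eC eQ.
have eF : (fpass [::] F).2 = (fpass [::] G).2.
  apply: IH => //; try exact: facts_fpass0; last by rewrite !fpass_size.
  by have := fpass_shrinks fF ne; lia.
apply: fpass_inj => //; try exact: facts_gins.
- by case/andP: fF.
- by case/andP: fG.
by rewrite [LHS]surjective_pairing [RHS]surjective_pairing eR eF.
Qed.

End Factors.

End Insertion.

(** * Affine factorizations as sequences of factors *)

Section Link.
Variables (n : nat) (x : 'I_n).
Notation okw := (okw n).
Notation red := (red x).
Notation celt := (celt x).
Notation ltr := (ltr x).
Notation facts := (facts x).
Notation xrank := (xrank x).

Definition nasc (A : {set 'I_n}) := [seq xrank a | a <- xsort x (enum A)].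

Lemma map_xsort s : [seq xrank a | a <- xsort x s] = sort leq [seq xrank a | a <- s].
Proof. by rewrite sort_map. Qed.

Lemma nasc_srt (A : {set 'I_n}) : srt (nasc A).
Proof.
rewrite /nasc map_xsort ltn_sorted_uniq_leq sort_uniq map_inj_uniq ?enum_uniq //.
  by rewrite sort_sorted //; apply: leq_total.
exact: xrank_inj.
Qed.

Lemma mem_nasc (A : {set 'I_n}) k : k < n -> (k \in nasc A) = (ltr k \in A).
Proof.
move=> kn; apply/mapP/idP => [[a]|kA].
  by rewrite mem_sort mem_enum => aA ->; rewrite xrankK.
by exists (ltr k); rewrite ?mem_sort ?mem_enum // ltrK.
Qed.

Lemma mem_nasc_rank (A : {set 'I_n}) a : (xrank a \in nasc A) = (a \in A).
Proof. by rewrite mem_nasc ?xrank_lt // xrankK. Qed.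

Lemma map_ltr_nasc (A : {set 'I_n}) : [seq ltr k | k <- nasc A] = xsort x (enum A).
Proof. by rewrite /nasc -map_comp map_id_in // => a _ /=; rewrite xrankK. Qed.

Lemma size_nasc (A : {set 'I_n}) : size (nasc A) = #|A|.
Proof. by rewrite size_map size_sort cardE. Qed.

Lemma nasc_ok (A : {set 'I_n}) : x \notin A -> okw (nasc A).
Proof.
move=> xA; apply/allP => k /mapP[a]; rewrite mem_sort mem_enum => aA -> /=.
by rewrite -xrank_ne; apply: contraNneq xA => <-.
Qed.

Definition cset (A : seq nat) : {set 'I_n} := [set a | xrank a \in A]%SET.

Lemma csetK (A : {set 'I_n}) : cset (nasc A) = A.
Proof. by apply/setP => a; rewrite inE mem_nasc_rank. Qed.

Lemma nascK A : srt A -> okw A -> nasc (cset A) = A.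
Proof.
move=> sA oA; apply: srt_eq => //; first exact: nasc_srt.
move=> k; have [kn|kn] := ltnP k n; first by rewrite mem_nasc // inE ltrK.
apply/idP/idP => [/mapP[a _ e]|/(allP oA) /=]; last by lia.
by have := xrank_lt x a; rewrite -e; lia.
Qed.

Lemma cset_ok A : okw A -> x \notin cset A.
Proof. by move=> oA; rewrite inE xrank_x; apply/negP => /(allP oA) /=; rewrite ltnn. Qed.

Lemma celt_nasc (A : {set 'I_n}) : celt (nasc A) = word_elt (rev (xsort x (enum A))).
Proof. by rewrite /celt map_rev map_ltr_nasc. Qed.

(** In a set avoiding [x] the letters [ord_pred j] and [j] have consecutive positions, so the
    decreasing word reads [j] first. *)
Lemma cyc_dec_desc (A : {set 'I_n}) : x \notin A -> cyc_dec_word (rev (xsort x (enum A))).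
Proof.
move=> xA; split; first by rewrite rev_uniq sort_uniq enum_uniq.
move=> j; rewrite !mem_rev !mem_sort !mem_enum => jA pA; apply/negP => lt.
have sd : sorted (fun a b => xrank b < xrank a) (rev (xsort x (enum A))).
  rewrite rev_sorted; have := nasc_srt A; rewrite /nasc sorted_map.
  by apply: sub_sorted.
have tr : transitive (fun a b => xrank b < xrank a) by move=> a b c; lia.
have := sorted_ltn_index tr sd; move/(_ (ord_pred j) j).
rewrite !mem_rev !mem_sort !mem_enum => /(_ pA jA lt).
have px : ord_pred j != x by apply: contraNneq xA => <-.
rewrite -{1}(ord_predK j) -(xrankK x (ord_pred j)) ordS_ltr.
move: px; rewrite xrank_ne => px.
by rewrite !ltrK; have := n_gt0 x; lia.
Qed.

Lemma desc_uniq (A : {set 'I_n}) : uniq (rev (xsort x (enum A))).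
Proof. by rewrite rev_uniq sort_uniq enum_uniq. Qed.

Lemma con_desc (A : {set 'I_n}) : con (word_elt (rev (xsort x (enum A)))) = A.
Proof.
rewrite uniq_con ?desc_uniq //; apply/setP => a.
by rewrite inE mem_rev mem_sort mem_enum.
Qed.

Lemma cyc_dec_con (g : affine_sym n) u : cyc_dec_word u -> word_elt u = g ->
  con g = [set i in u]%SET /\ aff_length g = size u.
Proof. by move=> [uu _] <-; rewrite uniq_con // uniq_length. Qed.

Lemma cyc_dec_celt g : cyc_dec g -> x \notin con g -> g = celt (nasc (con g)).
Proof.
case=> u cu eu xg; rewrite celt_nasc -eu; apply: cyc_dec_word_unique => //.
  by apply: cyc_dec_desc; rewrite eu.
have [ec _] := cyc_dec_con cu eu; rewrite eu ec.
by move=> i; rewrite mem_rev mem_sort mem_enum inE.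
Qed.

Lemma cyc_eltE (A : {set 'I_n}) : x \notin A -> cyc_elt A = celt (nasc A).
Proof.
move=> xA; rewrite /cyc_elt.
have hA : [set w | cyc_dec w /\ con w = A]%classic (celt (nasc A)).
  rewrite /= celt_nasc con_desc; split=> //.
  by exists (rev (xsort x (enum A))) => //; apply: cyc_dec_desc.
have [cw ew] := xgetPex 1%g (ex_intro _ _ hA).
rewrite -/(xget _ _) in cw ew *.
by rewrite (cyc_dec_celt cw) ?ew.
Qed.

Lemma cyc_elt_spec (A : {set 'I_n}) : x \notin A ->
  [/\ cyc_dec (cyc_elt A), con (cyc_elt A) = A & aff_length (cyc_elt A) = #|A|].
Proof.
move=> xA; rewrite cyc_eltE // celt_nasc con_desc uniq_length ?desc_uniq //.
rewrite size_rev size_sort cardE; split=> //.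
by exists (rev (xsort x (enum A))) => //; apply: cyc_dec_desc.
Qed.

Definition toF (f : seq (affine_sym n)) := [seq nasc (con g) | g <- f].
Definition ofF F : seq (affine_sym n) := [seq cyc_elt (cset A) | A <- F].

Lemma celt_flatten F : celt (flatten F) = (\big[*%g/1%g]_(A <- rev F) celt A)%g.
Proof.
elim: F => [|A F IH]; first by rewrite big_nil celt_nil.
by rewrite /= celt_cat IH rev_cons -cats1 big_cat big_seq1.
Qed.

Lemma ofF_fact F : facts F -> affine_factorization (celt (flatten F)) (size F) (ofF F).
Proof.
move=> /andP[sF rF].
have okF A : A \in F -> okw A.
  move=> AF; apply/allP => k kA; apply: (allP (red_ok rF)).
  by apply/flattenP; exists A.
split.
- by rewrite size_map.
- by move=> g /mapP[A /okF oA ->]; have [] := cyc_elt_spec (cset_ok oA).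
- rewrite celt_flatten -map_rev big_map big_seq [RHS]big_seq; apply: eq_bigr => A.
  by rewrite mem_rev => AF; rewrite cyc_eltE ?cset_ok ?okF // nascK ?okF // (allP sF).
- move: rF => /andP[_ /eqP ->]; rewrite size_flatten /shape -map_comp; congr sumn.
  apply/eq_in_map => A AF /=; have [_ _ ->] := cyc_elt_spec (cset_ok (okF _ AF)).
  by rewrite -size_nasc nascK ?okF // (allP sF).
Qed.

Lemma toF_ofF F : facts F -> toF (ofF F) = F.
Proof.
move=> /andP[sF rF]; rewrite /toF /ofF -map_comp map_id_in // => A AF /=.
have oA : okw A.
  apply/allP => k kA; apply: (allP (red_ok rF)).
  by apply/flattenP; exists A.
have [_ -> _] := cyc_elt_spec (cset_ok oA).
by rewrite nascK // (allP sF).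
Qed.

Section Fact.
Variables (w : affine_sym n) (m : nat) (f : seq (affine_sym n)).
Hypotheses (pw : parabolic x w) (ff : affine_factorization w m f).

Definition cycw (g : affine_sym n) : seq 'I_n :=
  xget [::] [set u | cyc_dec_word u /\ word_elt u = g]%classic.

Lemma cycwP g : g \in f -> cyc_dec_word (cycw g) /\ word_elt (cycw g) = g.
Proof.
move=> gf; have [_ cd _ _] := ff; have [u cu eu] := cd _ gf.
exact: (xgetPex [::] (ex_intro _ u (conj cu eu) : exists u, [set u | _]%classic u)).
Qed.

(** Since lengths add up, words of the factors concatenate to a reduced word of [w]; by
    [reduced_avoids] it does not contain [x]. *)
Lemma fact_avoids g : g \in f -> x \notin con g.
Proof.
move=> gf; have [sf cd ew el] := ff; have [u0 xu0 eu0] := pw.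
pose W := flatten [seq cycw h | h <- rev f].
have eW : word_elt W = w.
  rewrite -ew /W; have : {subset rev f <= f} by move=> h; rewrite mem_rev.
  elim: (rev f) => [|h s IH] sub; first by rewrite /= big_nil word_elt_nil.
  rewrite /= word_elt_cat big_cons IH; last by move=> k ks; apply: sub; rewrite inE ks orbT.
  by have [_ ->] := cycwP (sub h (mem_head _ _)).
have sW : size W = aff_length (word_elt W).
  rewrite eW -el size_flatten /shape -map_comp map_rev sumn_rev; congr sumn.
  apply/eq_in_map => h hf /=; have [c1 c2] := cycwP hf.
  by have [_ ->] := cyc_dec_con c1 c2.
have xW : x \notin W by apply: (reduced_avoids xu0) => //; rewrite eW.
have [c1 c2] := cycwP gf; have [-> _] := cyc_dec_con c1 c2; rewrite inE.
apply: contra xW => xg; apply/flattenP; exists (cycw g) => //.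
by apply/mapP; exists g; rewrite ?mem_rev.
Qed.

Lemma fact_celt g : g \in f -> g = celt (nasc (con g)).
Proof.
by move=> gf; have [_ cd _ _] := ff; apply: cyc_dec_celt; [apply: cd|apply: fact_avoids].
Qed.

Lemma fact_length g : g \in f -> aff_length g = size (nasc (con g)).
Proof.
move=> gf; have [c1 c2] := cycwP gf; have [ec ->] := cyc_dec_con c1 c2.
rewrite size_nasc ec cardsE; apply/esym/card_uniqP; by case: c1.
Qed.

Lemma toF_celt : celt (flatten (toF f)) = w.
Proof.
have [_ _ <- _] := ff; rewrite celt_flatten -map_rev big_map big_seq [RHS]big_seq.
by apply: eq_bigr => g; rewrite mem_rev => /fact_celt <-.
Qed.

Lemma toF_facts : facts (toF f).
Proof.
have [_ _ _ el] := ff; apply/andP; split.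
  by apply/allP => A /mapP[g _ ->]; apply: nasc_srt.
apply/andP; split.
  apply/allP => k /flattenP[A /mapP[g gf ->] kA].
  exact: (allP (nasc_ok (fact_avoids gf))).
rewrite toF_celt -el size_flatten /shape -map_comp; apply/eqP; congr sumn.
by apply/eq_in_map => g gf /=; rewrite fact_length.
Qed.

Lemma size_toF : size (toF f) = m.
Proof. by rewrite size_map; case: ff. Qed.

Lemma ofF_toF : ofF (toF f) = f.
Proof.
rewrite /ofF /toF -map_comp map_id_in // => g gf /=.
by rewrite csetK cyc_eltE ?fact_avoids // -fact_celt.
Qed.

Lemma toF_weight : fact_weight f = map size (toF f).
Proof. by rewrite /fact_weight /toF -map_comp; apply/eq_in_map => g gf; rewrite fact_length. Qed.

End Fact.

(** * Edelman-Greene insertion in terms of positions *)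

Lemma eg_row_ltr a R : srt R -> okw (a :: R) ->
  eg_row x (ltr a) [seq ltr k | k <- R] =
  ([seq ltr k | k <- (nrow a R).1], omap ltr (nrow a R).2).
Proof.
move=> sR /= /andP[an /allP oR]; have n0 := n_gt0 x.
have aN : a < n by lia.
have okR k : k \in R -> k < n by move=> /oR /=; lia.
have ef : [seq b <- [seq ltr k | k <- R] | xlt x (ltr a) b] = [seq ltr k | k <- R & a < k].
  rewrite filter_map; congr map; apply: eq_in_filter => k kR.
  by rewrite /= /xlt (ltrK x aN) (ltrK x (okR _ kR)).
have em : xmin x [seq b <- [seq ltr k | k <- R] | xlt x (ltr a) b] =
    omap ltr (ohead [seq k <- R | a < k]).
  rewrite ef /xmin /xsort sorted_sort; first by case: [seq k <- R | a < k].
    by move=> b c d; rewrite /xle; lia.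
  rewrite sorted_map; have sF : srt [seq k <- R | a < k] by apply: sorted_filter => //; apply: ltn_trans.
  apply: (sub_in_sorted (P := mem R)) sF => [k l kR lR /= kl|].
    by rewrite /xle !ltrK ?okR //; lia.
  by apply/allP => k; rewrite mem_filter => /andP[].
have memR k : k < n -> (ltr k \in [seq ltr k | k <- R]) = (k \in R).
  move=> kn; apply/mapP/idP => [[l lR /eqP]|kR]; last by exists k.
  by rewrite (ltr_eq x kn (okR _ lR)) => /eqP->.
rewrite /eg_row em /nrow; case e : [seq k <- R | a < k] => [|b R2] /=.
  by rewrite map_rcons.
have bR : b \in R by have : b \in [seq k <- R | a < k] by [rewrite e inE eqxx]; rewrite mem_filter => /andP[].
(* As [a] is not the position of [x], its successor does not wrap around to position 0. *)
have a1n : a.+1 < n by lia.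
rewrite ordS_ltr (ltr_eq x (okR _ bR) a1n) (memR _ aN).
case: ifP => // [/andP[/eqP-> _] //|_] /=; congr pair.
have eR := srt_split a sR; rewrite e in eR.
rewrite [X in set_nth _ (map _ X)]eR [X in index _ (map _ X)]eR map_cat /= index_cat.
have -> : (ltr b \in [seq ltr i | i <- [seq r <- R | r <= a]]) = false.
  apply/negP => /mapP[l]; rewrite mem_filter => /andP[la lR] /eqP.
  rewrite (ltr_eq x (okR _ bR) (okR _ lR)) => /eqP bl.
  have : b \in [seq k <- R | a < k] by rewrite e inE eqxx.
  by rewrite mem_filter; lia.
rewrite /= eqxx addn0 size_map map_cat /=.
elim: [seq r <- R | r <= a] => //= k s IH; congr cons.
by move: IH; rewrite size_map || idtac.
Qed.

Fixpoint eg_rins (R u : seq 'I_n) : seq 'I_n * seq 'I_n :=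
  if u is a :: u' then
    let ro := eg_row x a R in let rv := eg_rins ro.1 u' in
    (rv.1, (if ro.2 is Some b then [:: b] else [::]) ++ rv.2)
  else (R, [::]).

Lemma eg_insert_row R P u : foldl (fun P a => eg_insert x a P) (R :: P) u =
  (eg_rins R u).1 :: foldl (fun P a => eg_insert x a P) P (eg_rins R u).2.
Proof.
elim: u R P => //= a u IH R P; case: (eg_row x a R) => R' o /=; rewrite IH.
by case: o.
Qed.

Lemma eg_rins_ltr R u : srt R -> okw (R ++ u) -> gins R u ->
  eg_rins [seq ltr k | k <- R] [seq ltr k | k <- u] =
  ([seq ltr k | k <- (rins R u).1], [seq ltr k | k <- (rins R u).2]).
Proof.
elim: u R => //= a u IH R sR; rewrite okw_cat /= => /and3P[oR oa ou] /andP[g gu].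
have oaR : okw (R ++ [:: a]) by rewrite okw_cat oR /= oa.
have [o1 _ _] := nrow_celt x sR oaR g.
rewrite eg_row_ltr //=; last by rewrite oa oR.
rewrite IH ?nrow_srt //; last by move: o1; rewrite !okw_cat => /andP[_ ->].
by case: (nrow a R).2.
Qed.

Lemma eg_tins u : red u ->
  foldl (fun P a => eg_insert x a P) [::] [seq ltr k | k <- u] =
  [seq [seq ltr k | k <- R] | R <- tins [::] u].
Proof.
have [N] := ubnP (size u); elim: N u => // N IH u su ru.
have [->//|ne] := eqVneq u [::]; rewrite tins_nil //.
(* Once a letter is inserted, the empty tableau and the tableau with one empty row give the same
   result. *)
have -> : foldl (fun P a => eg_insert x a P) [::] [seq ltr k | k <- u] =
    foldl (fun P a => eg_insert x a P) [:: [::]] [seq ltr k | k <- u] by case: (u) ne.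
have [g r _] := rins_celt (p := [::]) (R := [::]) isT ru.
rewrite eg_insert_row (@eg_rins_ltr [::]) //=; last by apply: (red_ok ru).
congr cons; apply: IH; last by move: r => /= /red_infixr.
have := rins_size (isT : srt [::]) g.
have : 0 < size (rins [::] u).1.
  by case: (u) ne => //= a v _; apply: leq_trans (rins_size_ge _ _).
rewrite /=; nlia.
Qed.

Lemma eg_PE w m f i : parabolic x w -> affine_factorization w m f ->
  eg_P x f i = [seq [seq ltr k | k <- R] | R <- nP (take i (toF f))].
Proof.
move=> pw ff; rewrite /eg_P /nP -eg_tins; last first.
  by have /(facts_take i)/andP[] := toF_facts pw ff.
rewrite /toF -map_take; elim: (take i f) [::] => //= g s IH P.
by rewrite map_cat foldl_cat map_ltr_nasc -IH.
Qed.

Lemma eg_QE w m f : parabolic x w -> affine_factorization w m f ->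
  eg_Q x f = nQ (toF f).
Proof.
move=> pw ff; rewrite /eg_Q /nQ size_map; congr foldl.
apply/funext => Q; apply/funext => i; congr fill_cells.
rewrite (eg_PE i pw ff) /tab_shape -map_comp; apply: eq_map => R /=.
by rewrite size_map.
Qed.

End Link.

(** * The pairing of two factors *)

Section Pairing.
Variables (n : nat) (x : 'I_n).
Notation okw := (okw n).
Notation red := (red x).
Notation celt := (celt x).
Notation ltr := (ltr x).
Notation facts := (facts x).
Notation xrank := (xrank x).
Notation nasc := (nasc x).
Notation cset := (cset x).
Notation toF := (toF x).
Notation ofF := (ofF x).
Notation ranks := (map xrank).
Implicit Types (s bs av : seq 'I_n) (a b : 'I_n).

Lemma xsort_sorted s : sorted leq (ranks (xsort x s)).
Proof. by rewrite map_xsort sort_sorted //; apply: leq_total. Qed.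

Lemma xmin_eq s b : b \in s -> (forall c, c \in s -> xrank b <= xrank c) -> xmin x s = Some b.
Proof.
move=> bs hb; rewrite /xmin; have := xsort_sorted s.
have ms c : (c \in xsort x s) = (c \in s) by rewrite mem_sort.
case: (xsort x s) ms => [|c t] ms; first by have := ms b; rewrite bs.
rewrite /= => p; congr Some; apply: (@xrank_inj _ x).
apply/eqP; rewrite eqn_leq hb -?ms ?mem_head // andbT.
have : b \in c :: t by rewrite ms.
rewrite inE => /predU1P[->//|bt].
by apply: (allP (order_path_min leq_trans p)); apply: map_f.
Qed.

Lemma xmax_eq s b : b \in s -> (forall c, c \in s -> xrank c <= xrank b) -> xmax x s = Some b.
Proof.
move=> bs hb; rewrite /xmax; have := xsort_sorted s.
have ms c : (c \in xsort x s) = (c \in s) by rewrite mem_sort.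
case/lastP: (xsort x s) ms => [|t c] ms; first by have := ms b; rewrite bs.
rewrite rev_rcons /= map_rcons -cats1 sorted_leq_cat => /and3P[_ _ h]; congr Some.
apply: (@xrank_inj _ x); apply/eqP; rewrite eqn_leq hb -?ms ?mem_rcons ?mem_head //=.
have : b \in rcons t c by rewrite ms.
rewrite mem_rcons inE => /predU1P[->//|bt].
by have /= /andP[] := allP h _ (map_f xrank bt).
Qed.

Lemma max_ex s : s != [::] -> exists2 a, a \in s & forall c, c \in s -> xrank c <= xrank a.
Proof.
elim: s => // b s IH _; have [->|/IH[a as_ ha]] := eqVneq s [::].
  by exists b => [|c]; rewrite inE // => /eqP->.
have [le|lt] := leqP (xrank b) (xrank a).
  by exists a => [|c]; rewrite inE ?as_ ?orbT // => /predU1P[->//|/ha].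
by exists b => [|c]; rewrite inE ?eqxx // => /predU1P[->//|/ha]; lia.
Qed.

Lemma min_ex s : s != [::] -> exists2 a, a \in s & forall c, c \in s -> xrank a <= xrank c.
Proof.
elim: s => // b s IH _; have [->|/IH[a as_ ha]] := eqVneq s [::].
  by exists b => [|c]; rewrite inE // => /eqP->.
have [le|lt] := leqP (xrank a) (xrank b).
  by exists a => [|c]; rewrite inE ?as_ ?orbT // => /predU1P[->//|/ha].
by exists b => [|c]; rewrite inE ?eqxx // => /predU1P[->//|/ha]; lia.
Qed.

(** Consider the difference of counts at [t]. An unpaired [b] has no available letter above it and
    adds one to all differences up to [b]. Pairing [b] with [a] keeps these differences and lowers
    only those strictly between [b] and [a], which are not positive anyway. *)
Lemma pairing_recP bs av : sorted gtn (ranks bs) -> uniq av ->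
  let L := (pairing_rec x bs av).1 in let R := (pairing_rec x bs av).2 in
  let E := size L in
  [/\ is_eps (ranks av) (ranks bs) E, size R + size bs = E + size av,
      L != [::] -> exists b, [/\ xmin x L = Some b, b \in bs,
        cnt (ranks bs) (xrank b) = E + cnt (ranks av) (xrank b).+1
      & forall t, xrank b < t -> cnt (ranks bs) t < E + cnt (ranks av) t.+1],
      {subset L <= bs} /\ {subset R <= av}
    & R != [::] -> exists a, [/\ xmax x R = Some a, a \in R,
        cnt (ranks bs) (xrank a) = E + cnt (ranks av) (xrank a).+1
      & forall t, t < xrank a -> cnt (ranks bs) t < E + cnt (ranks av) t.+1]].
Proof.
have gt_trans : transitive gtn by move=> a b c /=; lia.
elim: bs av => [|b bs IH] av sb ua.
  split=> //=.
  - split=> [t|]; first by rewrite cnt_nil.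
    have [T hT] := cnt_ubound (ranks av); exists T; rewrite cnt_nil cnt_eq0 // => c /hT; lia.
  - by rewrite addn0.
  - by split.
  - move=> /max_ex[a aA ha]; exists a; split=> //.
    + exact: xmax_eq.
    + by rewrite cnt_nil cnt_eq0 // => c /mapP[d /ha + ->]; lia.
    + move=> t ta; rewrite cnt_nil /= -has_count; apply/hasP; exists (xrank a) => //.
      exact: map_f.
have sb' : sorted gtn (ranks bs) by apply: path_sorted sb.
have ltb : forall c, c \in bs -> xrank c < xrank b.
  by move=> c cb; apply: (allP (order_path_min gt_trans sb)); apply: map_f.
have cb0 t : xrank b <= t -> cnt (ranks bs) t = 0.
  by move=> bt; apply: cnt_eq0 => c /mapP[d /ltb + ->]; lia.
have [e|ne] := eqVneq [seq a <- av | xlt x b a] [::].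
  have av_le c : c \in av -> xrank c <= xrank b.
    move=> cav; rewrite leqNgt; apply/negP => lt.
    by have : c \in [seq a <- av | xlt x b a] by [rewrite mem_filter cav andbT]; rewrite e.
  have ca0 t : xrank b < t -> cnt (ranks av) t = 0.
    by move=> bt; apply: cnt_eq0 => c /mapP[d /av_le + ->]; lia.
  have {IH} [[h1 [t0 h2]] h3 h4 [h5 h5'] h6] := IH av sb' ua.
  have em : xmin x [seq a <- av | xlt x b a] = None by rewrite e.
  rewrite /= em /=.
  set L := (pairing_rec x bs av).1 in h1 h2 h3 h4 h5 h6 *.
  set R := (pairing_rec x bs av).2 in h3 h5' h6 *.
  split=> //.
  - split=> [t|]; rewrite ?cnt_cons.
      by have := h1 t; case: (leqP t (xrank b)) => [|lt]; [nlia|rewrite cb0 ?(ltnW lt) //; nlia].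
    have [le|lt] := leqP t0 (xrank b); first by exists t0; rewrite cnt_cons le; nlia.
    (* A maximizer above [b] means that no other letter stays unpaired; then [b] itself attains the
       value 1. *)
    exists (xrank b); rewrite cnt_cons leqnn cb0 // ca0 //.
    by move: h2; rewrite cb0 ?(ltnW lt) //; nlia.
  - by rewrite /= in h3 *; nlia.
  - move=> _; have [e0|ne0] := eqVneq L [::].
      exists b; split; rewrite ?e0 ?mem_head //=.
      + by rewrite cnt_cons leqnn cb0 // ca0.
      + by move=> t bt; rewrite cnt_cons cb0 ?(ltnW bt) // [t <= _]leqNgt bt.
    have [c [k1 k2 k3 k4]] := h4 ne0; have cb := ltb _ k2.
    exists c; split.
    + apply: xmin_eq.
        rewrite inE; apply/orP; right; move: k1; rewrite /xmin.
        have ms d : (d \in xsort x L) = (d \in L) by rewrite mem_sort.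
        by case: (xsort x L) ms => //= d l ms [<-]; rewrite -ms mem_head.
      have [d dL hd] := min_ex ne0; have := xmin_eq dL hd; rewrite k1 => -[->].
      by move=> c'; rewrite inE => /predU1P[->|/hd//]; apply: ltnW; apply: ltb; apply: h5.
    + by rewrite inE k2 orbT.
    + by rewrite cnt_cons (ltnW cb); nlia.
    + move=> t ct; rewrite cnt_cons; have := k4 t ct.
      by case: (leqP t (xrank b)); nlia.
  - by split=> // c; rewrite !inE => /predU1P[->|/h5 ->]; rewrite ?eqxx ?orbT.
  - move=> /h6[a [k1 k2 k3 k4]]; have ab := av_le _ (h5' _ k2); exists a; split=> //.
    + by rewrite cnt_cons ab; nlia.
    + by move=> t ta; rewrite cnt_cons; have := k4 t ta; case: (leqP t (xrank b)); nlia.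
have [a aF ha] := min_ex ne.
have em := xmin_eq aF ha; move: (aF); rewrite mem_filter /xlt => /andP[ba aav].
have mina c : c \in av -> xrank b < xrank c -> xrank a <= xrank c.
  by move=> cav bc; apply: ha; rewrite mem_filter cav andbT.
have ua' : uniq (rem a av) by apply: rem_uniq.
have cav t : cnt (ranks av) t = (t <= xrank a) + cnt (ranks (rem a av)) t.
  rewrite -cnt_cons; have := perm_map xrank (perm_to_rem aav).
  by move/permP/(_ (leq t)).
have sav : size av = (size (rem a av)).+1 by rewrite size_rem // prednK //; case: (av) aav.
have {IH} [[h1 [t0 h2]] h3 h4 [h5 h5'] h6] := IH (rem a av) sb' ua'.
rewrite /= em.
set L := (pairing_rec x bs (rem a av)).1 in h1 h2 h3 h4 h5 h6 *.
set R := (pairing_rec x bs (rem a av)).2 in h3 h5' h6 *.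
split=> //.
- split=> [t|].
    rewrite cnt_cons cav; have := h1 t; case: (leqP t (xrank b)); case: (leqP t.+1 (xrank a)); nlia.
  have [le|lt] := leqP t0 (xrank b).
    by exists t0; rewrite cnt_cons cav le (leq_ltn_trans le ba); nlia.
  have [le'|lt'] := leqP (xrank a) t0.
    by exists t0; rewrite cnt_cons cav leqNgt lt ltnNge le' /=; nlia.
  (* The maximizer lies strictly between [b] and [a], which forces the value 0; a threshold above
     all letters attains it. *)
  have E0 : size L = 0 by move: h2; rewrite cb0 ?(ltnW lt) //; nlia.
  have [T hT] := cnt_ubound (ranks av ++ ranks (b :: bs)); exists T.
  rewrite E0 !cnt_eq0 // => c cc; have := hT c; rewrite mem_cat cc ?orbT => /(_ isT); nlia.
- by rewrite /= sav !addnS h3.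
- move=> /h4[c [k1 k2 k3 k4]]; have cb := ltb _ k2; exists c; split=> //.
  + by rewrite inE k2 orbT.
  + by rewrite cnt_cons cav (ltnW cb) (ltn_trans cb ba); nlia.
  + move=> t ct; rewrite cnt_cons cav; have := k4 t ct.
    by case: (leqP t (xrank b)); case: (leqP t.+1 (xrank a)); nlia.
- split=> c; first by move/h5; rewrite inE orbC => ->.
  by move/h5'; apply: mem_rem.
- move=> /h6[c [k1 k2 k3 k4]]; exists c; split=> //.
    rewrite cnt_cons cav.
    have [le|lt] := leqP (xrank c) (xrank b); first by rewrite (leq_ltn_trans le ba); nlia.
    have := mina _ (mem_rem (h5' _ k2)) lt; rewrite ltnNge => ->; nlia.
  move=> t ct; rewrite cnt_cons cav; have := k4 t ct.
  by case: (leqP t (xrank b)); case: (leqP t.+1 (xrank a)); nlia.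
Qed.

Lemma pairingP (B A : {set 'I_n}) (L := (pairing x B A).1) (R := (pairing x B A).2) :
  let E := size L in
  [/\ is_eps (nasc A) (nasc B) E, size R + #|B| = E + #|A|,
      L != [::] -> exists b, [/\ xmin x L = Some b, b \in B,
        cnt (nasc B) (xrank b) = E + cnt (nasc A) (xrank b).+1
      & forall t, xrank b < t -> cnt (nasc B) t < E + cnt (nasc A) t.+1]
    & R != [::] -> exists a, [/\ xmax x R = Some a, a \in A,
        cnt (nasc B) (xrank a) = E + cnt (nasc A) (xrank a).+1
      & forall t, t < xrank a -> cnt (nasc B) t < E + cnt (nasc A) t.+1]].
Proof.
have sb : sorted gtn (ranks (rev (xsort x (enum B)))).
  by rewrite map_rev rev_sorted; apply: nasc_srt.
have [[h1 h2] h3 h4 [_ h5] h6] := pairing_recP sb (enum_uniq A).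
have eB t : cnt (ranks (rev (xsort x (enum B)))) t = cnt (nasc B) t.
  by rewrite map_rev /cnt count_rev.
have eA t : cnt (ranks (enum A)) t = cnt (nasc A) t.
  by rewrite /nasc map_xsort /cnt count_sort.
split.
- split=> [t|]; first by have := h1 t; rewrite eB eA.
  by have [t] := h2; rewrite eB eA; exists t.
- by move: h3; rewrite size_rev size_sort -!cardE.
- move=> /h4[b [k1 k2 k3 k4]]; exists b; split=> //.
  + by move: k2; rewrite mem_rev mem_sort mem_enum.
  + by rewrite -eB -eA.
  + by move=> t /k4; rewrite eB eA.
- move=> /h6[a [k1 k2 k3 k4]]; exists a; split=> //.
  + by move: (h5 _ k2); rewrite mem_enum.
  + by rewrite -eB -eA.
  + by move=> t /k4; rewrite eB eA.
Qed.

(** * The operators on factorizations in terms of positions *)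

Lemma ord_pred_ltr k : ord_pred (ltr k.+1) = ltr k.
Proof. by rewrite -ordS_ltr ordSK. Qed.

Lemma iter_pred_ltr i k : i <= k -> iter i (@ord_pred n) (ltr k) = ltr (k - i).
Proof.
elim: i => [|i IH] ik; first by rewrite subn0.
rewrite iterS IH ?(ltnW ik) //; have -> : k - i = (k - i.+1).+1 by lia.
by rewrite ord_pred_ltr.
Qed.

Lemma iter_succ_ltr i k : iter i (@ordS n) (ltr k) = ltr (k + i).
Proof. by elim: i => [|i IH]; rewrite ?addn0 // iterS IH ordS_ltr addnS. Qed.

Lemma ord_pred_ltr0 : ord_pred (ltr 0) = x.
Proof.
have -> : ltr 0 = ordS x; last by rewrite ordSK.
rewrite -{2}(ltr_last x) ordS_ltr prednK ?n_gt0 //.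
by apply: val_inj; rewrite !val_ltr add0n modnDl.
Qed.

(** The predecessor of position 0 is [x], which is not in [B], so the run ends before it could wrap
    around. *)
Lemma run_downP (B : {set 'I_n}) b : x \notin B -> b \in B ->
  exists c, [/\ iter (run_down B b) (@ord_pred n) b = ltr c, c <= xrank b,
    forall j, c <= j <= xrank b -> j \in nasc B & ~~ ((0 < c) && (c.-1 \in nasc B))].
Proof.
move=> xB bB; set k := xrank b.
have kn : k < n by apply: xrank_lt.
have kb : b = ltr k by rewrite /k xrankK.
pose P i := iter i.+1 (@ord_pred n) b \notin B.
have hasP' : has P (iota 0 n).
  apply/hasP; exists k; rewrite ?mem_iota // /P kb iterS iter_pred_ltr // subnn ord_pred_ltr0.
  exact: xB.
have i0k : run_down B b <= k.
  rewrite leqNgt; apply/negP => lt; have := before_find 0 lt.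
  by rewrite nth_iota // add0n => /negbT /negPn; rewrite kb iterS iter_pred_ltr // subnn ord_pred_ltr0 (negPf xB).
exists (k - run_down B b); split.
- by rewrite kb iter_pred_ltr // -kb.
- exact: leq_subr.
- move=> j jk; have [->|ne] := eqVneq j k; first by rewrite mem_nasc // -kb.
  have lt : (k - j).-1 < run_down B b by lia.
  have := before_find 0 lt; rewrite nth_iota; last by lia.
  rewrite add0n => /negbT /negPn; rewrite prednK; last by lia.
  rewrite kb iter_pred_ltr; last by lia.
  by rewrite subKn; [rewrite mem_nasc //; lia|lia].
- apply/negP => /andP[c0]; rewrite mem_nasc; last by lia.
  have := nth_find 0 hasP'; rewrite -/(run_down B b) nth_iota; last by lia.
  rewrite /P add0n kb iter_pred_ltr -?kb; last by lia.
  by move/negP; rewrite subnS.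
Qed.

Lemma run_upP (A : {set 'I_n}) a : x \notin A -> a \in A ->
  exists d, [/\ iter (run_up A a) (@ordS n) a = ltr d, xrank a <= d < n,
    forall j, xrank a <= j <= d -> j \in nasc A & d.+1 \notin nasc A].
Proof.
move=> xA aA; set k := xrank a.
have ka : a = ltr k by rewrite /k xrankK.
have kn : k < n.-1 by rewrite /k -xrank_ne; apply: contraNneq xA => <-.
pose P i := iter i.+1 (@ordS n) a \notin A.
have Plast : P (n.-1 - k.+1).
  by rewrite /P ka iter_succ_ltr -subSn // subSS subnKC ?(ltnW kn) // ltr_last.
have hasP' : has P (iota 0 n).
  by apply/hasP; exists (n.-1 - k.+1) => //; rewrite mem_iota; lia.
have i0 : run_up A a <= n.-1 - k.+1.
  rewrite leqNgt; apply/negP => lt; have := before_find 0 lt.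
  by rewrite nth_iota ?add0n; [rewrite -/(P _) Plast|lia].
exists (k + run_up A a); split.
- by rewrite {2}ka iter_succ_ltr.
- lia.
- move=> j jk; have [->|ne] := eqVneq j k; first by rewrite mem_nasc -?ka //; lia.
  have lt : (j - k).-1 < run_up A a by lia.
  have := before_find 0 lt; rewrite nth_iota; last by lia.
  rewrite add0n => /negbT /negPn; rewrite prednK; last by lia.
  rewrite {1}ka iter_succ_ltr subnKC; last by lia.
  by rewrite mem_nasc //; lia.
- have := nth_find 0 hasP'; rewrite -/(run_up A a) nth_iota; last by lia.
  rewrite /P add0n; have := iter_succ_ltr (run_up A a).+1 k; rewrite -ka => ->.
  by rewrite addnS mem_nasc //; lia.
Qed.

Lemma set_contents_split (f1 f2 : seq (affine_sym n)) g1 g2 (A B : {set 'I_n}) :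
  set_contents (size f1).+1 (f1 ++ g1 :: g2 :: f2) A B = f1 ++ cyc_elt B :: cyc_elt A :: f2.
Proof. by rewrite /set_contents /=; elim: f1 => //= g f1 ->. Qed.

Section Ops.
Variables (w : affine_sym n) (m : nat) (f1 f2 : seq (affine_sym n)) (g1 g2 : affine_sym n).
Let f := f1 ++ g1 :: g2 :: f2.
Let r := (size f1).+1.
Hypotheses (pw : parabolic x w) (ff : affine_factorization w m f).
Let A := nasc (con g1).
Let B := nasc (con g2).
Let F1 := toF f1.
Let F2 := toF f2.

Lemma split_toF : toF f = F1 ++ A :: B :: F2.
Proof. by rewrite /toF map_cat. Qed.

Lemma split_facts : facts (F1 ++ A :: B :: F2).
Proof. by rewrite -split_toF; apply: toF_facts ff. Qed.

Lemma split_ofF : ofF F1 = f1 /\ ofF F2 = f2.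
Proof.
have := ofF_toF pw ff; rewrite split_toF /ofF map_cat => /eqP.
rewrite eqseq_cat ?size_map // => /andP[/eqP-> /eqP[_ _ ->]].
by [].
Qed.

Lemma split_x : x \notin con g1 /\ x \notin con g2.
Proof.
by split; apply: (fact_avoids pw ff); rewrite /f mem_cat !inE eqxx ?orbT.
Qed.

Lemma factor1 : factor f r = g1.
Proof. by rewrite /factor /f /r /= nth_cat ltnn subnn. Qed.

Lemma factor2 : factor f r.+1 = g2.
Proof. by rewrite /factor /f /r /= nth_cat ltnNge leqnSn /= subSn // subnn. Qed.

Lemma fact_e_spec : exists E, is_eps A B E /\
  (E = 0 -> fact_e x r f = None) /\
  (0 < E -> exists A' B' (b c : nat), estep A B A' B' b c E /\
     fact_e x r f = Some (ofF (F1 ++ A' :: B' :: F2))).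
Proof.
have [x1 x2] := split_x; have [sA sB rAB] := facts_pair split_facts.
have [o1 o2] := split_ofF.
rewrite /fact_e /unpairedL factor1 factor2.
have [hE _ hL _] := pairingP (con g2) (con g1).
set L := (pairing x (con g2) (con g1)).1 in hE hL *.
exists (size L); split=> //; split=> [/size0nil ->//|].
rewrite lt0n size_eq0 => /hL[b [eb bB mb gb]]; rewrite eb.
have [c [ec cb run bot]] := run_downP x2 bB.
have E0 : 0 < size L by move: eb; rewrite /xmin; case: (L).
pose A' := nasc (iter (run_down (con g2) b) (@ord_pred n) b |: con g1)%SET.
pose B' := nasc (con g2 :\ b)%SET.
have cn : c < n by apply: leq_ltn_trans cb (xrank_lt x b).
have rk j : j \in nasc (con g2) -> j < n by move=> /mapP[d _ ->]; apply: xrank_lt.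
have rk1 j : j \in nasc (con g1) -> j < n by move=> /mapP[d _ ->]; apply: xrank_lt.
have es : estep A B A' B' (xrank b) c (size L).
  split=> //; try exact: nasc_srt.
  - move=> j; have [jn|jn] := ltnP j n.
      by rewrite /A' !mem_nasc // !inE ec ltr_eq.
    have nA (C : {set 'I_n}) : j \in nasc C = false.
      by apply/negP => /mapP[d _ ej]; have := xrank_lt x d; rewrite -ej ltnNge jn.
    by rewrite /A' /A !nA orbF; apply/esym/negbTE; lia.
  - move=> j; have [jn|jn] := ltnP j n.
      rewrite /B' !mem_nasc // !inE; congr (~~ _ && _).
      by rewrite -{1}(xrankK x b) ltr_eq // xrank_lt.
    have nA (C : {set 'I_n}) : j \in nasc C = false.
      by apply/negP => /mapP[d _ ej]; have := xrank_lt x d; rewrite -ej ltnNge jn.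
    by rewrite /B' /B !nA andbF.
exists A', B', (xrank b), c; split=> //.
by rewrite set_contents_split /ofF map_cat /= !csetK -/(ofF F1) -/(ofF F2) o1 o2.
Qed.

(** If f vanishes, all letters of w^r are paired, and the identity of sizes is what [tab_f_None]
    asks for. Otherwise the new pair is described as one that e takes back to the old pair. *)
Lemma fact_f_spec : exists E, is_eps A B E /\
  (fact_f x r f = None -> size A + E = size B) /\
  (forall g, fact_f x r f = Some g -> exists A' B' (d a : nat),
     [/\ estep A' B' A B d a E.+1, celt (A' ++ B') = celt (A ++ B), red (A' ++ B'),
         g = ofF (F1 ++ A' :: B' :: F2) & srt A' && srt B']).
Proof.
have [x1 x2] := split_x; have [sA sB rAB] := facts_pair split_facts.
have [o1 o2] := split_ofF.
rewrite /fact_f /unpairedR factor1 factor2.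
have [hE hs _ hR] := pairingP (con g2) (con g1).
set L := (pairing x (con g2) (con g1)).1 in hE hs hR.
set R := (pairing x (con g2) (con g1)).2 in hs hR *.
exists (size L); split=> //.
have [e0|ne] := eqVneq R [::].
  rewrite e0 /=; split=> // _; rewrite /A /B !size_nasc.
  by move: hs; rewrite e0 /= add0n addnC.
have [a [ea aA ma la]] := hR ne; rewrite ea; split=> // g [<-].
have [d [ed /andP[ad dn] run top]] := run_upP x1 aA.
pose A' := nasc (con g1 :\ a)%SET.
pose B' := nasc (iter (run_up (con g1) a) (@ordS n) a |: con g2)%SET.
have nA j (C : {set 'I_n}) : n <= j -> j \in nasc C = false.
  by move=> jn; apply/negP => /mapP[e _ ej]; have := xrank_lt x e; rewrite -ej ltnNge jn.
have mA j : (j \in A') = (j != xrank a) && (j \in A).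
  have [jn|jn] := ltnP j n; last by rewrite /A' /A !nA ?andbF.
  rewrite /A' !mem_nasc // !inE; congr (~~ _ && _).
  by rewrite -{1}(xrankK x a) ltr_eq // xrank_lt.
have mB j : (j \in B') = (j == d) || (j \in B).
  have [jn|jn] := ltnP j n; last by rewrite /B' /B !nA // orbF; apply/esym/negbTE; lia.
  by rewrite /B' !mem_nasc // !inE ed ltr_eq.
have [h1 h2 h3] := @fstep n x A B A' B' (xrank a) d (size L) sA sB rAB hE ma la ad run top
  (nasc_srt x _) (nasc_srt x _) mA mB.
exists A', B', d, (xrank a); split=> //; last by rewrite !nasc_srt.
by rewrite set_contents_split /ofF map_cat /= !csetK -/(ofF F1) -/(ofF F2) o1 o2.
Qed.

End Ops.

End Pairing.

(** * Highest weight tableaux and the expansion into Schur functions *)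

Lemma tab_cells_uniq t : uniq (tab_cells t).
Proof.
apply: allpairs_uniq_dep; first exact: iota_uniq.
  by move=> r _; apply: iota_uniq.
by move=> [r j] [r' j'] _ _ /= [-> ->].
Qed.

Lemma map_tab_cells t : map (tab_entry t) (tab_cells t) = flatten t.
Proof.
rewrite /tab_cells map_flatten -map_comp -[RHS]/(flatten (id t)); congr flatten.
rewrite -[RHS](mkseq_nth [::]) /mkseq; apply: eq_map => r /=.
by rewrite -map_comp -[RHS](mkseq_nth 0).
Qed.

Lemma count_tab_scan k t : tabl t ->
  count (fun c => tab_entry t c == k) (tab_scan t) = count_mem k (flatten t).
Proof.
move=> tt; rewrite -map_tab_cells count_map.
have /permP -> // : perm_eq (tab_scan t) (tab_cells t).
by apply: uniq_perm; [exact: tab_scan_uniq|exact: tab_cells_uniq|exact: mem_tab_scanE].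
Qed.

(** The number of unpaired [i] is the number of all [i] minus that of all [i+1], plus the string
    length. *)
Lemma tab_f_None (i : nat) t : tabl t ->
  count_mem i (flatten t) + teps i t = count_mem i.+1 (flatten t) -> tab_f i t = None.
Proof.
move=> tt; have /= := tab_pairing_count i t (tab_scan t) [::] [::].
rewrite -/(tab_unpaired i t) -/(teps i t) !count_tab_scan // => h1 h2.
by rewrite /tab_f (size0nil (_ : size (tab_unpaired i t).1 = 0)) //;
  move: h1; rewrite !addn0 -h2 [RHS]addnC -[RHS]add0n => /addIn.
Qed.

Notation bounded m := (all (all (fun a => 0 < a <= m))).

Lemma semistandard_tabl m t : semistandard m t -> tabl t /\ bounded m t.
Proof.
elim: t => [//|row T IH] [pt bd rw cl].
have mc r j : ((r.+1, j) \in tab_cells (row :: T)) = ((r, j) \in tab_cells T).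
  by rewrite !mem_tab_cells.
have m0 j : ((0, j) \in tab_cells (row :: T)) = (j < size row) by rewrite mem_tab_cells.
move: pt; rewrite /is_part /= inE negb_or => /andP[ps /andP[r0 nT]].
have [tT aT] : tabl T /\ bounded m T.
  apply: IH; split.
  - by rewrite /is_part (path_sorted ps).
  - by move=> [r j] h; have := bd (r.+1, j); rewrite mc => /(_ h).
  - by move=> r j; have := rw r.+1 j; rewrite !mc.
  - by move=> r j; have := cl r.+1 j; rewrite !mc.
have sr : sorted leq row.
  by apply/(sortedP 0) => j hj; have := rw 0 j; rewrite !m0 => /(_ (ltnW hj) hj).
have le : size (head [::] T) <= size row by case: (T) ps => //= row' T' /andP[].
have ck : colok row T.
  rewrite /colok le /=; apply/allP => j; rewrite mem_iota /= add0n => hj.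
  have := cl 0 j; rewrite m0 mc mem_tab_cells /tab_entry /= nth0 hj andbT; apply.
    exact: leq_trans hj le.
  by case: (T) hj.
rewrite /= sr ck tT aT -size_eq0 eq_sym r0; split=> //; rewrite andbT.
by apply/allP => a /(nthP 0)[j hj <-]; have := bd (0, j); rewrite m0; apply.
Qed.

Lemma tabl_semistandard m t : tabl t -> bounded m t -> semistandard m t.
Proof.
elim: t => [_ _|row T IH tt /= /andP[ar aT]].
  by split=> // r j; rewrite mem_tab_cells.
have [sr ck tT] := tabl_parts tt; have [pT bT rT cT] := IH tT aT.
split.
- move: tt => /= /and4P[_ nr _ _]; move: pT => /andP[pT1 pT2].
  rewrite /is_part /= inE negb_or pT2 andbT eq_sym size_eq0 nr andbT.
  by case: (T) ck pT1 => //= row' T' /andP[h _] ->; rewrite andbT.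
- move=> [[|r] j]; rewrite mem_tab_cells /= => h.
    by apply: (allP ar); apply: mem_nth.
  by apply: (bT (r, j)); rewrite mem_tab_cells.
- move=> [|r] j; rewrite !mem_tab_cells /= => h1 h2; first exact: sorted_nth.
  by apply: rT; rewrite mem_tab_cells.
- move=> [|r] j; rewrite !mem_tab_cells /= => h1 h2.
    have c0 : (0, j) \in tab_cells T by rewrite mem_tab_cells.
    by have [_] := tabl_col tt c0; rewrite addn0.
  by apply: cT; rewrite mem_tab_cells.
Qed.

Lemma bounded_le m m' t : m <= m' -> bounded m t -> bounded m' t.
Proof. by move=> le; apply: sub_all => row; apply: sub_all => a; lia. Qed.

Lemma tabl_is_part t : tabl t -> is_part (tab_shape t).
Proof.
elim: t => //= row T IH /and4P[_ nr ck /IH/andP[h1 h2]].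
rewrite /is_part /= inE negb_or h2 andbT eq_sym size_eq0 nr andbT.
by case: (T) ck h1 => //= row' T' /andP[h _] ->; rewrite andbT.
Qed.

(** The highest weight tableau of shape [la], with all entries raised by [k]. *)
Fixpoint hw k la : seq (seq nat) := if la is a :: l then nseq a k.+1 :: hw k.+1 l else [::].

Definition wsum k la := \sum_(i < size la) (k + i).+1 * nth 0 la i.

Lemma wsum_cons k a l : wsum k (a :: l) = k.+1 * a + wsum k.+1 l.
Proof.
by rewrite /wsum big_ord_recl addn0; congr addn; apply: eq_bigr => i _ /=; rewrite addSnnS.
Qed.

Lemma sumn_row_leqif k row : all (ltn k) row ->
  k.+1 * size row <= sumn row ?= iff (row == nseq (size row) k.+1).
Proof.
elim: row => [_|a row IH /= /andP[ka /IH h]]; first by rewrite muln0; split.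
by rewrite mulnS eqseq_cons eq_sym; apply: leqif_add => //; apply: leqif_eq.
Qed.

Lemma tabl_above k row T : tabl (row :: T) -> all (ltn k) row -> all (all (ltn k.+1)) T.
Proof.
move=> tt ar.
apply/allP => row' /(nthP [::])[r rT <-]; apply/allP => a /(nthP 0)[j hj <-].
have cc : (r, j) \in tab_cells T by rewrite mem_tab_cells /= rT.
have [jr] := tabl_col tt cc; rewrite /tab_entry /=.
by have := allP ar _ (mem_nth 0 jr); rewrite /=; lia.
Qed.

(** Columns increase strictly, so an entry of row [r] is at least [k + r + 1]. *)
Lemma sumn_tab_leqif k t : tabl t -> all (all (ltn k)) t ->
  wsum k (tab_shape t) <= sumn (flatten t) ?= iff (t == hw k (tab_shape t)).
Proof.
elim: t k => [|row T IH] k; first by rewrite /wsum big_ord0; split.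
move=> tt /= /andP[ar aT]; have [_ _ tT] := tabl_parts tt.
rewrite wsum_cons sumn_cat eqseq_cons; apply: leqif_add; first exact: sumn_row_leqif.
exact: IH tT (tabl_above tt ar).
Qed.

Lemma sum_count_mem (g : nat -> nat) m s : all (fun a => 0 < a <= m) s ->
  \sum_(i < m) g i.+1 * count_mem i.+1 s = \sum_(a <- s) g a.
Proof.
elim: s => [_|a s IH /= /andP[ha /IH hs]].
  by rewrite big_nil big1 // => i _; rewrite muln0.
rewrite big_cons -hs; under eq_bigr do rewrite mulnDr.
rewrite big_split /=; congr addn.
have lt : a.-1 < m by lia.
rewrite (bigD1 (Ordinal lt)) //= prednK ?eqxx ?muln1; last by case/andP: ha.
rewrite big1 ?addn0 // => i ne; case: eqP => [ea|_]; last by rewrite muln0.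
by case/eqP: ne; apply: val_inj; rewrite /= ea.
Qed.

Lemma bounded_flatten m t : bounded m t = all (fun a => 0 < a <= m) (flatten t).
Proof. by elim: t => //= row T ->; rewrite all_cat. Qed.

Lemma wsum_weight m t : bounded m t -> wsum 0 (tab_weight m t) = sumn (flatten t).
Proof.
rewrite bounded_flatten => /(sum_count_mem id) h; rewrite sumnE -h /wsum size_mkseq.
by apply: eq_bigr => i _; rewrite nth_mkseq // add0n.
Qed.

Lemma sumn_weight m t : bounded m t -> sumn (tab_weight m t) = sumn (tab_shape t).
Proof.
rewrite bounded_flatten => /(sum_count_mem (fun=> 1)) h.
rewrite -[tab_shape t]/(shape t) -size_flatten -sum1_size -h sumnE big_map.
rewrite -{1}[m]subn0 -/(index_iota 0 m) big_mkord.
by apply: eq_bigr => i _; rewrite mul1n.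
Qed.

Lemma shape_hw k la : tab_shape (hw k la) = la.
Proof. by elim: la k => //= a l IH k; rewrite size_nseq IH. Qed.

Lemma nth_hw k la r : nth [::] (hw k la) r = nseq (nth 0 la r) (k + r).+1.
Proof.
elim: la k r => [|a l IH] k [|r] //=; first by rewrite addn0.
by rewrite IH addSnnS.
Qed.

Lemma hw_bounds k la : all (all (fun a => k < a <= k + size la)) (hw k la).
Proof.
elim: la k => //= a l IH k; apply/andP; split; first by rewrite all_nseq; lia.
by apply: sub_all (IH k.+1) => row; apply: sub_all => b; lia.
Qed.

Lemma tabl_hw k la : is_part la -> tabl (hw k la).
Proof.
elim: la k => //= a l IH k; rewrite /is_part /= inE negb_or => /andP[pa /andP[a0 l0]].
rewrite IH; last by rewrite /is_part (path_sorted pa).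
have -> : sorted leq (nseq a k.+1).
  by apply/(sortedP 0) => j; rewrite size_nseq => h; rewrite !nth_nseq h (ltnW h).
rewrite -size_eq0 size_nseq eq_sym a0 andbT /= /colok size_nseq.
case: l pa {IH l0} => //= b l /andP[ba _]; rewrite size_nseq; apply/andP; split=> //.
apply/allP => j; rewrite mem_iota /= add0n => jb.
by rewrite !nth_nseq jb (leq_trans jb ba).
Qed.

Lemma count_hw k la i : count_mem (k + i).+1 (flatten (hw k la)) = nth 0 la i.
Proof.
elim: la k i => [|a l IH] k i; first by rewrite nth_nil.
rewrite /= count_cat count_nseq /=; case: i => [|i]; last first.
  by rewrite -addSnnS IH (_ : (_ == _) = false) ?mul0n //; lia.
rewrite addn0 eqxx mul1n (_ : count_mem _ _ = 0) ?addn0 //.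
apply/count_memPn/negP => /flattenP[row rh kr].
by have := allP (allP (hw_bounds k.+1 l) _ rh) _ kr; lia.
Qed.

Lemma hw_semistandard la : is_part la -> semistandard (size la) (hw 0 la).
Proof.
move=> pl; apply: tabl_semistandard; first exact: tabl_hw.
exact: (hw_bounds 0 la).
Qed.

Lemma hw_weight la m : tab_weight m (hw 0 la) = mkseq (nth 0 la) m.
Proof. by apply: eq_map => i; rewrite -(count_hw 0 la i). Qed.

(** Operators e lead from any tableau to [hw], the only one of its shape killed by all of them
    ([tab_highest]); they end because each lowers the sum of the entries. *)
Lemma tab_connected m (K : seq (seq nat) -> Prop) :
  (forall i t t', 0 < i < m -> tab_e i t = Some t' -> K t <-> K t') ->
  forall t, tabl t -> bounded m t -> K t <-> K (hw 0 (tab_shape t)).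
Proof.
move=> hK t; have [N] := ubnP (sumn (flatten t)); elim: N t => // N IH t sz tt bt.
have [/hasP[i]|nh] := boolP (has (fun i => tab_e i t != None) (iota 1 m.-1)).
  rewrite mem_iota; case e : (tab_e i t) => [t'|//] hi _.
  have im : 0 < i < m by lia.
  have [tt' st' bt'] := tabl_e tt e; have [_ <- _] := tab_e_inv e.
  have := IH t'; rewrite -st' in sz; move=> /(_ sz tt') IH'.
  apply: iff_trans (hK _ _ _ im e) _; apply: IH'; apply: bt' => //; lia.
suff {1}-> : t = hw 0 (tab_shape t) by [].
apply: (@eq_from_nth _ [::]) => [|r rt]; 
  first by rewrite -(size_map size (hw _ _)) -/(tab_shape (hw _ _)) shape_hw size_map.
rewrite nth_hw (nth_map [::]) //; apply: (tab_highest tt bt) => // i im.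
apply/eqP/negPn/negP => h; case/hasP: nh; exists i => //; rewrite mem_iota; lia.
Qed.

(** * Finiteness and triangularity of the Schur coefficients *)

Local Open Scope classical_set_scope.

Lemma fset_setP (T : choiceType) (A : set T) a : finite_set A -> reflect (A a) (a \in fset_set A).
Proof. by move=> fA; rewrite in_fset_set //; apply: (iffP idP) => [/set_mem|/mem_set]. Qed.

Definition ssyt la al := [set t : seq (seq nat) |
  [/\ semistandard (size al) t, tab_shape t = la & tab_weight (size al) t = al]].

Definition parts N := [set la : seq nat | is_part la /\ sumn la = N].

Lemma ssyt_finite la al : finite_set (ssyt la al).
Proof.
apply: (@sub_finite_set _ _ [set reshape la (map val (u : seq _)) |
  u in [set: (sumn la).-tuple 'I_(size al).+1]]); last exact/finite_image/finite_finset.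
move=> t [/semistandard_tabl[_ bt] <- _].
have sz : size [seq inord a : 'I_(size al).+1 | a <- flatten t] == sumn (tab_shape t).
  by rewrite size_map size_flatten.
exists (Tuple sz) => //=; rewrite -map_comp map_id_in ?flattenK // => a af /=.
by rewrite inordK //; move: bt; rewrite bounded_flatten => /allP/(_ _ af); lia.
Qed.

Lemma parts_finite N : finite_set (parts N).
Proof.
apply: (@sub_finite_set _ _ [set map val (u : seq _) | u in [set: {bseq N of 'I_N.+1}]]);
  last exact/finite_image/finite_finset.
move=> la [/andP[_ l0] sl].
have sz : size [seq inord a : 'I_N.+1 | a <- la] <= N.
  rewrite size_map -sl; elim: la l0 {sl} => //= a l IH; rewrite inE negb_or => /andP[a0 /IH].
  by case: a a0 => //= a _; lia.
exists (Bseq sz) => //=; rewrite -map_comp map_id_in // => a al /=.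
rewrite inordK // ltnS -sl; elim: la al {l0 sl sz} => //= b l IH.
by rewrite inE => /predU1P[->|/IH]; lia.
Qed.

Lemma schur0 la al : is_part la -> ~ parts (sumn al) la -> schur la al = 0%R.
Proof.
move=> pl nl; rewrite /schur (_ : [set t | _] = set0) ?fset_set0 //.
rewrite predeqE => t; split=> // -[/semistandard_tabl[_ bt] et wt]; case: nl; split=> //.
by rewrite -{1}wt sumn_weight // et.
Qed.

(** Only partitions of [sumn al] contribute, so the sum becomes one over a fixed finite set. *)
Lemma schur_sumE c al : (\sum_(la \in [set la : seq nat | is_part la]) c la * schur la al)%R =
  (\sum_(la <- fset_set (parts (sumn al))) c la * schur la al)%R.
Proof.
rewrite (@fsbigE _ _ _ _ _ (fset_set (parts (sumn al)))).
- rewrite big_seq_cond [RHS]big_seq; apply: eq_bigl => la.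
  case: (fset_setP la (parts_finite (sumn al))) => //= -[pl _].
  by apply: mem_set.
- exact: fset_uniq.
- by move=> la /= /(fset_setP _ (parts_finite _)) [].
- move=> la pl /negP nl; rewrite schur0 ?GRing.mulr0 // => h; apply: nl.
  by apply/(fset_setP _ (parts_finite _)).
Qed.

Lemma schur_triangular la mu : is_part la -> is_part mu -> la <> mu ->
  schur la mu = 0%R \/ wsum 0 la < wsum 0 mu.
Proof.
move=> pl pm ne; case: (pselect (exists t, ssyt la mu t)) => [[t [st et wt]]|nt]; last first.
  left; rewrite /schur (_ : [set t | _] = set0) ?fset_set0 //.
  by rewrite predeqE => t; split=> // h; case: nt; exists t.
right; have [tt bt] := semistandard_tabl st.
have b0 : all (all (ltn 0)) t by apply: sub_all bt => row; apply: sub_all => a /andP[].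
have [le eq] := sumn_tab_leqif tt b0.
(* The sum of the entries of [t] is [wsum 0 mu]; equality would make [t] the tableau [hw 0 la],
   whose weight is given by [la]. *)
rewrite -wt wsum_weight // -et ltn_neqAle le eq andbT; apply/negP => /eqP eh.
apply: ne; rewrite et in eh; move: wt; rewrite eh hw_weight => wt.
(* So far [mu] is [la] cut, or padded with zeros, to the size of [mu]. The bound on the entries
   excludes a cut, and the nonzero parts of [mu] exclude padding. *)
have sz : size la = size mu.
  apply/eqP; rewrite eqn_leq; apply/andP; split; rewrite leqNgt; apply/negP => lt.
    have : (size mu).+1 \in nth [::] t (size mu).
      rewrite eh nth_hw add0n mem_nseq eqxx andbT lt0n; apply/negP => /eqP e0.
      by case/andP: pl => _ /negP; apply; rewrite -e0 mem_nth.
    have mt : size mu < size t by rewrite -(size_map size) -/(tab_shape t) et.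
    by move=> /(allP (allP bt _ (mem_nth [::] mt))); rewrite ltnn andbF.
  case/andP: pm => _ /negP; apply; rewrite -wt; apply/(nthP 0).
  by exists (size la); rewrite ?size_mkseq // nth_mkseq // nth_default.
by rewrite -[LHS](mkseq_nth 0) sz.
Qed.

Lemma schur_diag mu : is_part mu -> schur mu mu <> 0%R.
Proof.
move=> pm; have /(fset_setP _ (ssyt_finite _ _)) h : ssyt mu mu (hw 0 mu).
  split; [exact: hw_semistandard|exact: shape_hw|by rewrite hw_weight mkseq_nth].
by rewrite /schur => -[] /eqP; rewrite cardfs_eq0 => /eqP e0; move: h; rewrite /ssyt e0 inE.
Qed.

(** At the monomial [mu] only [mu] itself and partitions of smaller [wsum] contribute, and
    [schur mu mu] is not zero. *)
Lemma schur_expansion_unique F c c' : schur_expansion F c -> schur_expansion F c' ->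
  forall mu, is_part mu -> c mu = c' mu.
Proof.
move=> hc hc' mu; have [N] := ubnP (wsum 0 mu); elim: N mu => // N IH mu sz pm.
have := hc mu; rewrite hc' !schur_sumE.
have mr : mu \in fset_set (parts (sumn mu)) by apply/(fset_setP _ (parts_finite _)).
rewrite !(bigD1_seq mu) //= ?fset_uniq //.
have -> : (\sum_(la <- fset_set (parts (sumn mu)) | la != mu) c' la * schur la mu =
    \sum_(la <- fset_set (parts (sumn mu)) | la != mu) c la * schur la mu)%R.
  rewrite big_seq_cond [RHS]big_seq_cond; apply: eq_bigr => la /andP[/(fset_setP _ (parts_finite _))[pl _] /eqP ne].
  by have [->|lt] := schur_triangular pl pm ne; rewrite ?GRing.mulr0 // IH //; lia.
by move/GRing.addIr/(GRing.mulIf (introN eqP (schur_diag pm)))->.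
Qed.

Lemma schur_coefE F c la : schur_expansion F c -> is_part la -> schur_coef F la = c la.
Proof.
move=> hc pl; apply: (@schur_expansion_unique F) => //.
by apply: (@xgetPex _ _ [set c | schur_expansion F c]); exists c.
Qed.

Lemma sum_count_fibers (T I : eqType) (h : T -> I) (s : seq T) (r : seq I) : uniq r ->
  {in s, forall a, h a \in r} -> \sum_(j <- r) count (fun a => h a == j) s = size s.
Proof.
move=> ur; elim: s => [_|a s IH hs] /=; first by rewrite big1.
rewrite big_split /= IH => [|b bs]; last by apply: hs; rewrite inE bs orbT.
have cm : count_mem (h a) r = 1 by rewrite count_uniq_mem // hs ?mem_head.
rewrite -[in RHS]add1n; congr addn; rewrite -cm.
by elim: r {IH cm ur hs} => [|j r IHr]; rewrite ?big_nil // big_cons IHr /= eq_sym.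
Qed.

(** * The crystal of factorizations *)

(** Appending empty factors makes factorizations with different numbers of factors comparable. *)
Lemma nP_rcons0 F : nP (rcons F [::]) = nP F.
Proof. by rewrite /nP flatten_rcons cats0. Qed.

Lemma nQ_rcons0 F : nQ (rcons F [::]) = nQ F.
Proof.
rewrite !nQE nP_rcons0 size_rcons; apply: eq_map => r; rewrite qrowS.
have tk i : i <= size F -> take i (rcons F [::]) = take i F by move=> h; rewrite -cats1 takel_cat.
rewrite (@take_oversize _ (size F).+1) ?size_rcons // tk // take_size nP_rcons0 subnn cats0 /qrow.
congr flatten; apply/eq_in_map => i; rewrite mem_iota /= add0n => iF.
by rewrite !tk // ltnW.
Qed.

Lemma cat_nseqS (F : seq (seq nat)) k : F ++ nseq k.+1 [::] = rcons (F ++ nseq k [::]) [::].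
Proof. by rewrite -cats1 -catA; congr cat; elim: k => //= k <-. Qed.

Lemma nP_pad F k : nP (F ++ nseq k [::]) = nP F.
Proof. by elim: k => [|k IH]; rewrite ?cats0 // cat_nseqS nP_rcons0. Qed.

Lemma nQ_pad F k : nQ (F ++ nseq k [::]) = nQ F.
Proof. by elim: k => [|k IH]; rewrite ?cats0 // cat_nseqS nQ_rcons0. Qed.

Lemma flatten_pad (F : seq (seq nat)) k : flatten (F ++ nseq k [::]) = flatten F.
Proof. by elim: k => [|k IH]; rewrite ?cats0 // cat_nseqS flatten_rcons cats0. Qed.

Section Crystal.
Variables (n : nat) (x : 'I_n) (w : affine_sym n).
Hypothesis pw : parabolic x w.
Notation okw := (okw n).
Notation red := (red x).
Notation celt := (celt x).
Notation facts := (facts x).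
Notation toF := (toF x).
Notation ofF := (ofF x).
Notation fact := (affine_factorization w).

Lemma facts_pad F k : facts (F ++ nseq k [::]) = facts F.
Proof. by rewrite /facts flatten_pad all_cat all_nseq orbT andbT. Qed.

Lemma fact_split m f i : fact m f -> 0 < i < m ->
  exists f1 g1 g2 f2, f = f1 ++ g1 :: g2 :: f2 /\ i = (size f1).+1.
Proof.
case=> sf _ _ _ im.
exists (take i.-1 f), (nth 1%g f i.-1), (nth 1%g f i), (drop i.+1 f); split; last first.
  by rewrite size_takel; lia.
have i1 : i.-1 < size f by lia.
have i2 : i < size f by lia.
rewrite -{1}(cat_take_drop i.-1 f) (drop_nth 1%g i1) prednK; last by case/andP: im.
by rewrite (drop_nth 1%g i2).
Qed.

Lemma ofF_fact_of m F : facts F -> celt (flatten F) = w -> size F = m -> fact m (ofF F).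
Proof. by move=> fF <- <-; apply: ofF_fact. Qed.

Lemma fact_e_tab m f i : fact m f -> 0 < i < m ->
  match fact_e x i f with
  | Some g => [/\ fact m g, nP (toF g) = nP (toF f) & tab_e i (nQ (toF f)) = Some (nQ (toF g))]
  | None => tab_e i (nQ (toF f)) = None
  end.
Proof.
move=> ff /(fact_split ff)[f1 [g1 [g2 [f2 [ef ->]]]]]; subst f.
have [E [hE [h0 h1]]] := fact_e_spec pw ff.
have fF := split_facts pw ff; have cF := toF_celt pw ff; have sF := size_toF x ff.
have [c1 c2] := core_e fF; rewrite size_map in c1 c2.
rewrite split_toF in cF sF *.
have [E0|E0] := posnP E.
  by rewrite h0 //; apply/eqP; rewrite tab_e_None (c1 _ hE) E0.
have [A' [B' [b [c [es ->]]]]] := h1 E0.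
have fG := step_facts fF es; rewrite toF_ofF //; split.
- apply: ofF_fact_of => //; first by rewrite (step_celt fF es).
  by move: sF; rewrite !size_cat.
- exact: step_nP fF es.
- exact: c2 es.
Qed.

Lemma fact_f_tab m f i : fact m f -> 0 < i < m ->
  match fact_f x i f with
  | Some g => [/\ fact m g, nP (toF g) = nP (toF f) & tab_f i (nQ (toF f)) = Some (nQ (toF g))]
  | None => tab_f i (nQ (toF f)) = None
  end.
Proof.
move=> ff /(fact_split ff)[f1 [g1 [g2 [f2 [ef ->]]]]]; subst f.
have [E [hE [h0 h1]]] := fact_f_spec pw ff.
have fF := split_facts pw ff; have cF := toF_celt pw ff; have sF := size_toF x ff.
have [c1 _] := core_e fF; rewrite size_map in c1.
rewrite split_toF in cF sF *.
set F1 := toF f1 in fF cF sF h1 c1 *; set F2 := toF f2 in fF cF sF h1 c1 *.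
have s1 : size F1 = size f1 by rewrite size_map.
set A := nasc x (con g1) in hE h0 h1 fF cF sF c1 *.
set B := nasc x (con g2) in hE h0 h1 fF cF sF c1 *.
case e : (fact_f _ _ _) => [g|]; last first.
  apply: tab_f_None; first exact: tabl_nQ fF.
  rewrite (c1 _ hE) -s1 (nQ_weight fF) ?(nQ_weight fF); last 2 first.
  - by rewrite size_cat /=; lia.
  - by rewrite size_cat /=; lia.
  by rewrite !nth_cat ltnn ltnNge leqnSn /= subSn // subnn /= h0.
have [A' [B' [d [a [es ec er -> /andP[sA' sB']]]]]] := h1 _ e.
have zA := estep_sizeA sA' sB' er es; have zB := estep_sizeB sB' es.
have fG : facts (F1 ++ A' :: B' :: F2).
  move: fF; rewrite /facts !all_cat /= !flatten_pair => /andP[/and4P[-> _ _ ->] rF].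
  rewrite sA' sB' /=; apply: (red_eq rF).
  - by have := red_ok rF; have := red_ok er; rewrite !okw_cat => -> /and3P[-> _ ->].
  - by rewrite !size_cat; lia.
  - exact: celt_ctx ec.
rewrite toF_ofF //; split.
- apply: ofF_fact_of => //; first by rewrite -cF (step_celt fG es).
  by move: sF; rewrite !size_cat.
- by rewrite (step_nP fG es).
(* As e takes the new factorization back to the old one, [tab_e_inv] yields the claim for f. *)
have [_ c2] := core_e fG; have := c2 _ _ _ _ _ es; rewrite s1.
by move=> /tab_e_inv[].
Qed.

Definition fam m F := [/\ facts F, celt (flatten F) = w & size F = m].

Lemma fam_toF m f : fact m f -> fam m (toF f).
Proof. by move=> ff; split; [exact: toF_facts ff|exact: toF_celt ff|exact: size_toF ff]. Qed.

Lemma fam_ofF m F : fam m F -> fact m (ofF F) /\ toF (ofF F) = F.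
Proof. by case=> fF cF sF; split; [exact: ofF_fact_of|exact: toF_ofF]. Qed.

(** The recording tableaux of the factorizations with a given P are closed under e and f, so by
    connectedness they exhaust their shape. *)
Lemma fact_connected m f t : fact m f -> semistandard m t ->
  tab_shape t = tab_shape (nP (toF f)) ->
  exists g, [/\ fact m g, nP (toF g) = nP (toF f) & nQ (toF g) = t].
Proof.
move=> ff /semistandard_tabl[tt bt] sh.
pose K t := exists g, [/\ fact m g, nP (toF g) = nP (toF f) & nQ (toF g) = t].
have hK i u u' : 0 < i < m -> tab_e i u = Some u' -> K u <-> K u'.
  move=> im eu; split=> -[g [fg eP eQ]].
    have := fact_e_tab fg im; rewrite eQ eu; case: (fact_e x i g) => // g' [fg' eP' [->]].
    by exists g'; rewrite eP'.
  have [fu _ _] := tab_e_inv eu.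
  have := fact_f_tab fg im; rewrite eQ fu; case: (fact_f x i g) => // g' [fg' eP' [->]].
  by exists g'; rewrite eP'.
have fF := toF_facts pw ff; have sF := size_toF x ff.
apply/(tab_connected hK tt bt); rewrite sh -nQ_shape; apply: (proj1 (tab_connected hK _ _)).
- exact: tabl_nQ fF.
- by rewrite -sF; apply: nQ_bounds fF.
- by exists f.
Qed.

(** The number of factors is left free, so that the multiplicities do not depend on it. *)
Definition Ptab P := exists m F, fam m F /\ nP F = P.

Lemma fam_full P m t : Ptab P -> semistandard m t -> tab_shape t = tab_shape P ->
  exists F, [/\ fam m F, nP F = P & nQ F = t].
Proof.
move=> [m0 [F0 [[fF0 cF0 sF0] eP]]] st sh; have [tt bt] := semistandard_tabl st.
have fam' : fam (m0 + m) (F0 ++ nseq m [::]).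
  by split; rewrite ?facts_pad ?flatten_pad // size_cat size_nseq sF0.
have [ff' eF'] := fam_ofF fam'.
have st' : semistandard (m0 + m) t.
  by apply: tabl_semistandard tt (bounded_le (leq_addl _ _) bt).
have [|g [fg gP gQ]] := fact_connected ff' st'; first by rewrite eF' nP_pad eP.
have [fG cG sG] := fam_toF fg; rewrite eF' nP_pad eP in gP.
set G := toF g in fG cG sG gP gQ.
have eG : G = take m G ++ nseq m0 [::].
  rewrite -{1}(cat_take_drop m G); congr cat.
  have sd : size (drop m G) = m0 by rewrite size_drop sG addnK.
  rewrite -sd; apply/all_pred1P/(all_nthP [::]) => i; rewrite sd => im /=.
  have lt : m + i < size G by rewrite sG; lia.
  rewrite nth_drop -size_eq0 -(nQ_weight fG lt) gQ; apply/eqP/count_memPn/negP => h.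
  by move: bt; rewrite bounded_flatten => /allP/(_ _ h); lia.
exists (take m G); split.
- split; first exact: facts_take.
    by rewrite -cG [in RHS]eG flatten_pad.
  by rewrite size_takel // sG leq_addl.
- by rewrite -gP [in RHS]eG nP_pad.
- by rewrite -gQ [in RHS]eG nQ_pad.
Qed.

Lemma fam_semistandard m F : fam m F -> semistandard m (nQ F).
Proof.
case=> fF _ <-; apply: tabl_semistandard; [exact: tabl_nQ fF|exact: nQ_bounds fF].
Qed.

Lemma fam_weight m F : fam m F -> tab_weight m (nQ F) = map size F.
Proof.
case=> fF _ <-; rewrite /tab_weight -[in RHS](mkseq_nth [::] F) /mkseq -map_comp.
by apply/eq_in_map => i; rewrite mem_iota => /= iF; rewrite (nQ_weight fF).
Qed.

Local Open Scope classical_set_scope.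

Lemma fam_finite m : finite_set [set F | fam m F].
Proof.
apply: (@sub_finite_set _ _ [set map (nasc x) (u : seq _) | u in [set: m.-tuple {set 'I_n}]]);
  last exact/finite_image/finite_finset.
move=> F fm; have [ff eF] := fam_ofF fm; have [_ _ sF] := fm.
have sz : size (map (@con n) (ofF F)) == m by rewrite !size_map sF.
by exists (Tuple sz) => //=; rewrite -[RHS]eF -map_comp.
Qed.

Lemma fact_finite m : finite_set [set f | fact m f].
Proof.
apply: (@sub_finite_set _ _ [set ofF F | F in [set F | fam m F]]); last exact/finite_image/fam_finite.
by move=> f ff; exists (toF f); [exact: fam_toF|exact: ofF_toF ff].
Qed.

Definition Ptabs la := [set P | Ptab P /\ tab_shape P = la].

(** Every such P already occurs with [size la] factors, recorded by the highest weight tableau. *)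
Lemma Ptabs_finite la : is_part la -> finite_set (Ptabs la).
Proof.
move=> pl; apply: (@sub_finite_set _ _ [set nP F | F in [set F | fam (size la) F]]);
  last exact/finite_image/fam_finite.
move=> P [hP sP]; have [|F [fF eP _]] := fam_full hP (hw_semistandard pl).
  by rewrite shape_hw.
by exists F.
Qed.

Definition mult la := #|` fset_set (Ptabs la)|.

Definition fact_shape f := tab_shape (nP (toF f)).

Definition fact_of_weight al := [set f | fact (size al) f /\ fact_weight f = al].

Lemma fact_of_weight_finite al : finite_set (fact_of_weight al).
Proof. by apply: sub_finite_set (fact_finite (size al)) => f []. Qed.

Lemma fact_shape_part m f : fact m f -> is_part (fact_shape f).
Proof.
by move=> ff; have [fF _ _] := fam_toF ff; rewrite /fact_shape -nQ_shape tabl_is_part // (tabl_nQ fF).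
Qed.

Lemma Ptabs_fact m f : fact m f -> Ptabs (fact_shape f) (nP (toF f)).
Proof. by move=> ff; split=> //; exists m, (toF f); split=> //; apply: fam_toF. Qed.

Lemma fact_PQ_inj m f g : fact m f -> fact m g ->
  nP (toF f) = nP (toF g) -> nQ (toF f) = nQ (toF g) -> f = g.
Proof.
move=> ff fg eP eQ; rewrite -(ofF_toF pw ff) -(ofF_toF pw fg).
have [h1 _ s1] := fam_toF ff; have [h2 _ s2] := fam_toF fg.
by rewrite (nPQ_inj h1 h2 _ eP eQ) // s1.
Qed.

(** The map to pairs (P, Q) is injective by [nPQ_inj] and reaches every pair of the right shape and
    weight by [fam_full]. *)
Lemma fact_fiber_card la al : is_part la ->
  count (fun f => fact_shape f == la) (fset_set (fact_of_weight al)) =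
  mult la * #|` fset_set (ssyt la al)|.
Proof.
move=> pl; pose h f := (nP (toF f), nQ (toF f)).
have memS := fset_setP _ (fact_of_weight_finite al).
have memP := fset_setP _ (Ptabs_finite pl).
have memT := fset_setP _ (ssyt_finite la al).
rewrite -size_filter -(size_map h) /mult -(@size_allpairs _ _ _ (fun P t => (P, t))).
apply/perm_size/uniq_perm.
- rewrite map_inj_in_uniq ?filter_uniq ?fset_uniq // => f g.
  rewrite !mem_filter => /andP[_ /memS[ff _]] /andP[_ /memS[fg _]] [eP eQ].
  exact: fact_PQ_inj ff fg eP eQ.
- by apply: allpairs_uniq; rewrite ?fset_uniq // => -[P t] [P' t'].
move=> [P t]; apply/mapP/allpairsP => [[f]|[[P' t'] /= [/memP[hP sP] /memT[st et wt] [-> ->]]]].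
  rewrite mem_filter => /andP[/eqP sf /memS[ff wf]] [-> ->].
  exists (nP (toF f), nQ (toF f)) => /=; split=> //.
    by apply/memP; rewrite -sf; apply: Ptabs_fact ff.
  apply/memT; have fm := fam_toF ff; split; first exact: fam_semistandard.
    by rewrite nQ_shape.
  by rewrite (fam_weight fm) -(toF_weight x ff).
have [|F [fm eP eQ]] := fam_full hP st; first by rewrite et sP.
have [ff eF] := fam_ofF fm; exists (ofF F); last by rewrite /h eF eP eQ.
rewrite mem_filter /fact_shape eF eP sP eqxx /=; apply/memS; split=> //.
by rewrite (toF_weight x ff) eF -(fam_weight fm) eQ.
Qed.

Lemma stanley_expansion : schur_expansion (stanley w) (fun la => Posz (mult la)).
Proof.
move=> al; rewrite schur_sumE /stanley -/(fact_of_weight al).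
have memS := fset_setP _ (fact_of_weight_finite al).
have memR := fset_setP _ (parts_finite (sumn al)).
rewrite -(@sum_count_fibers _ _ fact_shape _ (fset_set (parts (sumn al)))) ?fset_uniq //; last first.
  move=> f /memS[ff wf]; apply/memR; split; first exact: fact_shape_part ff.
  have fm := fam_toF ff; have [_ bt] := semistandard_tabl (fam_semistandard fm).
  by rewrite /fact_shape -nQ_shape -(sumn_weight bt) (fam_weight fm) -(toF_weight x ff) wf.
rewrite (big_morph Posz PoszD (erefl _)) big_seq [RHS]big_seq.
apply: eq_bigr => la /memR[pl _].
by rewrite fact_fiber_card // PoszM.
Qed.

(** The place of P among the tableaux of its shape numbers the copies of B(la). *)
Definition Pindex P := index P (fset_set (Ptabs (tab_shape P))).

Definition crystal_map f := ((fact_shape f, Pindex (nP (toF f))), eg_Q x f).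

Lemma crystal_map_e m i f : fact m f -> 0 < i < m ->
  omap crystal_map (fact_e x i f) = omap (pair (crystal_map f).1) (tab_e i (eg_Q x f)).
Proof.
move=> ff im; have := fact_e_tab ff im; rewrite (eg_QE pw ff).
case: (fact_e x i f) => [g [fg eP ->]|->//] /=.
by rewrite /crystal_map /fact_shape eP (eg_QE pw fg).
Qed.

Lemma crystal_map_f m i f : fact m f -> 0 < i < m ->
  omap crystal_map (fact_f x i f) = omap (pair (crystal_map f).1) (tab_f i (eg_Q x f)).
Proof.
move=> ff im; have := fact_f_tab ff im; rewrite (eg_QE pw ff).
case: (fact_f x i f) => [g [fg eP ->]|->//] /=.
by rewrite /crystal_map /fact_shape eP (eg_QE pw fg).
Qed.

Lemma crystal_map_bij m :
  set_bij (vertices (fact_crystal x w m)) (vertices (tab_crystal_dsum m mult)) crystal_map.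
Proof.
split.
- move=> f ff; have pl := fact_shape_part ff; split=> /=.
    split=> //; rewrite /mult /Pindex index_mem.
    by apply/(fset_setP _ (Ptabs_finite pl)); apply: Ptabs_fact ff.
  by rewrite (eg_QE pw ff); split; [exact: fam_semistandard (fam_toF ff)|rewrite nQ_shape].
- move=> f g /set_mem ff /set_mem fg; rewrite /crystal_map (eg_QE pw ff) (eg_QE pw fg).
  move=> [es ei eQ]; apply: (fact_PQ_inj ff fg) => //.
  have mem h : fact m h -> nP (toF h) \in fset_set (Ptabs (fact_shape h)).
    by move=> fh; apply/(fset_setP _ (Ptabs_finite (fact_shape_part fh))); apply: Ptabs_fact fh.
  move: ei; rewrite /Pindex -!/(fact_shape _) es => ei.
  have mf := mem f ff; rewrite es in mf.
  by rewrite -(nth_index [::] mf) ei nth_index ?mem.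
- move=> [[la k] t] /= [[pl kl] [st et]]; rewrite /= in pl kl st et.
  pose P := nth [::] (fset_set (Ptabs la)) k.
  have /(fset_setP _ (Ptabs_finite pl))[hP sP] : P \in fset_set (Ptabs la) by apply: mem_nth.
  have [|F [fm eP eQ]] := fam_full hP st; first by rewrite et sP.
  have [ff eF] := fam_ofF fm; exists (ofF F) => //=.
  rewrite /crystal_map /fact_shape (eg_QE pw ff) eF eP eQ sP /Pindex sP index_uniq //.
  exact: fset_uniq.
Qed.

Lemma crystal_map_iso m :
  crystal_iso m (fact_crystal x w m) (tab_crystal_dsum m mult) crystal_map.
Proof.
have bij := crystal_map_bij m; have [hfun _ hsurj] := bij.
have closed : crystal_closed m (fact_crystal x w m).
  move=> i f g im ff [] /= e.
    by have := fact_e_tab ff im; rewrite e => -[].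
  by have := fact_f_tab ff im; rewrite e => -[].
split=> //.
(* Closure of the direct sum is transported from the factorizations through surjectivity. *)
- move=> i b c im vb; have [f ff eb] := hsurj _ vb; subst b.
  have /= he := crystal_map_e ff im; have /= hf := crystal_map_f ff im.
  rewrite /= -he -hf => -[].
    by case e : (fact_e x i f) => [g|] //= [<-]; apply: hfun; apply: (closed i f) => //; left.
  by case e : (fact_f x i f) => [g|] //= [<-]; apply: hfun; apply: (closed i f) => //; right.
- by move=> f ff /=; rewrite (eg_QE pw ff) (fam_weight (fam_toF ff)) (toF_weight x ff).
- by move=> i f im ff; split; [exact: crystal_map_e ff im|exact: crystal_map_f ff im].
Qed.

End Crystal.

Theorem theorem4p11 (n m : nat) (x : 'I_n) (w : affine_sym n)
    (w_parabolic : parabolic x w) :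
  exists a : seq nat -> nat,
    [/\ forall la, is_part la -> schur_coef (stanley w) la = Posz (a la),
        exists h : seq (affine_sym n) -> (seq nat * nat) * seq (seq nat),
          crystal_iso m (fact_crystal x w m) (tab_crystal_dsum m a) h /\
          forall f, affine_factorization w m f -> (h f).2 = eg_Q x f
      & forall i f, 0 < i < m -> affine_factorization w m f ->
          omap (eg_Q x) (fact_e x i f) = tab_e i (eg_Q x f) /\
          omap (eg_Q x) (fact_f x i f) = tab_f i (eg_Q x f)].
Proof.
exists (mult x w); split.
- by move=> la; apply: schur_coefE (stanley_expansion w_parabolic).
- by exists (crystal_map x w); split=> //; apply: crystal_map_iso.
move=> i f im ff.
have := crystal_map_e w_parabolic ff im; have := crystal_map_f w_parabolic ff im.
(* The identities between elements of the direct sum are projected to their tableau components. *)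
by case: (fact_e x i f); case: (tab_e i _); case: (fact_f x i f); case: (tab_f i _) => //=;
  do ?[move=> ? [_ _ ->]|move=> [_ _ ->]|move=> ?|move=> _]; split.
Qed.
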